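(* Let $m,p\in\mathbb{N}=\{0,1,2,\dots\}$ and $\mathbf{x},\mathbf{y}\in\mathbb{R}^2$ with $0<|\mathbf{y}|<|\mathbf{x}|$, and put $r=|\mathbf{y}|/|\mathbf{x}|$. If $p+m\geq|\mathbf{x}|$ and $p+\frac m2>-\frac{m}{\ln r}$, then $$\left|R^H_{m,p}(\mathbf{x},\mathbf{y})\right|\leq\frac{4\sqrt{2}\,C_{p+m+1}(|\mathbf{x}|)\,(2p+m)^m\,r^p}{\pi\,|\mathbf{x}|^m\,\bigl(-(2p+m)\ln r-2m\bigr)}.$$
   Context: $J_n$, $Y_n$ are the Bessel functions of the first and second kind of integer order $n$, $H^{(1)}_n=J_n+\mathrm{i}Y_n$ is the Hankel function of the first kind, and $\theta_{\mathbf{x}}$ denotes the polar angle of $\mathbf{x}\in\mathbb{R}^2$. For $m\in\mathbb{Z}$, $p\in\mathbb{N}$ and $|\mathbf{y}|<|\mathbf{x}|$, $$R^{H}_{m,p}(\mathbf{x},\mathbf{y})=\left(\sum_{n=p+1}^\infty+\sum_{n=-\infty}^{-p-1}\right)H^{(1)}_{m+n}(|\mathbf{x}|)\,e^{\pm\mathrm{i}(m+n)\theta_\mathbf{x}}\,J_n(|\mathbf{y}|)\,e^{\mp\mathrm{i}n\theta_\mathbf{y}},$$ where either the upper signs are taken throughout or the lower signs are taken throughout; the statement holds for both choices. This is the truncation error of Graf's addition theorem for $H^{(1)}_m(|\mathbf{x}-\mathbf{y}|)e^{\pm\mathrm{i}m\theta_{\mathbf{x}-\mathbf{y}}}$ truncated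 to $|n|\le p$. For integers $n\ge1$ and $z>0$, $$C_n(z)=-Y_n(z)\left(\frac{z}{2}\right)^n\frac{\pi}{\Gamma(n)}.$$ *)

(* Defs.v *)
From Stdlib Require Export Reals ZArith.
From Stdlib Require Import Lra Lia.
From Coquelicot Require Export Coquelicot.
Open Scope R_scope.

Definition enorm (v : R * R) : R := sqrt (fst v ^ 2 + snd v ^ 2).

(* The principal value, in (-PI, PI]; see [polar_angleP]. Only integer
   multiples of it are ever exponentiated, so the branch is irrelevant. *)
Definition polar_angle (v : R * R) : R :=
  if Rle_dec 0 (snd v) then acos (fst v / enorm v)
  else - acos (fst v / enorm v).

Definition cis (t : R) : C := (cos t, sin t).

Definition harmonic (n : nat) : R := sum_n_m (fun j => / INR j) 1 n.

Definition euler_gamma : R :=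
  real (Lim_seq (fun n => harmonic n - ln (INR n))).

(* psi(n+1), where psi = Gamma'/Gamma *)
Definition psi_S (n : nat) : R := - euler_gamma + harmonic n.

Definition besselJ_nat (n : nat) (z : R) : R :=
  Series (fun k => (-1) ^ k / (INR (fact k) * INR (fact (n + k)))
                   * (z / 2) ^ (2 * k + n)).

(* The classical expansion
     Y_n(z) = (2/pi) J_n(z) ln(z/2)
       - (1/pi) sum_{0<=k<n} (n-k-1)!/k! (z/2)^(2k-n)
       - (1/pi) sum_{k>=0} (-1)^k (psi(k+1) + psi(n+k+1)) (z/2)^(2k+n)
                           / (k! (n+k)!).
   In the finite sum n = q+1, and [sum_n] includes its upper bound. *)
Definition besselY_nat (n : nat) (z : R) : R :=
  2 / PI * besselJ_nat n z * ln (z / 2)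
  - / PI * match n with
           | O => 0
           | S q => sum_n (fun k => INR (fact (q - k)) / INR (fact k)
                                    * (z / 2) ^ (2 * k) / (z / 2) ^ n) q
           end
  - / PI * Series (fun k => (-1) ^ k * (psi_S k + psi_S (n + k))
                            / (INR (fact k) * INR (fact (n + k)))
                            * (z / 2) ^ (2 * k + n)).

(* J_{-n} = (-1)^n J_n and Y_{-n} = (-1)^n Y_n for integer n. *)
Definition besselJ (n : Z) (z : R) : R :=
  if (n <? 0)%Z then (-1) ^ Z.abs_nat n * besselJ_nat (Z.abs_nat n) z
  else besselJ_nat (Z.abs_nat n) z.

Definition besselY (n : Z) (z : R) : R :=
  if (n <? 0)%Z then (-1) ^ Z.abs_nat n * besselY_nat (Z.abs_nat n) z
  else besselY_nat (Z.abs_nat n) z.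

Definition hankel1 (n : Z) (z : R) : C := (besselJ n z, besselY n z).

Definition Gamma (s : R) : R :=
  RInt_gen (fun t => Rpower t (s - 1) * exp (- t))
           (at_right 0) (Rbar_locally p_infty).

Definition Cfun (n : nat) (z : R) : R :=
  - besselY (Z.of_nat n) z * (z / 2) ^ n * (PI / Gamma (INR n)).

(* [upper = true] selects the upper signs. *)
Definition graf_sign (upper : bool) : R := if upper then 1 else -1.

Definition graf_term (upper : bool) (m : Z) (x y : R * R) (n : Z) : C :=
  (hankel1 (m + n) (enorm x)
   * cis (graf_sign upper * IZR (m + n) * polar_angle x)
   * RtoC (besselJ n (enorm y))
   * cis (- graf_sign upper * IZR n * polar_angle y))%C.

(* The terms n = p+1, p+2, ... and n = -p-1, -p-2, ... *)
Definition graf_tail_pos upper (m : Z) (p : nat) (x y : R * R) (k : nat) : C :=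
  graf_term upper m x y (Z.of_nat (p + 1 + k)).

Definition graf_tail_neg upper (m : Z) (p : nat) (x y : R * R) (k : nat) : C :=
  graf_term upper m x y (- Z.of_nat (p + 1 + k)).

Definition CSeries (u : nat -> C) : C :=
  (Series (fun k => Re (u k)), Series (fun k => Im (u k))).

Definition graf_remainder upper (m : Z) (p : nat) (x y : R * R) : C :=
  (CSeries (graf_tail_pos upper m p x y)
   + CSeries (graf_tail_neg upper m p x y))%C.

Definition graf_remainder_converges upper (m : Z) (p : nat) (x y : R * R) :=
  @ex_series C_AbsRing C_NormedModule (graf_tail_pos upper m p x y) /\
  @ex_series C_AbsRing C_NormedModule (graf_tail_neg upper m p x y).

Lemma polar_angleP (v : R * R) :
  0 < enorm v ->
  fst v = enorm v * cos (polar_angle v) /\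
  snd v = enorm v * sin (polar_angle v).
Proof.
  intros Hv.
  assert (Hsq : enorm v ^ 2 = fst v ^ 2 + snd v ^ 2).
  { unfold enorm. rewrite pow2_sqrt; [reflexivity | nra]. }
  set (N := enorm v) in *. set (a := fst v / N).
  assert (Ha : fst v = N * a) by (unfold a; field; lra).
  assert (Hs : snd v ^ 2 = N ^ 2 * (1 - a ^ 2)) by (rewrite Ha in Hsq; nra).
  assert (Ha2 : 0 <= 1 - a ^ 2).
  { apply Rmult_le_reg_l with (N ^ 2); [nra|]. rewrite <- Hs. nra. }
  assert (Hb : -1 <= a <= 1) by nra.
  assert (Hq : sqrt (1 - Rsqr a) = Rabs (snd v) / N).
  { replace (1 - Rsqr a) with (Rsqr (Rabs (snd v) / N)).
    - apply sqrt_Rsqr. apply Rdiv_le_0_compat; [apply Rabs_pos | lra].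
    - unfold Rdiv. rewrite Rsqr_mult, <- Rsqr_abs. unfold Rsqr.
      replace (snd v * snd v) with (N ^ 2 * (1 - a ^ 2)) by nra.
      field. lra. }
  unfold polar_angle. fold N. fold a.
  destruct (Rle_dec 0 (snd v)) as [H|H].
  - rewrite cos_acos, sin_acos by assumption. rewrite Hq, Rabs_pos_eq by lra.
    split; [exact Ha | field; lra].
  - rewrite cos_neg, sin_neg, cos_acos, sin_acos by assumption.
    rewrite Hq, Rabs_left by lra.
    split; [exact Ha | field; lra].
Qed.

Lemma is_lim_pow_exp (n : nat) :
  is_lim (fun t => t ^ n * exp (- t)) p_infty 0.
Proof.
  set (a := / (INR n + 1)).
  assert (Hn := pos_INR n).
  assert (Ha : 0 < a) by (apply Rinv_0_lt_compat; lra).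
  assert (Ea : (INR n + 1) * a = 1) by (unfold a; field; lra).
  assert (Hl : is_lim (fun t => - a * t) p_infty m_infty).
  { replace m_infty with (Rbar_mult (- a) p_infty).
    - apply is_lim_scal_l, is_lim_id.
    - simpl. destruct (Rle_dec 0 (- a)) as [H|H]; [exfalso; lra | reflexivity]. }
  assert (He : is_lim (fun t => exp (- a * t)) p_infty 0).
  { apply is_lim_comp with m_infty; [apply is_lim_exp_m | exact Hl |].
    exists 0. intros t _. discriminate. }
  assert (Hte : is_lim (fun t => t * exp (- a * t)) p_infty 0).
  { apply is_lim_ext with (fun t => - / a * (- a * t * exp (- a * t))).
    - intros t. field. lra.
    - replace (Finite 0) with (Rbar_mult (- / a) 0) by (simpl; f_equal; ring).
      apply is_lim_scal_l.
      apply (is_lim_comp (fun u => u * exp u)) with m_infty;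
        [apply is_lim_mul_exp_m | exact Hl |].
      exists 0. intros t _. discriminate. }
  apply is_lim_ext with
    (fun t => exp (- a * t) * (t * exp (- a * t)) ^ n).
  - intros t. rewrite Rpow_mult_distr.
    assert (H : forall k, exp (- a * t) ^ k = exp (INR k * (- a * t))).
    { induction k as [|k IH].
      - simpl. rewrite Rmult_0_l, exp_0. reflexivity.
      - rewrite <- tech_pow_Rmult, IH, <- exp_plus, S_INR. f_equal. ring. }
    rewrite H, (Rmult_comm (t ^ n)), <- Rmult_assoc, <- exp_plus, Rmult_comm.
    f_equal. f_equal.
    replace (- a * t + INR n * (- a * t)) with (- ((INR n + 1) * a) * t) by ring.
    rewrite Ea. ring.
  - clearbody a. clear Hn Ea. induction n as [|n IH].
    + apply is_lim_ext with (2 := He). intros t. simpl. ring.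
    + apply is_lim_ext with
        (fun t => (t * exp (- a * t)) * (exp (- a * t) * (t * exp (- a * t)) ^ n)).
      { intros t. simpl. ring. }
      replace (Finite 0) with (Rbar_mult 0 0) by (simpl; f_equal; ring).
      apply is_lim_mult; [exact Hte | exact IH | exact I].
Qed.

Lemma Gamma_INR_S (n : nat) : Gamma (INR (S n)) = INR (fact n).
Proof.
  unfold Gamma. apply is_RInt_gen_unique.
  set (f := fun k t => - exp (- t) *
        (fix G k := match k with O => 1
                    | S k' => t ^ k + INR k * G k' end) k).
  assert (Hf : forall k t, f (S k) t =
            - (exp (- t) * t ^ S k) + INR (S k) * f k t).
  { intros k t. unfold f. ring. }
  assert (Hd : forall k t, is_derive (f k) t (t ^ k * exp (- t))).
  { induction k as [|k IH]; intros t.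
    - unfold f. auto_derive; [exact I | simpl; ring].
    - apply is_derive_ext with
        (fun t => - (exp (- t) * t ^ S k) + INR (S k) * f k t).
      { intros u. symmetry. apply Hf. }
      replace (t ^ S k * exp (- t)) with
        ((exp (- t) * t ^ S k - INR (S k) * t ^ k * exp (- t))
         + INR (S k) * (t ^ k * exp (- t))) by ring.
      apply @is_derive_plus; [|apply is_derive_scal, IH].
      auto_derive; [exact I | simpl; ring]. }
  assert (Hf0 : forall k, f k 0 = - INR (fact k)).
  { induction k as [|k IH].
    - unfold f. rewrite Ropp_0, exp_0. simpl. ring.
    - rewrite Hf, IH, fact_simpl, mult_INR. simpl pow. ring. }
  assert (Hfi : forall k, is_lim (f k) p_infty 0).
  { induction k as [|k IH].
    - apply is_lim_ext with (fun t => -1 * (t ^ 0 * exp (- t))).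
      { intros t. unfold f. simpl. ring. }
      replace (Finite 0) with (Rbar_mult (-1) 0) by (simpl; f_equal; ring).
      apply is_lim_scal_l, is_lim_pow_exp.
    - apply is_lim_ext with
        (fun t => -1 * (t ^ S k * exp (- t)) + INR (S k) * f k t).
      { intros t. rewrite Hf. ring. }
      replace (Finite 0) with
        (Finite (-1 * 0 + INR (S k) * 0)) by (f_equal; ring).
      apply is_lim_plus'.
      + apply (is_lim_scal_l _ (-1) _ 0), is_lim_pow_exp.
      + apply (is_lim_scal_l _ (INR (S k)) _ 0), IH. }
  assert (HD : forall t, Derive (f n) t = t ^ n * exp (- t)).
  { intros t. apply is_derive_unique, Hd. }
  apply is_RInt_gen_ext with (Derive (f n)).
  - apply (Filter_prod _ _ _ (fun a => 0 < a) (fun b => 0 < b)).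
    + exists (mkposreal 1 Rlt_0_1). intros u _ Hu. exact Hu.
    + exists 0. intros u Hu. exact Hu.
    + intros a b Ha Hb t [Ht _].
      rewrite HD. f_equal. simpl fst in Ht. simpl snd in Ht.
      assert (0 < t) by (apply Rlt_trans with (2 := Ht), Rmin_case; assumption).
      rewrite S_INR. replace (INR n + 1 - 1) with (INR n) by ring.
      symmetry. apply Rpower_pow. assumption.
  - replace (INR (fact n)) with (0 - f n 0) by (rewrite Hf0; ring).
    apply is_RInt_gen_Derive.
    + apply filter_forall. intros ab t _. eexists. apply Hd.
    + apply filter_forall. intros ab t _.
      apply continuous_ext with (fun t => t ^ n * exp (- t)).
      { intros u. symmetry. apply HD. }
      apply (ex_derive_continuous (fun t => t ^ n * exp (- t))).
      auto_derive. exact I.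
    + apply (filterlim_filter_le_1 (F := locally 0) (f n) (filter_le_within _)).
      apply (ex_derive_continuous (f n)). eexists. apply Hd.
    + exact (Hfi n).
Qed.

Lemma CSeries_unique (u : nat -> C) (l : C) :
  @is_series C_AbsRing C_NormedModule u l -> CSeries u = l.
Proof.
  intros H.
  assert (Hs : forall n, (sum_n u n : C) =
            (sum_n (fun k => Re (u k)) n, sum_n (fun k => Im (u k)) n)).
  { induction n as [|n IH].
    - rewrite !sum_O. destruct (u 0%nat); reflexivity.
    - rewrite !sum_Sn, IH. destruct (u (S n)). reflexivity. }
  unfold CSeries. destruct l as [l1 l2]. f_equal; apply is_series_unique.
  - apply filterlim_ext with (fun n => fst (sum_n u n : C)).
    { intros n. rewrite Hs. reflexivity. }
    eapply filterlim_comp; [exact H|].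
    intros P [e He]. exists e. intros z Hz. apply He, Hz.
  - apply filterlim_ext with (fun n => snd (sum_n u n : C)).
    { intros n. rewrite Hs. reflexivity. }
    eapply filterlim_comp; [exact H|].
    intros P [e He]. exists e. intros z Hz. apply He, Hz.
Qed.

(* Main.v *)
Require Import Defs.
From Stdlib Require Import Lra Lia Ranalysis5.

(* Write z = |x| and M_n = J_n(z)^2 + Y_n(z)^2. Bounding J_n(|y|) by (|y|/2)^n / n!, everything
   reduces to |H_j(z)| <= -sqrt 2 Y_n(z) for n > p + m >= z, with j <= n of the same parity, and to
   C_n(z) being nonincreasing in n >= z; a geometric series then sums the two tails.

   Schlaefli's integral formulas for J_n and Y_n are obtained from the series by uniqueness for
   the Bessel system of orders (0, 1) at z = 0, where the Euler constant enters. They give the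
   radiation condition H_{n+1} + i H_n = O(1/z), which makes the derivative of z M_n tend to 0
   at infinity; an energy argument then shows that z M_n is nonincreasing for n >= 1. Through the
   recurrences this gives M_{n-1} <= M_{n+1}, and, since J_n > 0 and J_{n-1} > J_{n+1} for n >= z, also
   Y_n < 0 for n >= z. Finally J_n + Y_n <= 0 for even n >= z follows from Schlaefli's formulas, and
   the Wronskian propagates it to larger n. *)

(** * Power series of J and Y *)

(** The hypothesis [p + m >= |x|] controls Bessel functions only at orders at least the argument,
    whereas the tail over negative indices meets orders |m - n| that may lie far below it, where Y
    oscillates. Since m + n and |m - n| differ by 2 min(m, n), comparing moduli in steps of two is
    exactly what is required. Once C_n is inserted, the term of index n keeps r^n (n+m-1)!/n!, and
    AM-GM about the centre c = n + m/2 bounds the factorial ratio by c^m / c. With a = p + m/2 and c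
    = a + t, the estimate (a + t)^m <= a^m exp(m t / a) makes the tail geometric of ratio exp(-l),
    where l = - ln r - m/a; the second hypothesis says precisely l > 0. The constant 4 sqrt 2
    collects sqrt 2 from J^2 + Y^2 <= 2 Y^2, a 2 for the two tails, and a 2 because a l is half of
    the bracket in the denominator. *)

Definition exp_bounded (a : nat -> R) :=
  exists C, forall k, Rabs (a k) <= C * / INR (fact k).

Lemma exp_bounded_disk (a : nat -> R) (x : R) : exp_bounded a -> CV_disk a x.
Proof.
  intros [C HC]. unfold CV_disk.
  apply (@ex_series_le R_AbsRing R_CompleteNormedModule) with
    (b := fun k => C * (Rabs x ^ k * / INR (fact k))).
  - intros k. change norm with Rabs. rewrite Rabs_Rabsolu, Rabs_mult, <- RPow_abs.
    rewrite (Rmult_comm (Rabs x ^ k)), <- Rmult_assoc.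
    apply Rmult_le_compat_r; [apply pow_le, Rabs_pos | apply HC].
  - apply (@ex_series_scal R_AbsRing). exists (exp (Rabs x)).
    apply is_exp_Reals.
Qed.

Lemma exp_bounded_radius (a : nat -> R) (x : R) :
  exp_bounded a -> Rbar_lt (Rabs x) (CV_radius a).
Proof.
  intros Ha. unfold CV_radius.
  destruct (Lub_Rbar_correct (CV_disk a)) as [H _].
  apply Rbar_lt_le_trans with (Rabs x + 1); [simpl; lra |].
  apply H, exp_bounded_disk, Ha.
Qed.

Lemma exp_bounded_ex (a : nat -> R) (x : R) : exp_bounded a -> ex_pseries a x.
Proof. intros Ha. apply CV_radius_inside, exp_bounded_radius, Ha. Qed.

Lemma exp_bounded_is_derive (a : nat -> R) (x : R) :
  exp_bounded a -> is_derive (PSeries a) x (PSeries (PS_derive a) x).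
Proof. intros Ha. apply is_derive_PSeries, exp_bounded_radius, Ha. Qed.

Lemma exp_bounded_ext (a b : nat -> R) :
  (forall k, a k = b k) -> exp_bounded a -> exp_bounded b.
Proof. intros E [C HC]. exists C. intros k. rewrite <- E. apply HC. Qed.

Lemma exp_bounded_plus (a b : nat -> R) :
  exp_bounded a -> exp_bounded b -> exp_bounded (PS_plus a b).
Proof.
  intros [C HC] [D HD]. exists (C + D). intros k.
  unfold PS_plus. change plus with Rplus.
  eapply Rle_trans; [apply Rabs_triang|]. specialize (HC k). specialize (HD k). lra.
Qed.

Lemma exp_bounded_scal (c : R) (a : nat -> R) :
  exp_bounded a -> exp_bounded (PS_scal c a).
Proof.
  intros [C HC]. exists (Rabs c * C). intros k.
  unfold PS_scal. change scal with Rmult. rewrite Rabs_mult, Rmult_assoc.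
  apply Rmult_le_compat_l; [apply Rabs_pos | apply HC].
Qed.

Definition phi_coef (n k : nat) : R := (-1) ^ k / (INR (fact k) * INR (fact (n + k))).

(** This is the Bessel-Clifford function at -s: J_n(z) = (z/2)^n phi_n((z/2)^2). In the variable s
    it is entire and differentiation only shifts the order. *)
Definition phi (n : nat) (s : R) : R := PSeries (phi_coef n) s.

Lemma fact_ge_1 (n : nat) : 1 <= INR (fact n).
Proof. apply (le_INR 1), lt_O_fact. Qed.

Lemma phi_coef_bounded (n : nat) : exp_bounded (phi_coef n).
Proof.
  exists 1. intros k. unfold phi_coef, Rdiv.
  pose proof (fact_ge_1 k). pose proof (fact_ge_1 (n + k)).
  rewrite Rabs_mult, pow_1_abs, Rabs_pos_eq.
  - rewrite !Rmult_1_l, Rinv_mult. rewrite <- (Rmult_1_r (/ INR (fact k))) at 2.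
    apply Rmult_le_compat_l; [left; apply Rinv_0_lt_compat; lra|].
    rewrite <- Rinv_1. apply Rinv_le_contravar; lra.
  - left. apply Rinv_0_lt_compat. nra.
Qed.

Lemma phi_is_derive (n : nat) (s : R) : is_derive (phi n) s (- phi (S n) s).
Proof.
  replace (- phi (S n) s) with (PSeries (PS_derive (phi_coef n)) s).
  { apply exp_bounded_is_derive, phi_coef_bounded. }
  unfold phi. rewrite <- PSeries_opp. apply PSeries_ext. intros k.
  unfold PS_derive, PS_opp, phi_coef. change opp with Ropp.
  replace (n + S k)%nat with (S n + k)%nat by lia.
  rewrite (fact_simpl k), mult_INR, <- tech_pow_Rmult.
  pose proof (fact_ge_1 k). pose proof (fact_ge_1 (S n + k)).
  assert (INR (S k) <> 0) by (apply not_0_INR; lia).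
  field. repeat split; assumption || lra.
Qed.

Lemma phi_rec (n : nat) (s : R) :
  phi n s = INR (S n) * phi (S n) s - s * phi (S (S n)) s.
Proof.
  unfold Rminus. rewrite Ropp_mult_distr_r. unfold phi.
  rewrite <- PSeries_opp, <- PSeries_incr_1, <- PSeries_scal, <- PSeries_plus.
  - apply PSeries_ext. intros [|k]; unfold PS_plus, PS_scal, PS_incr_1, PS_opp, phi_coef;
      change opp with Ropp; change scal with Rmult; change plus with Rplus.
    + change zero with 0. rewrite !Nat.add_0_r, (fact_simpl n), mult_INR.
      pose proof (fact_ge_1 n). assert (INR (S n) <> 0) by (apply not_0_INR; lia).
      simpl (fact 0). simpl (_ ^ 0). change (INR 1) with 1. field. split; assumption || lra.
    + replace (S (S n) + k)%nat with (S (S (n + k)))%nat by lia.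
      replace (S n + S k)%nat with (S (S (n + k)))%nat by lia.
      replace (n + S k)%nat with (S (n + k))%nat by lia.
      rewrite (fact_simpl (S (n + k))), (fact_simpl k), !mult_INR, <- tech_pow_Rmult.
      pose proof (fact_ge_1 k). pose proof (fact_ge_1 (S (n + k))).
      rewrite !S_INR, plus_INR.
      pose proof (pos_INR n). pose proof (pos_INR k).
      field. repeat split; lra.
  - apply exp_bounded_ex, exp_bounded_scal, phi_coef_bounded.
  - apply ex_pseries_incr_1, ex_pseries_opp, exp_bounded_ex, phi_coef_bounded.
Qed.

Lemma phi_0 (n : nat) : phi n 0 = / INR (fact n).
Proof.
  unfold phi. rewrite PSeries_0. unfold phi_coef. rewrite Nat.add_0_r. simpl.
  pose proof (fact_ge_1 n). field. lra.
Qed.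

Definition psi_coef (n k : nat) : R :=
  (-1) ^ k * (psi_S k + psi_S (n + k)) / (INR (fact k) * INR (fact (n + k))).

(** The logarithm-free infinite series of Y_n, stripped of (z/2)^n in the same way as [phi]. *)
Definition psi_series (n : nat) (s : R) : R := PSeries (psi_coef n) s.

Lemma harmonic_S (n : nat) : harmonic (S n) = harmonic n + / INR (S n).
Proof. unfold harmonic. rewrite sum_n_Sm by lia. reflexivity. Qed.

Lemma harmonic_0 : harmonic 0 = 0.
Proof. unfold harmonic. rewrite sum_n_m_zero by lia. reflexivity. Qed.

Lemma harmonic_bound (n : nat) : 0 <= harmonic n <= INR n.
Proof.
  induction n as [|n IH]; [rewrite harmonic_0; simpl; lra|].
  rewrite harmonic_S, !S_INR.
  pose proof (pos_INR n).
  assert (0 < / (INR n + 1) <= 1).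
  { split; [apply Rinv_0_lt_compat; lra|]. rewrite <- Rinv_1.
    apply Rinv_le_contravar; lra. }
  lra.
Qed.

Lemma psi_S_S (n : nat) : psi_S (S n) = psi_S n + / INR (S n).
Proof. unfold psi_S. rewrite harmonic_S. ring. Qed.

Lemma INR_fact_ge (n : nat) : INR n <= INR (fact n).
Proof.
  apply le_INR. induction n as [|n IH]; [lia|]. rewrite fact_simpl.
  pose proof (lt_O_fact n). destruct n; [simpl; lia|]. nia.
Qed.

Lemma psi_coef_bounded (n : nat) : exp_bounded (psi_coef n).
Proof.
  exists (2 * Rabs euler_gamma + 2). intros k. unfold psi_coef, Rdiv.
  pose proof (fact_ge_1 k) as H1. pose proof (fact_ge_1 (n + k)) as H2.
  rewrite Rinv_mult, Rabs_mult, Rabs_mult, pow_1_abs, Rmult_1_l.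
  rewrite (Rabs_mult (/ _)), !(Rabs_pos_eq (/ _)) by (left; apply Rinv_0_lt_compat; lra).
  rewrite (Rmult_comm (/ INR (fact k))), <- Rmult_assoc.
  apply Rmult_le_compat_r; [left; apply Rinv_0_lt_compat; lra|].
  apply Rmult_le_reg_r with (INR (fact (n + k))); [lra|].
  rewrite Rmult_assoc, Rinv_l, Rmult_1_r by lra.
  pose proof (harmonic_bound k). pose proof (harmonic_bound (n + k)).
  pose proof (INR_fact_ge (n + k)).
  rewrite plus_INR in *. pose proof (pos_INR n).
  unfold psi_S. pose proof (Rabs_pos euler_gamma).
  assert (Rabs euler_gamma * 1 <= Rabs euler_gamma * INR (fact (n + k)))
    by (apply Rmult_le_compat_l; lra).
  apply Rle_trans with (2 * Rabs euler_gamma + 2 * (INR n + INR k)); [|nra].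
  apply Rabs_le. pose proof (Rle_abs euler_gamma). pose proof (Rle_abs (- euler_gamma)).
  rewrite Rabs_Ropp in *. lra.
Qed.

(** Differentiation turns psi(k+1) into psi(k+2) = psi(k+1) + 1/(k+1); the surplus 1/(k+1) produces
    exactly the coefficients of [phi n] shifted by one place. *)
Lemma psi_is_derive (n : nat) (s : R) :
  is_derive (psi_series n) s
    (- psi_series (S n) s + PSeries (PS_decr_1 (phi_coef n)) s).
Proof.
  replace (- psi_series (S n) s + PSeries (PS_decr_1 (phi_coef n)) s)
    with (PSeries (PS_derive (psi_coef n)) s).
  { apply exp_bounded_is_derive, psi_coef_bounded. }
  unfold psi_series. rewrite <- PSeries_opp, <- PSeries_plus.
  - apply PSeries_ext. intros k.
    unfold PS_plus, PS_derive, PS_opp, PS_decr_1, phi_coef, psi_coef.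
    change opp with Ropp; change plus with Rplus.
    replace (n + S k)%nat with (S n + k)%nat by lia.
    rewrite psi_S_S, (fact_simpl k), mult_INR, <- tech_pow_Rmult.
    pose proof (fact_ge_1 k). pose proof (fact_ge_1 (S n + k)).
    assert (INR (S k) <> 0) by (apply not_0_INR; lia).
    field. repeat split; assumption || lra.
  - apply ex_pseries_opp, exp_bounded_ex, psi_coef_bounded.
  - apply (@ex_pseries_decr_1 R_AbsRing R_NormedModule); [|apply exp_bounded_ex, phi_coef_bounded].
    destruct (Req_dec s 0) as [H|H]; [left; exact H|].
    right. exists (/ s). apply Rinv_l, H.
Qed.

Lemma phi_decr (n : nat) (s : R) :
  s * PSeries (PS_decr_1 (phi_coef n)) s = phi n s - / INR (fact n).
Proof.
  unfold phi at 1. rewrite (PSeries_decr_1 (phi_coef n) s).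
  - unfold phi_coef at 2. rewrite Nat.add_0_r. simpl.
    pose proof (fact_ge_1 n). field. lra.
  - apply exp_bounded_ex, phi_coef_bounded.
Qed.

(** The counterpart of [phi_rec], with the derivative of [psi_series (S n)] spelled out.
    Coefficientwise it is multiplication by n + 1 + k, and [phi (S n)] comes from psi_S(n+1+k) -
    psi_S(n+k) = 1/(n+1+k). *)
Lemma psi_rec (n : nat) (s : R) :
  INR (S n) * psi_series (S n) s
  + s * (- psi_series (S (S n)) s + PSeries (PS_decr_1 (phi_coef (S n))) s)
  = psi_series n s + phi (S n) s.
Proof.
  assert (He : exp_bounded (PS_derive (psi_coef (S n)))).
  { apply exp_bounded_ext with
      (PS_plus (PS_scal (-1) (psi_coef (S (S n)))) (PS_decr_1 (phi_coef (S n)))).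
    - intros k. unfold PS_plus, PS_derive, PS_scal, PS_decr_1, phi_coef, psi_coef.
      change scal with Rmult; change plus with Rplus.
      replace (S n + S k)%nat with (S (S n) + k)%nat by lia.
      rewrite psi_S_S, (fact_simpl k), mult_INR, <- tech_pow_Rmult.
      pose proof (fact_ge_1 k). pose proof (fact_ge_1 (S (S n) + k)).
      assert (INR (S k) <> 0) by (apply not_0_INR; lia).
      field. repeat split; assumption || lra.
    - apply exp_bounded_plus; [apply exp_bounded_scal, psi_coef_bounded|].
      destruct (phi_coef_bounded (S n)) as [C HC]. exists C. intros k.
      unfold PS_decr_1. eapply Rle_trans; [apply HC|].
      apply Rmult_le_compat_l.
      + pose proof (HC 0%nat) as H. simpl in H. rewrite Rinv_1, Rmult_1_r in H.
        eapply Rle_trans; [apply Rabs_pos | exact H].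
      + apply Rinv_le_contravar; [apply INR_fact_lt_0|].
        apply le_INR, fact_le. lia. }
  assert (Hd : - psi_series (S (S n)) s + PSeries (PS_decr_1 (phi_coef (S n))) s
    = PSeries (PS_derive (psi_coef (S n))) s).
  { transitivity (Derive (psi_series (S n)) s).
    - symmetry. apply is_derive_unique, psi_is_derive.
    - apply is_derive_unique, exp_bounded_is_derive, psi_coef_bounded. }
  rewrite Hd. unfold phi, psi_series.
  rewrite <- PSeries_incr_1, <- PSeries_scal, <- !PSeries_plus.
  - apply PSeries_ext. intros [|k]; unfold PS_plus, PS_scal, PS_incr_1, PS_derive, phi_coef, psi_coef;
      change scal with Rmult; change plus with Rplus.
    + change zero with 0. rewrite !Nat.add_0_r, psi_S_S, (fact_simpl n), mult_INR.
      pose proof (fact_ge_1 n). assert (INR (S n) <> 0) by (apply not_0_INR; lia).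
      simpl (fact 0). simpl (_ ^ 0). change (INR 1) with 1. field. split; assumption || lra.
    + replace (S n + S k)%nat with (S (n + S k))%nat by lia.
      rewrite (psi_S_S (n + S k)), (fact_simpl (n + S k)), !mult_INR.
      pose proof (fact_ge_1 (S k)). pose proof (fact_ge_1 (n + S k)).
      assert (INR (S (n + S k)) = INR (S n) + INR (S k)) as E
        by (rewrite <- plus_INR; f_equal; lia).
      assert (INR (S (n + S k)) <> 0) by (apply not_0_INR; lia).
      rewrite E in *. field. repeat split; assumption || lra.
  - apply exp_bounded_ex, psi_coef_bounded.
  - apply exp_bounded_ex, phi_coef_bounded.
  - apply exp_bounded_ex, exp_bounded_scal, psi_coef_bounded.
  - apply ex_pseries_incr_1, exp_bounded_ex, He.
Qed.

Lemma psi_series_0_0 : psi_series 0 0 = - 2 * euler_gamma.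
Proof.
  unfold psi_series. rewrite PSeries_0. unfold psi_coef, psi_S.
  simpl (0 + 0)%nat. rewrite harmonic_0. simpl. field.
Qed.

(** * Differential recurrences *)

Lemma besselJ_phi (n : nat) (z : R) :
  besselJ_nat n z = (z / 2) ^ n * phi n ((z / 2) ^ 2).
Proof.
  unfold besselJ_nat, phi, PSeries. rewrite <- Series_scal_l.
  apply Series_ext. intros k. unfold phi_coef. rewrite pow_add, pow_mult. ring.
Qed.

Definition finite_part (n : nat) (s : R) : R :=
  match n with
  | O => 0
  | S q => sum_n (fun k => INR (fact (q - k)) / INR (fact k) * s ^ k) q
  end.

Ltac as_Req := match goal with |- ?a = ?b => change (@eq R a b) end.

Lemma is_derive_eq (f : R -> R) (x l l' : R) :
  is_derive f x l -> l = l' -> is_derive f x l'.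
Proof. intros H <-. exact H. Qed.

Lemma Rmult_sum_n (a : R) (u : nat -> R) (n : nat) :
  a * sum_n u n = sum_n (fun k => a * u k) n.
Proof. symmetry. apply (sum_n_mult_l (K := R_AbsRing)). Qed.

Lemma Rplus_sum_n (u v : nat -> R) (n : nat) :
  sum_n u n + sum_n v n = sum_n (fun k => u k + v k) n.
Proof. symmetry. apply (sum_n_plus (G := R_AbelianMonoid)). Qed.

Lemma besselY_psi (n : nat) (z : R) :
  besselY_nat n z =
    2 / PI * besselJ_nat n z * ln (z / 2)
    - / PI * (finite_part n ((z / 2) ^ 2) / (z / 2) ^ n)
    - / PI * ((z / 2) ^ n * psi_series n ((z / 2) ^ 2)).
Proof.
  unfold besselY_nat. f_equal; [f_equal|]; f_equal.
  - destruct n as [|q]; [simpl; field|].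
    unfold finite_part. unfold Rdiv at 5. rewrite (Rmult_comm (sum_n _ _)), Rmult_sum_n.
    apply sum_n_ext. intros k. as_Req. rewrite pow_mult. unfold Rdiv. ring.
  - unfold psi_series, PSeries. rewrite <- Series_scal_l.
    apply Series_ext. intros k. unfold psi_coef. rewrite pow_add, pow_mult. ring.
Qed.

Lemma sum_pow_is_derive (c : nat -> R) (q : nat) (s : R) :
  is_derive (fun s => sum_n (fun k => c k * s ^ k) q) s
    (sum_n (fun k => c k * (INR k * s ^ pred k)) q).
Proof.
  induction q as [|q IH].
  - rewrite sum_O. apply is_derive_ext with (fun s => c 0%nat * s ^ 0).
    { intros t. rewrite sum_O. reflexivity. }
    auto_derive; [exact I | simpl; ring].
  - rewrite sum_Sn.
    apply is_derive_ext with
      (fun s => plus (sum_n (fun k => c k * s ^ k) q) (c (S q) * s ^ S q)).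
    { intros t. rewrite sum_Sn. reflexivity. }
    apply @is_derive_plus; [exact IH|].
    auto_derive; [exact I|]. change (match q with O => 1 | S _ => INR q + 1 end) with (INR (S q)).
    simpl pred. ring.
Qed.

Lemma finite_part_is_derive (n : nat) (s : R) :
  is_derive (finite_part (S n)) s (finite_part n s).
Proof.
  replace (finite_part n s) with
    (sum_n (fun k => INR (fact (n - k)) / INR (fact k) * (INR k * s ^ pred k)) n).
  { apply sum_pow_is_derive. }
  destruct n as [|q]; [rewrite sum_O; simpl; ring|].
  unfold sum_n at 1. rewrite sum_Sn_m by lia. simpl (INR 0).
  rewrite <- sum_n_m_S. unfold finite_part, sum_n.
  rewrite Rmult_0_l, Rmult_0_r. change plus with Rplus. rewrite Rplus_0_l.
  apply sum_n_m_ext. intros k. as_Req. simpl (S q - S k)%nat. simpl (pred (S k)).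
  rewrite fact_simpl, mult_INR.
  pose proof (fact_ge_1 k). assert (INR (S k) <> 0) by (apply not_0_INR; lia).
  field. split; assumption || lra.
Qed.

(** On coefficients this is (n+1-k) (n-k)! = (n+1-k)!, once [finite_part n] is read as the
    derivative of [finite_part (S n)]. The correction is the top term k = n+1, which only the
    right-hand polynomial contains. *)
Lemma finite_part_rec (n : nat) (s : R) :
  INR (S n) * finite_part (S n) s - s * finite_part n s
  = finite_part (S (S n)) s - s ^ S n / INR (fact (S n)).
Proof.
  assert (E : finite_part n s =
    sum_n (fun k => INR (fact (n - k)) / INR (fact k) * (INR k * s ^ pred k)) n).
  { transitivity (Derive (finite_part (S n)) s).
    - symmetry. apply is_derive_unique, finite_part_is_derive.
    - apply is_derive_unique, sum_pow_is_derive. }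
  rewrite E. unfold finite_part.
  rewrite (sum_Sn _ n). rewrite Nat.sub_diag. change plus with Rplus.
  rewrite !Rmult_sum_n.
  simpl (INR (fact 0)).
  assert (Hk : forall u v w : R, u = v + w -> u - v = w) by (intros; lra).
  assert (Hk' : forall u v w : R, v = w -> u = u + v - w) by (intros; lra).
  transitivity (sum_n (fun k => INR (fact (S n - k)) / INR (fact k) * s ^ k) n);
    [|apply Hk'; unfold Rdiv; ring].
  apply Hk. rewrite Rplus_sum_n.
  apply sum_n_ext_loc. intros k Hkn. as_Req.
  replace (S n - k)%nat with (S (n - k)) by lia.
  rewrite (fact_simpl (n - k)), mult_INR.
  pose proof (fact_ge_1 k).
  replace (INR (S (n - k))) with (INR (S n) - INR k) by (rewrite <- minus_INR by lia; f_equal; lia).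
  destruct k as [|k].
  - simpl (INR 0). rewrite Rmult_0_l, Rmult_0_r, Rmult_0_r, Rminus_0_r, Rplus_0_l. unfold Rdiv. ring.
  - simpl (pred _). rewrite <- (tech_pow_Rmult s k). field. lra.
Qed.

Lemma half_pow_is_derive (n : nat) (z : R) :
  0 < z -> is_derive (fun z => (z / 2) ^ n) z (INR n / z * (z / 2) ^ n).
Proof.
  intros Hz.
  replace (INR n / z * (z / 2) ^ n) with (INR n * (1 / 2) * (z / 2) ^ pred n).
  - apply (is_derive_pow (fun z => z / 2)). auto_derive; [exact I | field].
  - destruct n as [|n]; [simpl; field; lra|].
    simpl pred. rewrite <- tech_pow_Rmult. field. lra.
Qed.

Lemma comp_half_sqr_is_derive (f : R -> R) (z l : R) :
  is_derive f ((z / 2) ^ 2) l -> is_derive (fun z => f ((z / 2) ^ 2)) z (z / 2 * l).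
Proof.
  intros H. apply (is_derive_comp f (fun z => (z / 2) ^ 2)); [exact H|].
  auto_derive; [exact I | simpl; field].
Qed.

Lemma besselJ_is_derive_up (n : nat) (z : R) :
  0 < z -> is_derive (besselJ_nat n) z (INR n / z * besselJ_nat n z - besselJ_nat (S n) z).
Proof.
  intros Hz. apply is_derive_ext with (fun z => (z / 2) ^ n * phi n ((z / 2) ^ 2)).
  { intros t. symmetry. apply besselJ_phi. }
  rewrite !besselJ_phi.
  replace (_ - _) with (INR n / z * (z / 2) ^ n * phi n ((z / 2) ^ 2)
    + (z / 2) ^ n * (z / 2 * - phi (S n) ((z / 2) ^ 2))) by (simpl; ring).
  apply (is_derive_mult (fun z => (z / 2) ^ n) (fun z => phi n ((z / 2) ^ 2))).
  - apply half_pow_is_derive, Hz.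
  - apply comp_half_sqr_is_derive, phi_is_derive.
  - intros u v. apply Rmult_comm.
Qed.

Lemma besselJ_rec (n : nat) (z : R) :
  0 < z ->
  besselJ_nat n z + besselJ_nat (S (S n)) z = 2 * INR (S n) / z * besselJ_nat (S n) z.
Proof.
  intros Hz. rewrite !besselJ_phi, (phi_rec n). simpl pow. field. lra.
Qed.

Lemma besselJ_is_derive_down (n : nat) (z : R) :
  0 < z ->
  is_derive (besselJ_nat (S n)) z (besselJ_nat n z - INR (S n) / z * besselJ_nat (S n) z).
Proof.
  intros Hz. replace (_ - _) with
    (INR (S n) / z * besselJ_nat (S n) z - besselJ_nat (S (S n)) z).
  - apply besselJ_is_derive_up, Hz.
  - pose proof (besselJ_rec n z Hz). unfold Rdiv in *. lra.
Qed.

Lemma besselY_comb_is_derive (J p F G : R -> R) (z J' p' F' G' : R) :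
  0 < z -> p z <> 0 ->
  is_derive J z J' -> is_derive p z p' -> is_derive F z F' -> is_derive G z G' ->
  is_derive (fun z => 2 / PI * J z * ln (z / 2) - / PI * (F z / p z) - / PI * (p z * G z)) z
    (2 / PI * (J' * ln (z / 2) + J z / z)
     - / PI * (F' / p z - F z * p' / (p z) ^ 2) - / PI * (p' * G z + p z * G')).
Proof.
  intros Hz Hp HJ HP HF HG. pose proof PI_RGT_0.
  auto_derive.
  - repeat split; try (eexists; eassumption); try assumption. lra.
  - change (Derive (fun x : R => J x)) with (Derive J).
    change (Derive (fun x : R => p x)) with (Derive p).
    change (Derive (fun x : R => F x)) with (Derive F).
    change (Derive (fun x : R => G x)) with (Derive G).
    rewrite (is_derive_unique _ _ _ HJ), (is_derive_unique _ _ _ HP),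
      (is_derive_unique _ _ _ HF), (is_derive_unique _ _ _ HG).
    change (z * / 2) with (z / 2). field. repeat split; assumption || lra.
Qed.

(** The derivative [F'] of the finite part stays free because [finite_part 0] is the constant 0 and
    obeys no formula common with the positive orders. *)
Lemma besselY_is_derive_aux (n : nat) (z F' : R) :
  0 < z -> is_derive (finite_part n) ((z / 2) ^ 2) F' ->
  is_derive (besselY_nat n) z
    (2 / PI * ((INR n / z * besselJ_nat n z - besselJ_nat (S n) z) * ln (z / 2)
                + besselJ_nat n z / z)
     - / PI * (z / 2 * F' / (z / 2) ^ n
               - INR n / z * (finite_part n ((z / 2) ^ 2) / (z / 2) ^ n))
     - / PI * (INR n / z * (z / 2) ^ n * psi_series n ((z / 2) ^ 2)
       + (z / 2) ^ n * (z / 2 * (- psi_series (S n) ((z / 2) ^ 2)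
                      + PSeries (PS_decr_1 (phi_coef n)) ((z / 2) ^ 2))))).
Proof.
  intros Hz HF. pose proof PI_RGT_0 as HPI. eapply is_derive_ext; [intros t; symmetry; apply besselY_psi|].
  assert (Hp : (z / 2) ^ n <> 0) by (apply pow_nonzero; lra).
  pose proof (besselY_comb_is_derive _ (fun z => (z / 2) ^ n) _ _ z _ _ _ _ Hz Hp
    (besselJ_is_derive_up n z Hz) (half_pow_is_derive n z Hz)
    (comp_half_sqr_is_derive _ _ _ HF)
    (comp_half_sqr_is_derive _ _ _ (psi_is_derive n _))) as H.
  apply is_derive_eq with (1 := H). cbv beta. field. repeat split; assumption || lra.
Qed.

(** Each of the three pieces of Y_n violates the relation, and the defects cancel: J_n/z from the
    logarithm against phi_n - 1/n! from the infinite series, and the leftover 1/n! against the top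
    term of the finite part. *)
Lemma besselY_is_derive_up (n : nat) (z : R) :
  0 < z -> is_derive (besselY_nat n) z (INR n / z * besselY_nat n z - besselY_nat (S n) z).
Proof.
  intros Hz. pose proof PI_RGT_0.
  assert (Hp : (z / 2) ^ n <> 0) by (apply pow_nonzero; lra).
  pose proof (phi_decr n ((z / 2) ^ 2)) as Hd.
  pose proof (fact_ge_1 n) as Hf.
  assert (Hd' : PSeries (PS_decr_1 (phi_coef n)) ((z / 2) ^ 2) =
    (phi n ((z / 2) ^ 2) - / INR (fact n)) / (z / 2) ^ 2).
  { rewrite <- Hd. field. lra. }
  assert (HF : exists F' : R, is_derive (finite_part n) ((z / 2) ^ 2) F' /\
    INR n * finite_part n ((z / 2) ^ 2) - (z / 2) ^ 2 * F' =
      finite_part (S n) ((z / 2) ^ 2) - ((z / 2) ^ 2) ^ n / INR (fact n)).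
  { destruct n as [|q].
    - exists 0. split; [apply @is_derive_const|]. unfold finite_part. rewrite sum_O. simpl. field.
    - exists (finite_part q ((z / 2) ^ 2)). split; [apply finite_part_is_derive|].
      apply finite_part_rec. }
  destruct HF as [F' [HF HF']].
  assert (EF : F' = (INR n * finite_part n ((z / 2) ^ 2) - finite_part (S n) ((z / 2) ^ 2)
    + ((z / 2) ^ 2) ^ n / INR (fact n)) / (z / 2) ^ 2).
  { apply Rmult_eq_reg_l with ((z / 2) ^ 2); [|apply pow_nonzero; lra].
    transitivity (INR n * finite_part n ((z / 2) ^ 2) - finite_part (S n) ((z / 2) ^ 2)
    + ((z / 2) ^ 2) ^ n / INR (fact n)); [lra|]. field. split; lra. }
  pose proof (besselY_is_derive_aux n z F' Hz HF) as H0.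
  apply is_derive_eq with (1 := H0).
  rewrite !besselY_psi, !besselJ_phi, Hd', EF, <- pow_mult, (Nat.mul_comm 2 n), pow_mult.
  rewrite <- (tech_pow_Rmult (z / 2) n). clear Hd' EF HF' HF H0 Hd.
  generalize dependent ((z / 2) ^ n). intros p Hp.
  unfold pow. field. repeat split; assumption || lra.
Qed.

(** Here the finite part satisfies the relation by itself; the term J_{n+1}/z from the logarithm
    cancels the extra [phi (S n)] of [psi_rec]. *)
Lemma besselY_is_derive_down (n : nat) (z : R) :
  0 < z ->
  is_derive (besselY_nat (S n)) z (besselY_nat n z - INR (S n) / z * besselY_nat (S n) z).
Proof.
  intros Hz. pose proof PI_RGT_0.
  assert (Hp : (z / 2) ^ n <> 0) by (apply pow_nonzero; lra).
  pose proof (besselY_is_derive_aux (S n) z _ Hz (finite_part_is_derive n ((z / 2) ^ 2))) as H0.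
  apply is_derive_eq with (1 := H0).
  assert (Hr := psi_rec n ((z / 2) ^ 2)). assert (Hr' := phi_rec n ((z / 2) ^ 2)).
  assert (Hd' : PSeries (PS_decr_1 (phi_coef (S n))) ((z / 2) ^ 2) =
    (psi_series n ((z / 2) ^ 2) + phi (S n) ((z / 2) ^ 2)
      - INR (S n) * psi_series (S n) ((z / 2) ^ 2)) / (z / 2) ^ 2
     + psi_series (S (S n)) ((z / 2) ^ 2)).
  { apply Rmult_eq_reg_l with ((z / 2) ^ 2); [|apply pow_nonzero; lra].
    transitivity (psi_series n ((z / 2) ^ 2) + phi (S n) ((z / 2) ^ 2)
      - INR (S n) * psi_series (S n) ((z / 2) ^ 2) +
       (z / 2) ^ 2 * psi_series (S (S n)) ((z / 2) ^ 2)); [lra | field; lra]. }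
  rewrite !besselY_psi, !besselJ_phi, Hr', Hd'.
  rewrite <- !(tech_pow_Rmult (z / 2) (S n)), <- !(tech_pow_Rmult (z / 2) n).
  clear Hd' Hr Hr' H0. generalize dependent ((z / 2) ^ n). intros p Hp.
  unfold pow. field. repeat split; assumption || lra.
Qed.

(** The up and down formulas both compute the derivative of Y_{n+1}. *)
Lemma besselY_rec (n : nat) (z : R) :
  0 < z ->
  besselY_nat n z + besselY_nat (S (S n)) z = 2 * INR (S n) / z * besselY_nat (S n) z.
Proof.
  intros Hz.
  pose proof (is_derive_unique _ _ _ (besselY_is_derive_down n z Hz)) as H1.
  rewrite (is_derive_unique _ _ _ (besselY_is_derive_up (S n) z Hz)) in H1.
  unfold Rdiv in *. lra.
Qed.

Opaque phi psi_series phi_coef psi_coef besselJ_nat besselY_nat.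

(** * Bound on J and the Wronskian *)

Lemma is_derive_nondecreasing (f df : R -> R) (a b : R) :
  a <= b ->
  (forall x, a <= x <= b -> is_derive f x (df x)) ->
  (forall x, a <= x <= b -> 0 <= df x) -> f a <= f b.
Proof.
  intros Hab Hd Hp.
  destruct (MVT_gen f a b df) as [c [Hc E]].
  - intros x Hx. rewrite Rmin_left, Rmax_right in Hx by lra. apply Hd. lra.
  - intros x Hx. rewrite Rmin_left, Rmax_right in Hx by lra.
    apply continuity_pt_filterlim, (ex_derive_continuous f). eexists. apply Hd. exact Hx.
  - rewrite Rmin_left, Rmax_right in Hc by lra. specialize (Hp c Hc). nra.
Qed.

Lemma is_derive_nonincreasing (f df : R -> R) (a b : R) :
  a <= b ->
  (forall x, a <= x <= b -> is_derive f x (df x)) ->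
  (forall x, a <= x <= b -> df x <= 0) -> f b <= f a.
Proof.
  intros Hab Hd Hp.
  assert (- f a <= - f b); [|lra].
  apply (is_derive_nondecreasing (fun x => - f x) (fun x => - df x)).
  - exact Hab.
  - intros x Hx. apply (is_derive_opp f). apply Hd, Hx.
  - intros x Hx. specialize (Hp x Hx). lra.
Qed.

(* The energy [phi n ^ 2 + s * phi (n+1) ^ 2] has derivative [-(2n+1) phi (n+1) ^ 2]. *)
Lemma phi_bound (n : nat) (s : R) : 0 <= s -> Rabs (phi n s) <= / INR (fact n).
Proof.
  intros Hs. pose proof (fact_ge_1 n) as Hf.
  assert (H : phi n s ^ 2 + s * phi (S n) s ^ 2 <= phi n 0 ^ 2 + 0 * phi (S n) 0 ^ 2).
  { apply (is_derive_nonincreasing (fun s => phi n s ^ 2 + s * phi (S n) s ^ 2)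
      (fun s => - (2 * INR n + 1) * phi (S n) s ^ 2)); [exact Hs | |].
    - intros x Hx.
      apply is_derive_eq with (2 * phi n x * (- phi (S n) x)
        + (phi (S n) x ^ 2 + x * (2 * phi (S n) x * (- phi (S (S n)) x)))).
      + auto_derive.
        * repeat split; eexists; apply phi_is_derive.
        * change (Derive (fun x : R => phi n x)) with (Derive (phi n)).
          change (Derive (fun x : R => phi (S n) x)) with (Derive (phi (S n))).
          rewrite !(is_derive_unique _ _ _ (phi_is_derive _ x)). ring.
      + rewrite (phi_rec n x), S_INR. ring.
    - intros x Hx. pose proof (pos_INR n). pose proof (pow2_ge_0 (phi (S n) x)). nra. }
  rewrite phi_0 in H.
  apply Rsqr_incr_0; [| apply Rabs_pos | left; apply Rinv_0_lt_compat; lra].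
  rewrite <- Rsqr_abs, !Rsqr_pow2.
  assert (0 <= s * phi (S n) s ^ 2) by (apply Rmult_le_pos; [lra | apply pow2_ge_0]).
  lra.
Qed.

Lemma besselJ_bound (n : nat) (z : R) :
  0 <= z -> Rabs (besselJ_nat n z) <= (z / 2) ^ n / INR (fact n).
Proof.
  intros Hz. rewrite besselJ_phi, Rabs_mult, (Rabs_pos_eq (_ ^ n)) by (apply pow_le; lra).
  apply Rmult_le_compat_l; [apply pow_le; lra|].
  apply phi_bound. nra.
Qed.

(** In J_1 Y_0 - J_0 Y_1 the logarithms cancel, and what remains is 2/(pi z) times this entire
    function of s = (z/2)^2. Its derivative vanishes and its value at 0 is phi_0(0) = 1, so no limit
    at the singular point is taken. *)
Lemma phi_psi_wronskian (s : R) :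
  phi 0 s + s * (phi 0 s * psi_series 1 s - phi 1 s * psi_series 0 s) = 1.
Proof.
  set (k := fun s => phi 0 s + s * (phi 0 s * psi_series 1 s - phi 1 s * psi_series 0 s)).
  assert (Hd : forall t, is_derive k t 0).
  { intros t. unfold k. auto_derive.
    - repeat split;
        match goal with
        | |- ex_derive (fun x => phi ?n x) ?w => exists (- phi (S n) w); apply phi_is_derive
        | |- ex_derive (fun x => psi_series ?n x) ?w => eexists; exact (psi_is_derive n w)
        end.
    - change (Derive (fun x : R => phi 0 x)) with (Derive (phi 0)).
      change (Derive (fun x : R => phi 1 x)) with (Derive (phi 1)).
      change (Derive (fun x : R => psi_series 0 x)) with (Derive (psi_series 0)).
      change (Derive (fun x : R => psi_series 1 x)) with (Derive (psi_series 1)).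
      rewrite !(is_derive_unique _ _ _ (phi_is_derive _ t)),
        !(is_derive_unique _ _ _ (psi_is_derive _ t)).
      pose proof (psi_rec 0 t) as H1. pose proof (phi_rec 0 t) as H2.
      pose proof (phi_decr 0 t) as H3. simpl in H1, H2, H3.
      revert H1 H2 H3.
      generalize (phi 0 t) (phi 1 t) (phi 2 t) (psi_series 0 t) (psi_series 1 t)
        (PSeries (PS_decr_1 (phi_coef 0)) t)
        (- psi_series 2 t + PSeries (PS_decr_1 (phi_coef 1)) t).
      intros p0 p1 p2 q0 q1 d0 d1 H1 H2 H3.
      transitivity (- p1 + p0 * q1 - p1 * q0 - t * p1 * q1 + p0 * (t * d1)
        + (t * p2) * q0 + t * p1 * q1 - p1 * (t * d0)); [ring|].
      replace (t * d1) with (q0 + p1 - q1) by lra.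
      replace (t * p2) with (p1 - p0) by lra.
      rewrite H3, Rinv_1. ring. }
  assert (H0 : k 0 = 1).
  { unfold k. rewrite phi_0. simpl. field. }
  change (k s = 1). rewrite <- H0.
  destruct (Rtotal_order s 0) as [H|[->|H]]; [|reflexivity|].
  - apply (eq_is_derive k); [intros; apply Hd | exact H].
  - symmetry. apply (eq_is_derive k); [intros; apply Hd | exact H].
Qed.

(** Order 0 is [phi_psi_wronskian]; J and Y obey the same three-term recurrence, so the determinant
    of two consecutive orders does not depend on n. *)
Lemma bessel_wronskian (n : nat) (z : R) :
  0 < z ->
  besselJ_nat (S n) z * besselY_nat n z - besselJ_nat n z * besselY_nat (S n) z
  = 2 / (PI * z).
Proof.
  intros Hz. pose proof PI_RGT_0. induction n as [|n IH].
  - rewrite !besselY_psi, !besselJ_phi.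
    pose proof (phi_psi_wronskian ((z / 2) ^ 2)) as H0.
    unfold finite_part. rewrite sum_O. simpl (fact _). simpl (INR 1).
    transitivity (2 / (PI * z) *
      (phi 0 ((z / 2) ^ 2) + (z / 2) ^ 2 * (phi 0 ((z / 2) ^ 2) * psi_series 1 ((z / 2) ^ 2)
           - phi 1 ((z / 2) ^ 2) * psi_series 0 ((z / 2) ^ 2))));
      [|rewrite H0; ring].
    simpl pow. field. lra.
  - rewrite <- IH.
    pose proof (besselJ_rec n z Hz) as HJ. pose proof (besselY_rec n z Hz) as HY.
    replace (besselJ_nat (S (S n)) z) with
      (2 * INR (S n) / z * besselJ_nat (S n) z - besselJ_nat n z) by lra.
    replace (besselY_nat (S (S n)) z) with
      (2 * INR (S n) / z * besselY_nat (S n) z - besselY_nat n z) by lra.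
    ring.
Qed.

(** * Dominated improper integrals *)

(** The tool for differentiating under an integral: a pointwise quadratic remainder for the
    integrand integrates to the remainder required here. *)
Lemma is_derive_of_quadratic (F : R -> R) (z l C d : R) :
  0 < d -> (forall h, Rabs h <= d -> Rabs (F (z + h) - F z - h * l) <= C * h ^ 2) ->
  is_derive F z l.
Proof.
  intros Hd H. apply is_derive_Reals. intros eps Heps.
  assert (HC : 0 <= Rabs C) by apply Rabs_pos.
  assert (Hm : 0 < Rmin d (eps / (Rabs C + 1))).
  { apply Rmin_case; [exact Hd|]. apply Rdiv_lt_0_compat; lra. }
  exists (mkposreal _ Hm). intros h Hh0 Hh. simpl in Hh.
  assert (Hh1 : Rabs h < d) by (eapply Rlt_le_trans; [exact Hh | apply Rmin_l]).
  assert (Hh2 : Rabs h < eps / (Rabs C + 1)) by (eapply Rlt_le_trans; [exact Hh | apply Rmin_r]).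
  replace ((F (z + h) - F z) / h - l) with ((F (z + h) - F z - h * l) / h) by (field; exact Hh0).
  unfold Rdiv. rewrite Rabs_mult, Rabs_inv.
  assert (Hp : 0 < Rabs h) by (apply Rabs_pos_lt, Hh0).
  apply Rmult_lt_reg_r with (Rabs h); [exact Hp|].
  rewrite Rmult_assoc, Rinv_l, Rmult_1_r by lra.
  eapply Rle_lt_trans; [apply H; lra|].
  assert (C * h ^ 2 <= Rabs C * Rabs h * Rabs h).
  { rewrite <- (pow2_abs h). pose proof (Rle_abs C). nra. }
  assert (Rabs h * (Rabs C + 1) < eps).
  { apply Rmult_lt_compat_r with (r := Rabs C + 1) in Hh2; [|lra].
    unfold Rdiv in Hh2. rewrite Rmult_assoc, Rinv_l, Rmult_1_r in Hh2 by lra. exact Hh2. }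
  nra.
Qed.

(** The rate 1/2 is fixed once and for all: the kernels below decay faster than every exponential,
    and a common rate makes the class stable under linear combinations. *)
Definition dominated (f : R -> R) : Prop :=
  (forall t, continuous f t) /\
  exists K, forall t, 0 <= t -> Rabs (f t) <= K * exp (- t / 2).

Definition improper (f : R -> R) : R := real (Lim_seq (fun n => RInt f 0 (INR n))).

Lemma continuous_ex_RInt (f : R -> R) (a b : R) :
  (forall t, continuous f t) -> ex_RInt f a b.
Proof. intros H. apply (ex_RInt_continuous f). intros; apply H. Qed.

Lemma RInt_antiderivative (f F : R -> R) (a b : R) :
  (forall t, is_derive F t (f t)) -> (forall t, continuous f t) ->
  RInt f a b = F b - F a.
Proof.
  intros HF Hf. apply is_RInt_unique.
  apply (is_RInt_derive (V := R_CompleteNormedModule) F f); intros; [apply HF | apply Hf].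
Qed.

Lemma exp_half_is_derive (K t : R) :
  is_derive (fun t => - 2 * K * exp (- t / 2)) t (K * exp (- t / 2)).
Proof. auto_derive; [exact I | change (- t * / 2) with (- t / 2); field]. Qed.

Lemma exp_half_continuous (K t : R) : continuous (fun t => K * exp (- t / 2)) t.
Proof. apply (ex_derive_continuous (fun t => K * exp (- t / 2))). auto_derive. exact I. Qed.

Lemma RInt_exp_half (K a b : R) :
  RInt (fun t => K * exp (- t / 2)) a b = 2 * K * exp (- a / 2) - 2 * K * exp (- b / 2).
Proof.
  rewrite (RInt_antiderivative _ (fun t => - 2 * K * exp (- t / 2))).
  - as_Req. ring.
  - apply exp_half_is_derive.
  - apply exp_half_continuous.
Qed.

Lemma improper_correct (f : R -> R) :
  dominated f -> is_lim_seq (fun n => RInt f 0 (INR n)) (improper f).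
Proof.
  intros [Hc [K HK]].
  assert (Hx : forall a b, ex_RInt f a b) by (intros; apply continuous_ex_RInt, Hc).
  assert (He : ex_finite_lim_seq (fun n => RInt f 0 (INR n))).
  (* The integral up to n is a partial sum of the integrals over unit intervals, and these are
     bounded by a geometric sequence. *)
  { assert (HS : ex_series (fun n => RInt f (INR n) (INR (S n)))).
    { apply (@ex_series_le R_AbsRing R_CompleteNormedModule) with
        (b := fun n => 2 * K * exp (- 1 / 2) ^ n).
      - intros n. change norm with Rabs.
        assert (Hn : INR n <= INR (S n)) by (rewrite S_INR; lra).
        eapply Rle_trans; [apply abs_RInt_le; [exact Hn | apply Hx]|].
        eapply Rle_trans.
        + apply RInt_le with (g := fun t => K * exp (- t / 2)); [exact Hn | | |].
          * apply continuous_ex_RInt. intros t.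
            apply (continuous_comp f Rabs); [apply Hc | apply continuous_Rabs].
          * apply continuous_ex_RInt, exp_half_continuous.
          * intros t Ht. apply HK. pose proof (pos_INR n). lra.
        + rewrite RInt_exp_half.
          assert (Hp : exp (- 1 / 2) ^ n = exp (- INR n / 2)).
          { clear. induction n as [|n IH]; [simpl; rewrite Ropp_0, Rdiv_0_l, exp_0; reflexivity|].
            rewrite <- tech_pow_Rmult, IH, <- exp_plus, S_INR. f_equal. field. }
          rewrite Hp. pose proof (exp_pos (- INR (S n) / 2)).
          assert (0 <= K).
          { specialize (HK 0 (Rle_refl 0)). rewrite Ropp_0, Rdiv_0_l, exp_0 in HK.
            pose proof (Rabs_pos (f 0)). lra. }
          nra.
      - apply (@ex_series_scal R_AbsRing R_NormedModule). apply ex_series_geom.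
        rewrite Rabs_pos_eq by (left; apply exp_pos). rewrite <- exp_0.
        apply exp_increasing. lra. }
    destruct HS as [l Hl]. exists l.
    apply is_lim_seq_incr_1.
    apply is_lim_seq_ext with (2 := Hl). intros n.
    induction n as [|n IH]; [rewrite sum_O; reflexivity|].
    rewrite sum_Sn, IH. apply (RInt_Chasles (V := R_CompleteNormedModule)); apply Hx. }
  apply Lim_seq_correct' in He. exact He.
Qed.

Lemma improper_unique (f : R -> R) (l : R) :
  is_lim_seq (fun n => RInt f 0 (INR n)) l -> improper f = l.
Proof. intros H. unfold improper. rewrite (is_lim_seq_unique _ _ H). reflexivity. Qed.

Lemma dominated_continuous (f : R -> R) (t : R) : dominated f -> continuous f t.
Proof. intros H. apply H. Qed.

Lemma dominated_ex_RInt (f : R -> R) (a b : R) : dominated f -> ex_RInt f a b.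
Proof. intros H. apply continuous_ex_RInt. intros t. apply H. Qed.

Lemma dominated_lin (f g : R -> R) (a b : R) :
  dominated f -> dominated g -> dominated (fun t => a * f t + b * g t).
Proof.
  intros [Hf [K HK]] [Hg [L HL]]. split.
  - intros t. apply (continuous_plus (fun t => a * f t) (fun t => b * g t)).
    + apply (continuous_scal_r a f). apply Hf.
    + apply (continuous_scal_r b g). apply Hg.
  - exists (Rabs a * K + Rabs b * L). intros t Ht.
    eapply Rle_trans; [apply Rabs_triang|]. rewrite !Rabs_mult.
    specialize (HK t Ht). specialize (HL t Ht).
    pose proof (Rabs_pos a). pose proof (Rabs_pos b). nra.
Qed.

Lemma improper_lin (f g : R -> R) (a b : R) :
  dominated f -> dominated g ->
  improper (fun t => a * f t + b * g t) = a * improper f + b * improper g.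
Proof.
  intros Hf Hg. apply improper_unique.
  apply is_lim_seq_ext with (fun n => a * RInt f 0 (INR n) + b * RInt g 0 (INR n)).
  - intros n. symmetry. apply is_RInt_unique.
    apply (is_RInt_plus (V := R_NormedModule) (fun t => a * f t) (fun t => b * g t)).
    + apply (is_RInt_scal (V := R_NormedModule) f).
      apply (RInt_correct (V := R_CompleteNormedModule)), dominated_ex_RInt, Hf.
    + apply (is_RInt_scal (V := R_NormedModule) g).
      apply (RInt_correct (V := R_CompleteNormedModule)), dominated_ex_RInt, Hg.
  - apply is_lim_seq_plus'.
    + apply (is_lim_seq_scal_l _ a (improper f)), improper_correct, Hf.
    + apply (is_lim_seq_scal_l _ b (improper g)), improper_correct, Hg.
Qed.

Lemma improper_le (f g : R -> R) :
  dominated f -> dominated g -> (forall t, 0 <= t -> f t <= g t) -> improper f <= improper g.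
Proof.
  intros Hf Hg H.
  apply (is_lim_seq_le (fun n => RInt f 0 (INR n)) (fun n => RInt g 0 (INR n))
    (improper f) (improper g)).
  - intros n. apply RInt_le; [apply pos_INR | apply dominated_ex_RInt, Hf |
      apply dominated_ex_RInt, Hg |]. intros t Ht. apply H. lra.
  - apply improper_correct, Hf.
  - apply improper_correct, Hg.
Qed.

Lemma improper_abs_le (f g : R -> R) :
  dominated f -> dominated g -> (forall t, 0 <= t -> Rabs (f t) <= g t) ->
  Rabs (improper f) <= improper g.
Proof.
  intros Hf Hg H. apply Rabs_le. split.
  - apply Rle_trans with (improper (fun t => 0 * f t + (-1) * g t)).
    + rewrite improper_lin by assumption. lra.
    + apply improper_le; [apply dominated_lin; assumption | exact Hf |].
      intros t Ht. specialize (H t Ht). apply Rabs_le_between in H. lra.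
  - apply improper_le; [exact Hf | exact Hg |].
    intros t Ht. specialize (H t Ht). apply Rabs_le_between in H. lra.
Qed.

Lemma improper_antiderivative (f F : R -> R) :
  (forall t, is_derive F t (f t)) -> (forall t, continuous f t) ->
  is_lim_seq (fun n => F (INR n)) 0 -> improper f = - F 0.
Proof.
  intros HF Hc Hl. apply improper_unique.
  apply is_lim_seq_ext with (fun n => F (INR n) - F 0).
  - intros n. symmetry. apply RInt_antiderivative; assumption.
  - replace (Finite (- F 0)) with (Finite (0 - F 0)) by (f_equal; ring).
    apply is_lim_seq_minus'; [exact Hl | apply is_lim_seq_const].
Qed.

Lemma is_lim_seq_exp_neg (k : R) : 0 < k -> is_lim_seq (fun n => exp (- (k * INR n))) 0.
Proof.
  intros Hk. apply is_lim_seq_ext with (fun n => exp (- k) ^ n).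
  - intros n. induction n as [|n IH]; [simpl; rewrite Rmult_0_r, Ropp_0, exp_0; reflexivity|].
    rewrite <- tech_pow_Rmult, IH, <- exp_plus, S_INR. f_equal. ring.
  - apply is_lim_seq_geom. rewrite Rabs_pos_eq by (left; apply exp_pos).
    rewrite <- exp_0. apply exp_increasing. lra.
Qed.

Lemma dominated_exp_half (K : R) : dominated (fun t => K * exp (- t / 2)).
Proof.
  split; [apply exp_half_continuous|]. exists (Rabs K). intros t _.
  rewrite Rabs_mult, (Rabs_pos_eq (exp _)); [lra | left; apply exp_pos].
Qed.

Lemma improper_exp_half (K : R) : improper (fun t => K * exp (- t / 2)) = 2 * K.
Proof.
  rewrite (improper_antiderivative _ (fun t => - 2 * K * exp (- t / 2))).
  - rewrite Ropp_0, Rdiv_0_l, exp_0. ring.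
  - apply exp_half_is_derive.
  - apply exp_half_continuous.
  - replace (Finite 0) with (Finite (- 2 * K * 0)) by (f_equal; ring).
    apply (is_lim_seq_scal_l _ (- 2 * K) 0).
    apply is_lim_seq_ext with (2 := is_lim_seq_exp_neg (1/2) ltac:(lra)).
    intros n. f_equal. field.
Qed.

Lemma improper_tail (f : R -> R) (U k : R) :
  dominated f -> 0 <= U ->
  (forall t, U <= t -> 0 <= f t <= k * exp (- (t - U))) ->
  0 <= improper f - RInt f 0 U <= k.
Proof.
  intros Hf HU H.
  assert (Hx : forall a b, ex_RInt f a b) by (intros; apply dominated_ex_RInt, Hf).
  assert (Hl : is_lim_seq (fun n => RInt f U (INR n)) (improper f - RInt f 0 U)).
  { apply is_lim_seq_ext with (fun n => RInt f 0 (INR n) - RInt f 0 U).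
    - intros n. rewrite <- (RInt_Chasles (V := R_CompleteNormedModule) f 0 U (INR n)) by apply Hx.
      change plus with Rplus. ring.
    - apply is_lim_seq_minus'; [apply improper_correct, Hf | apply is_lim_seq_const]. }
  assert (Hk : 0 <= k).
  { specialize (H U (Rle_refl U)). rewrite Rminus_diag, Ropp_0, exp_0 in H. lra. }
  destruct (INR_unbounded U) as [N HN].
  assert (Hb : forall n, 0 <= RInt f U (INR (n + N)) <= k).
  { intros n.
    assert (HUn : U <= INR (n + N)) by (rewrite plus_INR; pose proof (pos_INR n); lra).
    split.
    - apply RInt_ge_0; [exact HUn | apply Hx |]. intros t Ht. apply H. lra.
    - apply Rle_trans with (RInt (fun t => k * exp (- (t - U))) U (INR (n + N))).
      + apply RInt_le; [exact HUn | apply Hx | |].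
        * apply continuous_ex_RInt. intros t.
          apply (ex_derive_continuous (fun t => k * exp (- (t - U)))). auto_derive. exact I.
        * intros t Ht. apply H. lra.
      + rewrite (RInt_antiderivative _ (fun t => - k * exp (- (t - U)))).
        * rewrite Rminus_diag, Ropp_0, exp_0. pose proof (exp_pos (- (INR (n + N) - U))). nra.
        * intros t. auto_derive; [exact I | change (t + - U) with (t - U); ring].
        * intros t. apply (ex_derive_continuous (fun t => k * exp (- (t - U)))).
          auto_derive. exact I. }
  apply is_lim_seq_incr_n with (N := N) in Hl.
  split.
  - apply (is_lim_seq_le (fun _ => 0) (fun n => RInt f U (INR (n + N))) 0 (improper f - RInt f 0 U));
      [apply Hb | apply is_lim_seq_const | exact Hl].
  - apply (is_lim_seq_le (fun n => RInt f U (INR (n + N))) (fun _ => k) (improper f - RInt f 0 U) k);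
      [apply Hb | exact Hl | apply is_lim_seq_const].
Qed.

(** * Schlaefli's integrals *)

Lemma exp_ge_1_plus (x : R) : 1 + x <= exp x.
Proof.
  destruct (Req_dec x 0) as [->|H]; [rewrite exp_0; lra | left; apply exp_ineq1, H].
Qed.

Lemma exp_monotone (x y : R) : x <= y -> exp x <= exp y.
Proof. intros [H| ->]; [left; apply exp_increasing, H | right; reflexivity]. Qed.

Lemma exp_quadratic (u : R) : Rabs (exp u - 1 - u) <= u ^ 2 * exp (Rabs u).
Proof.
  destruct (MVT_gen exp 0 u exp) as [c [Hc Ec]].
  { intros. apply is_derive_exp. }
  { intros. apply derivable_continuous_pt, derivable_pt_exp. }
  destruct (MVT_gen exp 0 c exp) as [d [Hd Ed]].
  { intros. apply is_derive_exp. }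
  { intros. apply derivable_continuous_pt, derivable_pt_exp. }
  rewrite exp_0 in *.
  assert (Hcu : Rabs c <= Rabs u).
  { destruct (Rle_dec 0 u).
    - rewrite Rmin_left, Rmax_right in Hc by lra. rewrite !Rabs_pos_eq; lra.
    - rewrite Rmin_right, Rmax_left in Hc by lra. rewrite !Rabs_left1; lra. }
  assert (Hdu : d <= Rabs u).
  { apply Rle_trans with (Rabs c); [|exact Hcu].
    destruct (Rle_dec 0 c).
    - rewrite Rmin_left, Rmax_right in Hd by lra. rewrite Rabs_pos_eq; lra.
    - rewrite Rmin_right, Rmax_left in Hd by lra. pose proof (Rabs_pos c). lra. }
  replace (exp u - 1 - u) with (exp d * c * u) by nra.
  rewrite !Rabs_mult, (Rabs_pos_eq (exp d)) by (left; apply exp_pos).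
  rewrite <- (pow2_abs u).
  assert (exp d <= exp (Rabs u)) by (apply exp_monotone, Hdu).
  pose proof (exp_pos d). pose proof (Rabs_pos c). pose proof (Rabs_pos u).
  assert (exp d * Rabs c <= exp (Rabs u) * Rabs u) by (apply Rmult_le_compat; lra).
  nra.
Qed.

Lemma sinh_nonneg (t : R) : 0 <= t -> 0 <= sinh t.
Proof.
  intros H. unfold sinh. assert (exp (- t) <= exp t) by (apply exp_monotone; lra). lra.
Qed.

Lemma sinh_ge_sqr (t : R) : 0 <= t -> t ^ 2 / 8 <= sinh t.
Proof.
  intros H. unfold sinh.
  assert (exp (- t) <= 1) by (rewrite <- exp_0; apply exp_monotone; lra).
  assert (exp t = exp (t / 2) * exp (t / 2)) by (rewrite <- exp_plus; f_equal; lra).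
  pose proof (exp_ge_1_plus (t / 2)). nra.
Qed.

(** The exponential integrand in Schlaefli's formula for Y_n, which uses a = n and a = -n. A real
    parameter lets factors exp(t) and exp(-t) be absorbed as shifts of a by one. *)
Definition schlaefli_kernel (a z t : R) : R := exp (a * t - z * sinh t).

Lemma schlaefli_kernel_pos (a z t : R) : 0 < schlaefli_kernel a z t.
Proof. apply exp_pos. Qed.

Lemma is_derive_sinh_R (t : R) : is_derive sinh t (cosh t).
Proof.
  unfold sinh, cosh. auto_derive; [exact I|]. field.
Qed.

Lemma schlaefli_kernel_is_derive (a z t : R) :
  is_derive (schlaefli_kernel a z) t ((a - z * cosh t) * schlaefli_kernel a z t).
Proof.
  unfold schlaefli_kernel.
  apply (is_derive_comp exp (fun t => a * t - z * sinh t)); [apply is_derive_exp|].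
  apply (is_derive_minus (fun t => a * t) (fun t => z * sinh t)).
  - auto_derive; [exact I | ring].
  - apply is_derive_scal, is_derive_sinh_R.
Qed.

Lemma schlaefli_kernel_continuous (a z t : R) : continuous (schlaefli_kernel a z) t.
Proof.
  apply (ex_derive_continuous (schlaefli_kernel a z)). eexists.
  apply schlaefli_kernel_is_derive.
Qed.

(** The quadratic lower bound on sinh already beats the linear term: completing the square gives (a
    + 1/2) t <= z t^2 / 8 + 2 (a + 1/2)^2 / z, the added 1/2 paying for the factor exp(-t/2). *)
Lemma schlaefli_kernel_decay (a z t : R) :
  0 < z -> 0 <= t ->
  schlaefli_kernel a z t <= exp (2 * (a + 1 / 2) ^ 2 / z) * exp (- t / 2).
Proof.
  intros Hz Ht. unfold schlaefli_kernel. rewrite <- exp_plus. apply exp_monotone.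
  pose proof (sinh_ge_sqr t Ht).
  set (b := a + 1 / 2).
  assert (b * t <= z * (t ^ 2 / 8) + 2 * b ^ 2 / z).
  { assert (0 <= z * (t / 4 - b / z) ^ 2 * 2).
    { apply Rmult_le_pos; [apply Rmult_le_pos; [lra | apply pow2_ge_0] | lra]. }
    replace (z * (t / 4 - b / z) ^ 2 * 2) with
      (z * (t ^ 2 / 8) + 2 * b ^ 2 / z - b * t) in H0 by (field; lra). lra. }
  unfold b in *. nra.
Qed.

Lemma schlaefli_kernel_dominated (a z : R) : 0 < z -> dominated (schlaefli_kernel a z).
Proof.
  intros Hz. split; [apply schlaefli_kernel_continuous|].
  exists (exp (2 * (a + 1 / 2) ^ 2 / z)). intros t Ht.
  rewrite Rabs_pos_eq by (left; apply schlaefli_kernel_pos).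
  apply schlaefli_kernel_decay; assumption.
Qed.

Lemma schlaefli_kernel_shift (a z t : R) :
  schlaefli_kernel (a + 1) z t = exp t * schlaefli_kernel a z t /\
  schlaefli_kernel (a - 1) z t = exp (- t) * schlaefli_kernel a z t.
Proof.
  unfold schlaefli_kernel. rewrite <- !exp_plus. split; f_equal; ring.
Qed.

Definition schlaefli_tail (a z : R) : R := improper (schlaefli_kernel a z).

Ltac solve_dominated :=
  repeat match goal with
  | |- dominated (fun t => _ * _ + _ * _) => apply dominated_lin
  end; auto.

(** The z-derivative of the kernel is - sinh t times the kernel, that is half a difference of
    shifted kernels. *)
Lemma schlaefli_tail_is_derive (a z : R) :
  0 < z ->
  is_derive (schlaefli_tail a) z (- (schlaefli_tail (a + 1) z - schlaefli_tail (a - 1) z) / 2).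
Proof.
  intros Hz.
  (* [B] equals 4 sinh^2 t times the kernel at z/2. It majorizes the second-order remainder for |h|
     <= z/2, since exp(|h| sinh t) is absorbed by lowering z to z/2; written as a combination of
     shifted kernels it is dominated at once. *)
  set (B := fun t => 1 * schlaefli_kernel (a + 1 + 1) (z / 2) t
     + 1 * ((-2) * schlaefli_kernel a (z / 2) t + 1 * schlaefli_kernel (a - 1 - 1) (z / 2) t)).
  assert (HdB : dominated B).
  { apply dominated_lin; [|apply dominated_lin]; apply schlaefli_kernel_dominated; lra. }
  apply is_derive_of_quadratic with (C := improper B) (d := z / 2); [lra|].
  intros h Hh. assert (Hh' := Hh). apply Rabs_le_between in Hh'.
  set (D := fun t => 1 * schlaefli_kernel a (z + h) t
     + 1 * ((-1) * schlaefli_kernel a z t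
     + 1 * ((h / 2) * schlaefli_kernel (a + 1) z t + (- h / 2) * schlaefli_kernel (a - 1) z t))) in |- *.
  destruct (Req_dec h 0) as [->|Hh0].
  { rewrite Rplus_0_r. replace (_ - _ - _) with 0 by ring. rewrite Rabs_R0. simpl. lra. }
  assert (Hk : forall b, dominated (schlaefli_kernel b z)) by (intros; apply schlaefli_kernel_dominated, Hz).
  assert (Hk' : dominated (schlaefli_kernel a (z + h))) by (apply schlaefli_kernel_dominated; lra).
  assert (HD : dominated D) by (unfold D; solve_dominated).
  replace (schlaefli_tail a (z + h) - schlaefli_tail a z
    - h * (- (schlaefli_tail (a + 1) z - schlaefli_tail (a - 1) z) / 2)) with (improper D).
  2:{ unfold D, schlaefli_tail. rewrite !improper_lin; solve_dominated. field. }
  replace (improper B * h ^ 2) with (improper (fun t => h ^ 2 * B t + 0 * B t)).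
  2:{ rewrite improper_lin by assumption. ring. }
  apply improper_abs_le; [exact HD | apply dominated_lin; assumption |].
  intros t Ht. pose proof (sinh_nonneg t Ht) as Hs.
  assert (EB : B t = 4 * sinh t ^ 2 * schlaefli_kernel a (z / 2) t).
  { unfold B, sinh.
    destruct (schlaefli_kernel_shift a (z / 2) t) as [E1 E2].
    destruct (schlaefli_kernel_shift (a + 1) (z / 2) t) as [E3 _].
    destruct (schlaefli_kernel_shift (a - 1) (z / 2) t) as [_ E4].
    rewrite E3, E4, E1, E2.
    assert (E : exp t * exp (- t) = 1) by (rewrite <- exp_plus, Rplus_opp_r; apply exp_0).
    clear E1 E2 E3 E4. revert E. generalize (exp t) (exp (- t)). intros e e' E.
    generalize (schlaefli_kernel a (z / 2) t). intros w.
    replace (4 * ((e - e') / 2) ^ 2 * w) with ((e ^ 2 - 2 * (e * e') + e' ^ 2) * w) by field.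
    rewrite E. ring. }
  assert (ED : D t = schlaefli_kernel a z t * (exp (- (h * sinh t)) - 1 - (- (h * sinh t)))).
  { unfold D. destruct (schlaefli_kernel_shift a z t) as [-> ->].
    replace (schlaefli_kernel a (z + h) t) with (schlaefli_kernel a z t * exp (- (h * sinh t))).
    - generalize (exp (- (h * sinh t))). intros q. unfold sinh. field.
    - unfold schlaefli_kernel. rewrite <- exp_plus. f_equal. ring. }
  rewrite EB, ED, Rabs_mult, (Rabs_pos_eq (schlaefli_kernel _ _ _)) by (left; apply schlaefli_kernel_pos).
  pose proof (exp_quadratic (- (h * sinh t))) as Hq.
  rewrite Rabs_Ropp, Rabs_mult, (Rabs_pos_eq (sinh t)) in Hq by exact Hs.
  assert (Hle : schlaefli_kernel a z t * exp (Rabs h * sinh t) <= schlaefli_kernel a (z / 2) t).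
  { unfold schlaefli_kernel. rewrite <- exp_plus. apply exp_monotone. nra. }
  pose proof (schlaefli_kernel_pos a z t).
  pose proof (schlaefli_kernel_pos a (z / 2) t).
  eapply Rle_trans; [apply Rmult_le_compat_l; [lra | exact Hq]|].
  assert (0 <= (h * sinh t) ^ 2) by apply pow2_ge_0.
  apply Rle_trans with ((h * sinh t) ^ 2 * schlaefli_kernel a (z / 2) t); nra.
Qed.

(** Integrate the t-derivative (a - z cosh t) times the kernel over the half-line: the kernel falls
    from 1 at t = 0 to 0 at infinity, whence the inhomogeneous term. *)
Lemma schlaefli_tail_rec (a z : R) :
  0 < z ->
  schlaefli_tail (a + 1) z + schlaefli_tail (a - 1) z = 2 / z * (a * schlaefli_tail a z + 1).
Proof.
  intros Hz.
  assert (Hk : forall b, dominated (schlaefli_kernel b z)) by (intros; apply schlaefli_kernel_dominated, Hz).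
  assert (H : improper (fun t => a * schlaefli_kernel a z t
     + (- z / 2) * (1 * schlaefli_kernel (a + 1) z t + 1 * schlaefli_kernel (a - 1) z t)) = - 1).
  { replace (- 1) with (- schlaefli_kernel a z 0).
    - apply improper_antiderivative.
      + intros t. apply is_derive_eq with (1 := schlaefli_kernel_is_derive a z t).
        destruct (schlaefli_kernel_shift a z t) as [-> ->]. unfold cosh. field.
      + intros t. apply dominated_continuous. solve_dominated.
      + apply is_lim_seq_le_le with (u := fun _ => 0)
          (w := fun n => exp (2 * (a + 1 / 2) ^ 2 / z) * exp (- (1 / 2 * INR n))).
        * intros n. split; [left; apply schlaefli_kernel_pos|].
          replace (- (1 / 2 * INR n)) with (- INR n / 2) by field.
          apply schlaefli_kernel_decay; [exact Hz | apply pos_INR].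
        * apply is_lim_seq_const.
        * replace (Finite 0) with (Rbar_mult (exp (2 * (a + 1 / 2) ^ 2 / z)) 0)
            by (simpl; f_equal; ring).
          apply is_lim_seq_scal_l, is_lim_seq_exp_neg. lra.
    - unfold schlaefli_kernel. rewrite sinh_0, !Rmult_0_r, Rminus_0_r, exp_0. reflexivity. }
  rewrite !improper_lin in H; solve_dominated.
  unfold schlaefli_tail in *. apply Rmult_eq_reg_l with (z / 2); [|lra].
  transitivity (a * improper (schlaefli_kernel a z) + 1); [lra | field; lra].
Qed.

Lemma cos_lipschitz (x y : R) : Rabs (cos x - cos y) <= Rabs (x - y).
Proof.
  destruct (MVT_gen cos y x (fun x => - sin x)) as [c [_ ->]].
  - intros. apply is_derive_cos.
  - intros. apply continuity_cos.
  - rewrite Rabs_mult, Rabs_Ropp. pose proof (Rabs_pos (x - y)).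
    assert (Rabs (sin c) <= 1) by (apply Rabs_le, SIN_bound). nra.
Qed.

Lemma cos_quadratic (x k : R) : Rabs (cos (x + k) - cos x + k * sin x) <= k ^ 2.
Proof.
  destruct (MVT_gen cos x (x + k) (fun x => - sin x)) as [c [Hc Ec]].
  { intros. apply is_derive_cos. }
  { intros. apply continuity_cos. }
  destruct (MVT_gen sin c x cos) as [d [_ Ed]].
  { intros. apply is_derive_sin. }
  { intros. apply continuity_sin. }
  rewrite Ec. replace (- sin c * (x + k - x) + k * sin x) with (k * (sin x - sin c)) by ring.
  rewrite Ed, !Rabs_mult.
  assert (Rabs (cos d) <= 1) by (apply Rabs_le, COS_bound).
  assert (Rabs (x - c) <= Rabs k).
  { apply Rabs_le. destruct (Rle_dec 0 k).
    - rewrite Rmin_left, Rmax_right in Hc by lra. rewrite Rabs_pos_eq; lra.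
    - rewrite Rmin_right, Rmax_left in Hc by lra. rewrite Rabs_left; lra. }
  rewrite <- (pow2_abs k). pose proof (Rabs_pos k). pose proof (Rabs_pos (x - c)).
  pose proof (Rabs_pos (cos d)).
  assert (Rabs (cos d) * Rabs (x - c) <= 1 * Rabs k) by (apply Rmult_le_compat; lra). nra.
Qed.

Lemma ex_derive_ex_RInt (f : R -> R) (a b : R) :
  (forall t, ex_derive f t) -> ex_RInt f a b.
Proof.
  intros H. apply continuous_ex_RInt. intros t. apply (ex_derive_continuous f), H.
Qed.

(** The phase d treats both kinds at once: d = 0 gives the integral for J, and d = - pi/2 turns the
    cosine into the sine in the formula for Y. *)
Definition schlaefli_cos (a d z : R) : R :=
  RInt (fun t => cos (a * t - z * sin t + d)) 0 PI.

Lemma schlaefli_cos_ex (a d z u v : R) :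
  ex_RInt (fun t => cos (a * t - z * sin t + d)) u v.
Proof. apply ex_derive_ex_RInt. intros t. auto_derive. exact I. Qed.

Lemma RInt_lin (f g : R -> R) (a b u v : R) :
  ex_RInt f u v -> ex_RInt g u v ->
  RInt (fun t => a * f t + b * g t) u v = a * RInt f u v + b * RInt g u v.
Proof.
  intros Hf Hg. apply is_RInt_unique.
  apply (is_RInt_plus (V := R_NormedModule) (fun t => a * f t) (fun t => b * g t)).
  - apply (is_RInt_scal (V := R_NormedModule) f), (RInt_correct (V := R_CompleteNormedModule)), Hf.
  - apply (is_RInt_scal (V := R_NormedModule) g), (RInt_correct (V := R_CompleteNormedModule)), Hg.
Qed.

Lemma ex_RInt_lin (f g : R -> R) (a b u v : R) :
  ex_RInt f u v -> ex_RInt g u v -> ex_RInt (fun t => a * f t + b * g t) u v.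
Proof.
  intros Hf Hg.
  apply (ex_RInt_plus (V := R_NormedModule) (fun t => a * f t) (fun t => b * g t)).
  - apply (ex_RInt_scal (V := R_NormedModule) f), Hf.
  - apply (ex_RInt_scal (V := R_NormedModule) g), Hg.
Qed.

Ltac solve_ex_RInt_lin Hx :=
  repeat match goal with
  | |- ex_RInt (fun t => _ * _ + _ * _) _ _ => apply ex_RInt_lin
  end; try apply Hx.

Lemma RInt_abs_bound (f : R -> R) (a b M : R) :
  a <= b -> ex_RInt f a b -> (forall t, a <= t <= b -> Rabs (f t) <= M) ->
  Rabs (RInt f a b) <= (b - a) * M.
Proof.
  intros Hab Hf H. apply (norm_RInt_le_const (V := R_NormedModule) f a b (RInt f a b) M Hab H).
  apply (RInt_correct (V := R_CompleteNormedModule)), Hf.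
Qed.

Lemma schlaefli_cos_is_derive (a d z : R) :
  is_derive (schlaefli_cos a d) z ((schlaefli_cos (a - 1) d z - schlaefli_cos (a + 1) d z) / 2).
Proof.
  apply is_derive_of_quadratic with (C := PI) (d := 1); [lra|]. intros h _.
  pose proof schlaefli_cos_ex as Hx. pose proof PI_RGT_0.
  set (D := fun t => 1 * cos (a * t - (z + h) * sin t + d)
     + 1 * ((-1) * cos (a * t - z * sin t + d)
     + 1 * ((h / 2) * cos ((a + 1) * t - z * sin t + d)
        + (- h / 2) * cos ((a - 1) * t - z * sin t + d)))).
  replace (_ - _ - _) with (RInt D 0 PI).
  2:{ unfold D, schlaefli_cos. rewrite !RInt_lin; solve_ex_RInt_lin Hx. as_Req. field. }
  replace (PI * h ^ 2) with ((PI - 0) * h ^ 2) by ring.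
  apply RInt_abs_bound; [lra | unfold D; solve_ex_RInt_lin Hx |].
  intros t _. unfold D. set (x := a * t - z * sin t + d).
  replace (a * t - (z + h) * sin t + d) with (x + - (h * sin t)) by (unfold x; ring).
  replace ((a + 1) * t - z * sin t + d) with (x + t) by (unfold x; ring).
  replace ((a - 1) * t - z * sin t + d) with (x - t) by (unfold x; ring).
  rewrite (cos_plus x t), (cos_minus x t).
  replace (_ + _) with (cos (x + - (h * sin t)) - cos x + - (h * sin t) * sin x) by field.
  eapply Rle_trans; [apply cos_quadratic|].
  pose proof (SIN_bound t). assert (sin t ^ 2 <= 1) by nra. pose proof (pow2_ge_0 h). nra.
Qed.

(** Integrate the derivative of sin(a t - z sin t + d). At integer a the boundary term vanishes for
    d = 0; for d = - pi/2 it survives at odd a, and the half-line integrals compensate it later. *)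
Lemma schlaefli_cos_rec (a d z : R) :
  z * (schlaefli_cos (a - 1) d z + schlaefli_cos (a + 1) d z)
  = 2 * a * schlaefli_cos a d z - 2 * (sin (a * PI + d) - sin d).
Proof.
  pose proof schlaefli_cos_ex as Hx.
  set (f := fun t => a * cos (a * t - z * sin t + d)
    + (- z / 2) * (1 * cos ((a + 1) * t - z * sin t + d) + 1 * cos ((a - 1) * t - z * sin t + d))).
  assert (H : RInt f 0 PI = sin (a * PI - z * sin PI + d) - sin (a * 0 - z * sin 0 + d)).
  { apply (RInt_antiderivative f (fun t => sin (a * t - z * sin t + d))).
    - intros t. unfold f. set (x := a * t - z * sin t + d).
      replace ((a + 1) * t - z * sin t + d) with (x + t) by (unfold x; ring).
      replace ((a - 1) * t - z * sin t + d) with (x - t) by (unfold x; ring).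
      rewrite (cos_plus x t), (cos_minus x t). unfold x.
      auto_derive; [exact I|].
      change (a * t + - (z * sin t)) with (a * t - z * sin t). field.
    - intros t. unfold f.
      apply (ex_derive_continuous f). unfold f. auto_derive. exact I. }
  unfold f in H. rewrite !RInt_lin in H; solve_ex_RInt_lin Hx.
  rewrite sin_PI, sin_0, !Rmult_0_r, !Rminus_0_r, Rplus_0_l in H.
  unfold schlaefli_cos. lra.
Qed.

Lemma schlaefli_cos_near_0 (a d z : R) :
  Rabs (schlaefli_cos a d z - schlaefli_cos a d 0) <= PI * Rabs z.
Proof.
  pose proof schlaefli_cos_ex as Hx. pose proof PI_RGT_0.
  replace (_ - _) with (RInt (fun t => 1 * cos (a * t - z * sin t + d)
     + (-1) * cos (a * t - 0 * sin t + d)) 0 PI).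
  2:{ unfold schlaefli_cos. rewrite RInt_lin by apply Hx. as_Req. ring. }
  replace (PI * Rabs z) with ((PI - 0) * Rabs z) by ring.
  apply RInt_abs_bound; [lra | apply ex_RInt_lin; apply Hx |]. intros t _.
  replace (_ + _) with (cos (a * t - z * sin t + d) - cos (a * t - 0 * sin t + d)) by ring.
  eapply Rle_trans; [apply cos_lipschitz|].
  replace (_ - _) with (- (z * sin t)) by ring. rewrite Rabs_Ropp, Rabs_mult.
  assert (Rabs (sin t) <= 1) by (apply Rabs_le, SIN_bound). pose proof (Rabs_pos z). nra.
Qed.

Lemma schlaefli_cos_0_0 (d : R) : schlaefli_cos 0 d 0 = PI * cos d.
Proof.
  unfold schlaefli_cos.
  rewrite (RInt_ext _ (fun _ => cos d)).
  - rewrite RInt_const. change scal with Rmult. as_Req. ring.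
  - intros t _. f_equal. ring.
Qed.

Lemma schlaefli_cos_1_0 (d : R) : schlaefli_cos 1 d 0 = - 2 * sin d.
Proof.
  unfold schlaefli_cos.
  rewrite (RInt_ext _ (fun t => cos (t + d))) by (intros; f_equal; ring).
  rewrite (RInt_antiderivative _ (fun t => sin (t + d))).
  - rewrite (Rplus_comm PI), neg_sin, Rplus_0_l. as_Req. ring.
  - intros t. auto_derive; [exact I | ring].
  - intros t. apply (ex_derive_continuous (fun t => cos (t + d))). auto_derive. exact I.
Qed.

(** * The Euler constant *)

Lemma bernoulli (x : R) (n : nat) : -1 <= x -> 1 + INR n * x <= (1 + x) ^ n.
Proof.
  intros Hx. induction n as [|n IH]; [simpl; lra|].
  rewrite <- tech_pow_Rmult, S_INR. pose proof (pos_INR n).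
  apply Rle_trans with ((1 + x) * (1 + INR n * x)); [nra|].
  apply Rmult_le_compat_l; lra.
Qed.

Lemma exp_pow (x : R) (n : nat) : exp x ^ n = exp (INR n * x).
Proof.
  induction n as [|n IH]; [simpl; rewrite Rmult_0_l, exp_0; reflexivity|].
  rewrite <- tech_pow_Rmult, IH, <- exp_plus, S_INR. f_equal. ring.
Qed.

(** A quantitative form of (1 - y)^n ~ exp(-n y). From 1 + y <= exp(y) follows (1 - y^2) exp(-y) <=
    1 - y; raise this to the power n and use Bernoulli on (1 - y^2)^n. *)
Lemma exp_neg_vs_pow (y : R) (n : nat) :
  0 <= y <= 1 ->
  0 <= exp (- (INR n * y)) - (1 - y) ^ n <= INR n * y ^ 2 * exp (- (INR n * y)).
Proof.
  intros Hy. replace (- (INR n * y)) with (INR n * - y) by ring. rewrite <- exp_pow.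
  split.
  - assert ((1 - y) ^ n <= exp (- y) ^ n); [|lra].
    apply pow_incr. pose proof (exp_ge_1_plus (- y)). lra.
  - assert ((1 - INR n * y ^ 2) * exp (- y) ^ n <= (1 - y) ^ n); [|lra].
    apply Rle_trans with ((1 - y ^ 2) ^ n * exp (- y) ^ n).
    + apply Rmult_le_compat_r; [apply pow_le; left; apply exp_pos|].
      pose proof (bernoulli (- y ^ 2) n ltac:(nra)). unfold Rminus at 2. lra.
    + rewrite <- Rpow_mult_distr. apply pow_incr. split.
      * apply Rmult_le_pos; [nra | left; apply exp_pos].
      * pose proof (exp_ge_1_plus y). pose proof (exp_pos (- y)).
        assert (exp y * exp (- y) = 1) by (rewrite <- exp_plus, Rplus_opp_r; apply exp_0).
        replace (1 - y ^ 2) with ((1 - y) * (1 + y)) by ring.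
        apply Rle_trans with ((1 - y) * (exp y * exp (- y))); [|nra].
        rewrite Rmult_assoc. apply Rmult_le_compat_l; [lra|]. nra.
Qed.

(* This is [exp (- exp t / n)]. With [U = 2 ln n] and [y = exp (t - U)], replacing [exp (- n y)] by
   [(1 - y) ^ n] gives an integral over [[0, U]] close to [U - harmonic n]. *)
Definition gumbel_kernel (n : nat) (t : R) : R := exp (- (INR n * exp (t - 2 * ln (INR n)))).

Lemma exp_shift_2ln (n : nat) (t : R) :
  (0 < n)%nat -> exp (t - 2 * ln (INR n)) = exp t / INR n ^ 2.
Proof.
  intros Hn. apply lt_0_INR in Hn. unfold Rminus. rewrite exp_plus.
  replace (- (2 * ln (INR n))) with (- ln (INR n) + - ln (INR n)) by ring.
  rewrite exp_plus, exp_Ropp, exp_ln by exact Hn. field. lra.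
Qed.

Lemma gumbel_kernel_continuous (n : nat) (t : R) : continuous (gumbel_kernel n) t.
Proof. apply (ex_derive_continuous (gumbel_kernel n)). unfold gumbel_kernel. auto_derive. exact I. Qed.

Lemma schlaefli_kernel_gumbel (n : nat) (t : R) :
  (0 < n)%nat ->
  schlaefli_kernel 0 (2 / INR n) t = gumbel_kernel n t * exp (exp (- t) / INR n).
Proof.
  intros Hn. unfold gumbel_kernel. rewrite exp_shift_2ln by exact Hn. apply lt_0_INR in Hn.
  unfold schlaefli_kernel, sinh. rewrite <- exp_plus. f_equal. field. lra.
Qed.

Lemma gumbel_kernel_pos (n : nat) (t : R) : 0 < gumbel_kernel n t.
Proof. apply exp_pos. Qed.

Lemma gumbel_kernel_le_1 (n : nat) (t : R) : gumbel_kernel n t <= 1.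
Proof.
  unfold gumbel_kernel. rewrite <- exp_0. apply exp_monotone.
  pose proof (exp_pos (t - 2 * ln (INR n))). pose proof (pos_INR n). nra.
Qed.

Lemma gumbel_kernel_dominated (n : nat) : (0 < n)%nat -> dominated (gumbel_kernel n).
Proof.
  intros Hn. split; [apply gumbel_kernel_continuous|].
  assert (Hz : 0 < 2 / INR n) by (apply Rdiv_lt_0_compat; [lra | apply lt_0_INR, Hn]).
  destruct (schlaefli_kernel_dominated 0 _ Hz) as [_ [K HK]]. exists K.
  intros t Ht. eapply Rle_trans; [|apply HK, Ht].
  rewrite schlaefli_kernel_gumbel by exact Hn.
  rewrite Rabs_mult. pose proof (Rabs_pos (gumbel_kernel n t)).
  assert (1 <= Rabs (exp (exp (- t) / INR n))); [|nra].
  rewrite Rabs_pos_eq by (left; apply exp_pos). rewrite <- exp_0 at 1.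
  apply exp_monotone. apply Rdiv_le_0_compat; [left; apply exp_pos | apply lt_0_INR, Hn].
Qed.

Lemma exp_minus_1_le (x : R) : exp x - 1 <= x * exp x.
Proof.
  pose proof (exp_ge_1_plus (- x)). pose proof (exp_pos x).
  assert (exp x * exp (- x) = 1) by (rewrite <- exp_plus, Rplus_opp_r; apply exp_0). nra.
Qed.

(** The two kernels differ by the factor exp(exp(-t)/n), which exceeds 1 by at most 3 exp(-t)/n;
    integrating 3/n exp(-t/2) gives 6/n. *)
Lemma schlaefli_tail_0_gumbel (n : nat) :
  (0 < n)%nat ->
  0 <= schlaefli_tail 0 (2 / INR n) - improper (gumbel_kernel n) <= 6 / INR n.
Proof.
  intros Hn. assert (Hn' : 1 <= INR n) by (apply (le_INR 1); lia).
  assert (Hz : 0 < 2 / INR n) by (apply Rdiv_lt_0_compat; lra).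
  pose proof (gumbel_kernel_dominated n Hn) as Hg.
  pose proof (schlaefli_kernel_dominated 0 _ Hz) as Hs.
  unfold schlaefli_tail.
  assert (Hb : forall t, 0 <= t -> 0 <= schlaefli_kernel 0 (2 / INR n) t - gumbel_kernel n t
     <= 3 / INR n * exp (- t / 2)).
  { intros t Ht. rewrite schlaefli_kernel_gumbel by exact Hn.
    pose proof (gumbel_kernel_pos n t). pose proof (gumbel_kernel_le_1 n t).
    pose proof (exp_minus_1_le (exp (- t) / INR n)) as H1.
    assert (H2 : 0 <= exp (- t) / INR n) by (apply Rdiv_le_0_compat; [left; apply exp_pos | lra]).
    pose proof (exp_ge_1_plus (exp (- t) / INR n)) as H3.
    assert (H4 : exp (- t) <= exp (- t / 2)) by (apply exp_monotone; lra).
    assert (H5 : exp (exp (- t) / INR n) <= 3).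
    { apply Rle_trans with (exp 1); [|apply exp_le_3]. apply exp_monotone.
      assert (exp (- t) <= 1) by (rewrite <- exp_0; apply exp_monotone; lra).
      apply Rle_div_l; [lra|]. lra. }
    split; [nra|].
    apply Rle_trans with (exp (exp (- t) / INR n) - 1); [nra|].
    eapply Rle_trans; [exact H1|].
    apply Rle_trans with (exp (- t) / INR n * 3); [nra|].
    unfold Rdiv. rewrite (Rmult_comm 3), Rmult_assoc, (Rmult_comm (exp (- t))), Rmult_assoc.
    assert (0 < / INR n) by (apply Rinv_0_lt_compat; lra). unfold Rdiv in H4. nra. }
  replace (improper (schlaefli_kernel 0 (2 / INR n)) - improper (gumbel_kernel n)) with
    (improper (fun t => 1 * schlaefli_kernel 0 (2 / INR n) t + (-1) * gumbel_kernel n t))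
    by (rewrite improper_lin by assumption; ring).
  split.
  - apply Rle_trans with (improper (fun t => 0 * exp (- t / 2))); [rewrite improper_exp_half; lra|].
    apply improper_le; [apply dominated_exp_half | apply (dominated_lin _ _ 1 (-1) Hs Hg) |].
    intros t Ht. specialize (Hb t Ht). lra.
  - replace (6 / INR n) with (2 * (3 / INR n)) by (field; lra).
    rewrite <- improper_exp_half.
    apply improper_le; [apply (dominated_lin _ _ 1 (-1) Hs Hg) | apply dominated_exp_half |].
    intros t Ht. specialize (Hb t Ht). lra.
Qed.

(** Raising the exponent from n to n + 1 subtracts the integral of an exact derivative, (1 -
    exp(-U))^(n+1) / (n+1). This is 1/(n+1) up to exp(-U), so the steps add up to the harmonic
    number with error at most n exp(-U). *)
Lemma harmonic_integral (U : R) (n : nat) :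
  0 <= U ->
  U - harmonic n <= RInt (fun t => (1 - exp (t - U)) ^ n) 0 U
    <= U - harmonic n + INR n * exp (- U).
Proof.
  intros HU.
  assert (Hx : forall k, ex_RInt (fun t => (1 - exp (t - U)) ^ k) 0 U).
  { intros k. apply ex_derive_ex_RInt. intros t. auto_derive. exact I. }
  induction n as [|n IH].
  - rewrite (RInt_ext _ (fun _ => 1)) by (intros; reflexivity).
    rewrite RInt_const, harmonic_0. change scal with Rmult. simpl. lra.
  - assert (E : RInt (fun t => (1 - exp (t - U)) ^ S n) 0 U =
       RInt (fun t => (1 - exp (t - U)) ^ n) 0 U - (1 - exp (- U)) ^ S n / INR (S n)).
    { assert (H : RInt (fun t => exp (t - U) * (1 - exp (t - U)) ^ n) 0 U =
        (1 - exp (- U)) ^ S n / INR (S n)).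
      { rewrite (RInt_antiderivative _ (fun t => - (1 - exp (t - U)) ^ S n / INR (S n))).
        - rewrite Rminus_diag, exp_0, Rminus_diag, pow_i by lia.
          unfold Rminus. rewrite Rplus_0_l. unfold Rdiv. as_Req. ring.
        - intros t.
          apply is_derive_eq with (- / INR (S n) * (INR (S n) * - exp (t - U) * (1 - exp (t - U)) ^ pred (S n))).
          + apply is_derive_ext with (fun t => - / INR (S n) * (1 - exp (t - U)) ^ S n).
            { intros s. as_Req. unfold Rdiv. ring. }
            apply is_derive_scal.
            apply (is_derive_pow (fun t => 1 - exp (t - U))).
            auto_derive; [exact I|]. change (t + - U) with (t - U). ring.
          + simpl pred. field. apply not_0_INR. lia.
        - intros t. apply (ex_derive_continuous (fun t => exp (t - U) * (1 - exp (t - U)) ^ n)).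
          auto_derive. exact I. }
      rewrite <- H.
      transitivity (RInt (fun t => 1 * (1 - exp (t - U)) ^ n + (-1) * (exp (t - U) * (1 - exp (t - U)) ^ n)) 0 U).
      - apply RInt_ext. intros t _. simpl. as_Req. ring.
      - rewrite RInt_lin; [as_Req; ring | apply Hx |].
        apply ex_derive_ex_RInt. intros t. auto_derive. exact I. }
    rewrite E, harmonic_S.
    assert (Hn : 0 < INR (S n)) by (apply lt_0_INR; lia).
    assert (HeU : exp (- U) <= 1) by (rewrite <- exp_0; apply exp_monotone; lra).
    pose proof (exp_pos (- U)) as HeU'.
    assert (Hp1 : (1 - exp (- U)) ^ S n <= 1).
    { apply Rle_trans with (1 ^ S n); [apply pow_incr; lra | rewrite pow1; lra]. }
    assert (Hp2 : 1 - INR (S n) * exp (- U) <= (1 - exp (- U)) ^ S n).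
    { pose proof (bernoulli (- exp (- U)) (S n) ltac:(lra)). unfold Rminus in *. lra. }
    assert (H1 : (1 - exp (- U)) ^ S n / INR (S n) <= / INR (S n)).
    { unfold Rdiv. rewrite <- (Rmult_1_l (/ INR (S n))) at 2.
      apply Rmult_le_compat_r; [left; apply Rinv_0_lt_compat, Hn | exact Hp1]. }
    assert (H2 : / INR (S n) - exp (- U) <= (1 - exp (- U)) ^ S n / INR (S n)).
    { replace (/ INR (S n) - exp (- U)) with ((1 - INR (S n) * exp (- U)) * / INR (S n))
        by (field; lra).
      apply Rmult_le_compat_r; [left; apply Rinv_0_lt_compat, Hn | exact Hp2]. }
    rewrite S_INR in *. lra.
Qed.

Lemma RInt_gumbel_vs_pow (n : nat) :
  (0 < n)%nat -> let U := 2 * ln (INR n) in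
  0 <= RInt (gumbel_kernel n) 0 U - RInt (fun t => (1 - exp (t - U)) ^ n) 0 U <= 2 / INR n.
Proof.
  intros Hn U. assert (Hn' : 1 <= INR n) by (apply (le_INR 1); lia).
  assert (HU : 0 <= U).
  { unfold U. pose proof (ln_le 1 (INR n) ltac:(lra) Hn'). rewrite ln_1 in H. lra. }
  assert (Hx1 : ex_RInt (gumbel_kernel n) 0 U).
  { apply continuous_ex_RInt, gumbel_kernel_continuous. }
  assert (Hx2 : ex_RInt (fun t => (1 - exp (t - U)) ^ n) 0 U).
  { apply ex_derive_ex_RInt. intros t. auto_derive. exact I. }
  (* With y = exp(t - U), so that dy/dt = y, the error n y^2 exp(-n y) from [exp_neg_vs_pow] has the
     elementary antiderivative - (y + 1/n) exp(-n y). *)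
  set (F := fun t => - ((exp (t - U) + / INR n) * exp (- (INR n * exp (t - U))))).
  set (f := fun t => INR n * exp (t - U) ^ 2 * exp (- (INR n * exp (t - U)))).
  assert (HF : forall t, is_derive F t (f t)).
  { intros t. unfold F, f. auto_derive; [exact I|]. change (t + - U) with (t - U). field. lra. }
  assert (Hf : forall t, continuous f t).
  { intros t. apply (ex_derive_continuous f). unfold f. auto_derive. exact I. }
  assert (Hb : forall t, 0 < t < U -> 0 <= 1 * gumbel_kernel n t + (-1) * (1 - exp (t - U)) ^ n <= f t).
  { intros t Ht. unfold gumbel_kernel, f. fold U.
    assert (Hy : 0 <= exp (t - U) <= 1).
    { split; [left; apply exp_pos|]. rewrite <- exp_0. apply exp_monotone. lra. }
    pose proof (exp_neg_vs_pow _ n Hy). lra. }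
  replace (RInt (gumbel_kernel n) 0 U - RInt (fun t => (1 - exp (t - U)) ^ n) 0 U) with
    (RInt (fun t => 1 * gumbel_kernel n t + (-1) * (1 - exp (t - U)) ^ n) 0 U)
    by (rewrite RInt_lin by assumption; as_Req; ring).
  split.
  - apply RInt_ge_0; [exact HU | apply ex_RInt_lin; assumption |].
    intros t Ht. apply Hb, Ht.
  - apply Rle_trans with (RInt f 0 U).
    + apply RInt_le; [exact HU | apply ex_RInt_lin; assumption | apply continuous_ex_RInt, Hf |].
      intros t Ht. apply Hb, Ht.
    + rewrite (RInt_antiderivative f F) by assumption. unfold F.
      rewrite Rminus_diag, exp_0.
      assert (E : exp (0 - U) = / INR n ^ 2).
      { unfold U. rewrite exp_shift_2ln, exp_0 by exact Hn. unfold Rdiv. ring. }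
      rewrite E.
      pose proof (exp_pos (- (INR n * 1))).
      assert (Hi : 0 < / INR n) by (apply Rinv_0_lt_compat; lra).
      assert (Hi1 : / INR n <= 1) by (rewrite <- Rinv_1; apply Rinv_le_contravar; lra).
      assert (Hi2 : / INR n ^ 2 = / INR n * / INR n) by (rewrite <- pow_inv; simpl; ring).
      rewrite Hi2.
      assert (He : exp (- (INR n * (/ INR n * / INR n))) <= 1).
      { rewrite <- exp_0. apply exp_monotone. assert (0 < INR n * (/ INR n * / INR n)); [|lra].
        apply Rmult_lt_0_compat; [lra | nra]. }
      pose proof (exp_pos (- (INR n * (/ INR n * / INR n)))).
      unfold Rdiv.
      assert (0 <= (1 + / INR n) * exp (- (INR n * 1))) by nra.
      assert ((/ INR n * / INR n + / INR n) * exp (- (INR n * (/ INR n * / INR n)))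
         <= (/ INR n + / INR n) * 1) by (apply Rmult_le_compat; nra).
      lra.
Qed.

Lemma schlaefli_tail_0_harmonic (n : nat) :
  (0 < n)%nat ->
  Rabs (schlaefli_tail 0 (2 / INR n) - (2 * ln (INR n) - harmonic n)) <= 10 / INR n.
Proof.
  intros Hn. assert (Hn' : 1 <= INR n) by (apply (le_INR 1); lia).
  set (U := 2 * ln (INR n)).
  assert (HU : 0 <= U).
  { unfold U. pose proof (ln_le 1 (INR n) ltac:(lra) Hn'). rewrite ln_1 in H. lra. }
  pose proof (schlaefli_tail_0_gumbel n Hn) as H1.
  pose proof (RInt_gumbel_vs_pow n Hn) as H2. fold U in H2. cbv zeta in H2.
  pose proof (harmonic_integral U n HU) as H3.
  assert (EU : exp (- U) = / INR n ^ 2).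
  { replace (- U) with (0 - 2 * ln (INR n)) by (unfold U; ring).
    rewrite exp_shift_2ln, exp_0 by exact Hn. unfold Rdiv. ring. }
  assert (E3 : INR n * exp (- U) = / INR n) by (rewrite EU; field; lra).
  rewrite E3 in H3.
  (* Past U the exponent satisfies n exp(t - U) >= n + (t - U), and exp(-n) <= 1/n. *)
  assert (H4 : 0 <= improper (gumbel_kernel n) - RInt (gumbel_kernel n) 0 U <= / INR n).
  { apply improper_tail; [apply gumbel_kernel_dominated, Hn | exact HU |].
    intros t Ht. split; [left; apply gumbel_kernel_pos|].
    unfold gumbel_kernel. fold U.
    apply Rle_trans with (exp (- INR n) * exp (- (t - U))).
    - rewrite <- exp_plus. apply exp_monotone.
      pose proof (exp_ge_1_plus (t - U)). nra.
    - apply Rmult_le_compat_r; [left; apply exp_pos|].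
      rewrite exp_Ropp. apply Rinv_le_contravar; [lra|].
      pose proof (exp_ge_1_plus (INR n)). lra. }
  (* The four errors add up to 10/n: 6/n for replacing the kernel, 1/n for the tail past U, 2/n for
     the power and 1/n for the harmonic sum. *)
  unfold Rdiv in *. apply Rabs_le. lra.
Qed.

(** [euler_gamma] is the real part of a total limit operator, so convergence has to be established:
    the sequence decreases and is bounded below, both by ln x <= x - 1. *)
Lemma harmonic_minus_ln_converges :
  is_lim_seq (fun n => harmonic n - ln (INR n)) euler_gamma.
Proof.
  assert (He : ex_finite_lim_seq (fun n => harmonic n - ln (INR n))).
  (* Index 0 is left out because ln 0 is only a default value. *)
  { enough (ex_finite_lim_seq (fun n => harmonic (S n) - ln (INR (S n)))) as [l Hl].
    { exists l. apply is_lim_seq_incr_1, Hl. }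
    apply ex_finite_lim_seq_decr with 0.
    - intros n. rewrite (harmonic_S (S n)).
      assert (Hn : 0 < INR (S n)) by (apply lt_0_INR; lia).
      rewrite (S_INR (S n)). set (x := INR (S n)) in *.
      assert (H : ln (x / (x + 1)) <= - / (x + 1)).
      { pose proof (exp_ge_1_plus (ln (x / (x + 1)))) as H.
        rewrite exp_ln in H by (apply Rdiv_lt_0_compat; lra).
        replace (- / (x + 1)) with (x / (x + 1) - 1) by (field; lra). lra. }
      rewrite ln_div in H by lra. lra.
    - intros n.
      assert (H : forall k, ln (INR (S k)) <= harmonic k).
      { induction k as [|k IH]; [change (INR 1) with 1; rewrite harmonic_0, ln_1; lra|].
        rewrite harmonic_S.
        assert (Hk : 0 < INR (S k)) by (apply lt_0_INR; lia).
        rewrite (S_INR (S k)). set (x := INR (S k)) in *.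
        assert (H : ln ((x + 1) / x) <= / x).
        { pose proof (exp_ge_1_plus (ln ((x + 1) / x))) as H.
          rewrite exp_ln in H by (apply Rdiv_lt_0_compat; lra).
          replace (/ x) with ((x + 1) / x - 1) by (field; lra). lra. }
        rewrite ln_div in H by lra. lra. }
      specialize (H n). rewrite harmonic_S.
      assert (0 < / INR (S n)) by (apply Rinv_0_lt_compat, lt_0_INR; lia). lra. }
  apply Lim_seq_correct' in He. exact He.
Qed.

(** Limits at z = 0 are tested along z = 2/(N+1): then z/2 is [inv_succ N], and z has the form 2/n
    of the harmonic estimate. *)
Definition inv_succ (N : nat) : R := / INR (S N).

Lemma inv_succ_pos (N : nat) : 0 < inv_succ N.
Proof. apply Rinv_0_lt_compat, lt_0_INR. lia. Qed.

Lemma inv_succ_le_1 (N : nat) : inv_succ N <= 1.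
Proof.
  unfold inv_succ. rewrite <- Rinv_1. apply Rinv_le_contravar; [lra|].
  apply (le_INR 1). lia.
Qed.

Lemma inv_succ_lim : is_lim_seq inv_succ 0.
Proof.
  unfold inv_succ. apply (is_lim_seq_incr_1 (fun n => / INR n)).
  apply (is_lim_seq_inv INR p_infty); [apply is_lim_seq_INR | discriminate].
Qed.

Lemma is_lim_seq_squeeze (u v : nat -> R) (l : R) :
  (forall N, Rabs (u N - l) <= v N) -> is_lim_seq v 0 -> is_lim_seq u l.
Proof.
  intros H Hv.
  apply is_lim_seq_le_le with (u := fun N => l - v N) (w := fun N => l + v N).
  - intros N. specialize (H N). apply Rabs_le_between in H. lra.
  - replace (Finite l) with (Finite (l - 0)) by (f_equal; ring).
    apply is_lim_seq_minus'; [apply is_lim_seq_const | exact Hv].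
  - replace (Finite l) with (Finite (l + 0)) by (f_equal; ring).
    apply is_lim_seq_plus'; [apply is_lim_seq_const | exact Hv].
Qed.

Lemma inv_succ_ln_lim : is_lim_seq (fun N => inv_succ N * ln (inv_succ N)) 0.
Proof.
  apply is_lim_seq_ext with (fun N => -1 * (ln (INR (S N)) / INR (S N))).
  { intros N. unfold inv_succ. rewrite ln_Rinv by (apply lt_0_INR; lia). unfold Rdiv. ring. }
  replace (Finite 0) with (Rbar_mult (-1) 0) by (simpl; f_equal; ring).
  apply is_lim_seq_scal_l.
  apply (is_lim_seq_incr_1 (fun n => ln (INR n) / INR n)).
  apply (filterlim_comp _ _ _ INR (fun x => ln x / x) eventually (Rbar_locally p_infty)).
  - apply is_lim_seq_INR.
  - apply is_lim_div_ln_p.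
Qed.

Lemma continuous_inv_succ_sqr (f : R -> R) :
  (forall s, continuous f s) -> is_lim_seq (fun N => f (inv_succ N ^ 2)) (f 0).
Proof.
  intros Hf. apply (filterlim_comp _ _ _ (fun N => inv_succ N ^ 2) f eventually (locally 0)).
  - replace (Finite 0) with (Finite (0 * 0)) by (f_equal; ring).
    assert (H : is_lim_seq (fun N => inv_succ N * inv_succ N) (0 * 0))
      by (apply is_lim_seq_mult'; apply inv_succ_lim).
    rewrite Rmult_0_r in H.
    apply is_lim_seq_ext with (2 := H). intros N. simpl. ring.
  - apply Hf.
Qed.

Lemma phi_continuous (n : nat) (s : R) : continuous (phi n) s.
Proof. apply (ex_derive_continuous (phi n)). eexists. apply phi_is_derive. Qed.

Lemma psi_continuous (n : nat) (s : R) : continuous (psi_series n) s.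
Proof. apply (ex_derive_continuous (psi_series n)). eexists. apply psi_is_derive. Qed.

(** The logarithmic singularity of the half-line integral, - ln(z/2) - gamma: one of the two ln n in
    the harmonic estimate is the singularity, the other completes H_n - ln n. *)
Lemma schlaefli_tail_0_inv_succ :
  is_lim_seq (fun N => schlaefli_tail 0 (2 * inv_succ N) + ln (inv_succ N)) (- euler_gamma).
Proof.
  apply is_lim_seq_ext with
    (fun N => (schlaefli_tail 0 (2 / INR (S N)) - (2 * ln (INR (S N)) - harmonic (S N)))
       + -1 * (harmonic (S N) - ln (INR (S N)))).
  { intros N. unfold inv_succ. rewrite ln_Rinv by (apply lt_0_INR; lia). unfold Rdiv. ring. }
  replace (Finite (- euler_gamma)) with (Finite (0 + -1 * euler_gamma)) by (f_equal; ring).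
  apply is_lim_seq_plus'.
  - apply is_lim_seq_squeeze with (fun N => 10 * inv_succ N).
    + intros N. rewrite Rminus_0_r. apply schlaefli_tail_0_harmonic. lia.
    + replace (Finite 0) with (Rbar_mult 10 0) by (simpl; f_equal; ring).
      apply is_lim_seq_scal_l, inv_succ_lim.
  - apply (is_lim_seq_scal_l _ (-1) euler_gamma).
    apply (is_lim_seq_incr_1 (fun n => harmonic n - ln (INR n))).
    apply harmonic_minus_ln_converges.
Qed.

(** * Schlaefli's formulas *)

Lemma exp_neg_dominated : dominated (fun t => exp (- t)).
Proof.
  split.
  - intros t. apply (ex_derive_continuous (fun t => exp (- t))). auto_derive. exact I.
  - exists 1. intros t Ht. rewrite Rabs_pos_eq, Rmult_1_l by (left; apply exp_pos).
    apply exp_monotone. lra.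
Qed.

Lemma improper_exp_neg : improper (fun t => exp (- t)) = 1.
Proof.
  rewrite (improper_antiderivative _ (fun t => - exp (- t))).
  - rewrite Ropp_0, exp_0. ring.
  - intros t. auto_derive; [exact I | ring].
  - apply exp_neg_dominated.
  - replace (Finite 0) with (Rbar_mult (-1) 0) by (simpl; f_equal; ring).
    apply is_lim_seq_ext with (fun n => -1 * exp (- (1 * INR n))).
    { intros n. rewrite Rmult_1_l. ring. }
    apply is_lim_seq_scal_l, is_lim_seq_exp_neg. lra.
Qed.

(** The linear bound 1 - exp(-x) <= x is useless at x = z sinh t: multiplied by exp(-t) it does not
    decay. The square root leaves exp(-t/2), which is integrable. *)
Lemma one_minus_exp_le_sqrt (x : R) : 0 <= x -> 1 - exp (- x) <= sqrt x.
Proof.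
  intros Hx. pose proof (sqrt_pos x) as Hs. pose proof (exp_pos (- x)).
  pose proof (exp_ge_1_plus (- x)). pose proof (sqrt_sqrt x Hx).
  destruct (Rle_dec 1 (sqrt x)); nra.
Qed.

Lemma schlaefli_tail_m1_inv_succ : is_lim_seq (fun N => schlaefli_tail (-1) (2 * inv_succ N)) 1.
Proof.
  apply is_lim_seq_squeeze with (fun N => 2 * sqrt (inv_succ N)).
  - intros N. pose proof (inv_succ_pos N) as Hc. set (c := inv_succ N) in *.
    assert (Hz : 0 < 2 * c) by lra.
    pose proof (schlaefli_kernel_dominated (-1) _ Hz) as Hk.
    rewrite <- improper_exp_neg, <- (improper_exp_half (sqrt c)).
    unfold schlaefli_tail.
    replace (_ - _) with (improper (fun t => 1 * schlaefli_kernel (-1) (2 * c) t + (-1) * exp (- t)))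
      by (rewrite (improper_lin _ _ 1 (-1) Hk exp_neg_dominated); ring).
    apply improper_abs_le; [apply (dominated_lin _ _ 1 (-1) Hk exp_neg_dominated)
      | apply dominated_exp_half |].
    intros t Ht.
    replace (schlaefli_kernel (-1) (2 * c) t) with (exp (- t) * exp (- (2 * c * sinh t))).
    2:{ unfold schlaefli_kernel. rewrite <- exp_plus. f_equal. ring. }
    pose proof (sinh_nonneg t Ht) as Hs. pose proof (exp_pos (- t)) as Hp.
    assert (He1 : exp (- (2 * c * sinh t)) <= 1) by (rewrite <- exp_0; apply exp_monotone; nra).
    rewrite Rabs_left1 by nra.
    assert (Hsq : 1 - exp (- (2 * c * sinh t)) <= sqrt c * exp (t / 2)).
    { apply Rle_trans with (sqrt (2 * c * sinh t)); [apply one_minus_exp_le_sqrt; nra|].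
      rewrite <- (sqrt_Rsqr (exp (t / 2))) by (left; apply exp_pos).
      rewrite <- sqrt_mult by (try lra; apply Rle_0_sqr).
      apply sqrt_le_1_alt. unfold Rsqr. rewrite <- exp_plus.
      replace (t / 2 + t / 2) with t by lra. unfold sinh. pose proof (exp_pos (- t)). nra. }
    replace (exp (- t / 2)) with (exp (- t) * exp (t / 2)) by (rewrite <- exp_plus; f_equal; lra).
    nra.
  - replace (Finite 0) with (Rbar_mult 2 0) by (simpl; f_equal; ring).
    apply is_lim_seq_scal_l. rewrite <- sqrt_0.
    apply (is_lim_seq_continuous sqrt inv_succ 0); [|apply inv_succ_lim].
    apply continuity_pt_filterlim, continuous_sqrt.
Qed.

(* For a solution [(D0, D1)] of the Bessel system of orders 0 and 1, the energy
   [D0 ^ 2 + D1 ^ 2] is nonincreasing, so a solution vanishing at 0 is zero. *)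
Lemma bessel_system_unique (D0 D1 : R -> R) :
  (forall z, 0 < z -> is_derive D0 z (- D1 z)) ->
  (forall z, 0 < z -> is_derive D1 z (D0 z - D1 z / z)) ->
  is_lim_seq (fun N => D0 (2 * inv_succ N)) 0 ->
  is_lim_seq (fun N => D1 (2 * inv_succ N)) 0 ->
  forall z, 0 < z -> D0 z = 0 /\ D1 z = 0.
Proof.
  intros H0 H1 L0 L1 z Hz.
  set (E := fun z => D0 z ^ 2 + D1 z ^ 2).
  assert (Hmono : forall a b, 0 < a <= b -> E b <= E a).
  { intros a b Hab.
    apply (is_derive_nonincreasing E (fun z => - 2 * (D1 z ^ 2 / z))); [lra | |].
    - intros x Hx.
      apply is_derive_eq with (2 * D0 x * (- D1 x) + 2 * D1 x * (D0 x - D1 x / x)).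
      + unfold E. auto_derive.
        * repeat split; eexists; [apply H0 | apply H1]; lra.
        * change (Derive (fun x : R => D0 x)) with (Derive D0).
          change (Derive (fun x : R => D1 x)) with (Derive D1).
          rewrite (is_derive_unique _ _ _ (H0 x ltac:(lra))), (is_derive_unique _ _ _ (H1 x ltac:(lra))).
          ring.
      + field. lra.
    - intros x Hx. assert (0 <= D1 x ^ 2 / x); [|lra].
      apply Rdiv_le_0_compat; [apply pow2_ge_0 | lra]. }
  assert (HE : is_lim_seq (fun N => E (2 * inv_succ N)) 0).
  { replace (Finite 0) with (Finite (0 * 0 + 0 * 0)) by (f_equal; ring).
    unfold E. apply is_lim_seq_ext with
      (fun N => D0 (2 * inv_succ N) * D0 (2 * inv_succ N) + D1 (2 * inv_succ N) * D1 (2 * inv_succ N)).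
    { intros N. ring. }
    apply is_lim_seq_plus'; apply is_lim_seq_mult'; assumption. }
  assert (HEz : E z <= 0).
  { assert (Hev : eventually (fun N => E z <= E (2 * inv_succ N))).
    { assert (Hl : is_lim_seq (fun N => 2 * inv_succ N) 0).
      { replace (Finite 0) with (Rbar_mult 2 0) by (simpl; f_equal; ring).
        apply is_lim_seq_scal_l, inv_succ_lim. }
      apply is_lim_seq_spec in Hl. destruct (Hl (mkposreal z Hz)) as [N0 HN0].
      exists N0. intros N HN. apply Hmono.
      specialize (HN0 N HN). simpl in HN0. apply Rabs_lt_between in HN0.
      pose proof (inv_succ_pos N). lra. }
    apply (is_lim_seq_le_loc (fun _ => E z) (fun N => E (2 * inv_succ N)) (E z) 0 Hev);
      [apply is_lim_seq_const | exact HE]. }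
  unfold E in HEz. split; nra.
Qed.

Lemma cos_schlaefli_m1 (d z : R) : 0 < z -> schlaefli_cos (-1) d z = - schlaefli_cos 1 d z.
Proof.
  intros Hz. pose proof (schlaefli_cos_rec 0 d z) as H.
  replace (0 * PI + d) with d in H by ring. replace (0 - 1) with (-1) in H by ring.
  replace (0 + 1) with 1 in H by ring.
  assert (H' : z * (schlaefli_cos (-1) d z + schlaefli_cos 1 d z) = 0) by lra.
  apply Rmult_integral in H'. lra.
Qed.

Lemma schlaefli_cos_0_is_derive (d z : R) :
  0 < z -> is_derive (schlaefli_cos 0 d) z (- schlaefli_cos 1 d z).
Proof.
  intros Hz. apply is_derive_eq with (1 := schlaefli_cos_is_derive 0 d z).
  replace (0 - 1) with (-1) by ring. rewrite Rplus_0_l, cos_schlaefli_m1 by exact Hz. field.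
Qed.

Lemma schlaefli_cos_1_is_derive (d z : R) :
  0 < z ->
  is_derive (schlaefli_cos 1 d) z
    (schlaefli_cos 0 d z - schlaefli_cos 1 d z / z - 2 * sin d / z).
Proof.
  intros Hz. apply is_derive_eq with (1 := schlaefli_cos_is_derive 1 d z).
  pose proof (schlaefli_cos_rec 1 d z) as H.
  replace (1 - 1) with 0 in * by ring. rewrite Rmult_1_l, (Rplus_comm PI), neg_sin in H.
  replace (schlaefli_cos (1 + 1) d z) with
    ((2 * 1 * schlaefli_cos 1 d z - 2 * (- sin d - sin d)) / z - schlaefli_cos 0 d z).
  - field. lra.
  - rewrite <- H. field. lra.
Qed.

Lemma schlaefli_cos_inv_succ (a d : R) :
  is_lim_seq (fun N => schlaefli_cos a d (2 * inv_succ N)) (schlaefli_cos a d 0).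
Proof.
  apply is_lim_seq_squeeze with (fun N => (2 * PI) * inv_succ N).
  - intros N. eapply Rle_trans; [apply schlaefli_cos_near_0|].
    pose proof (inv_succ_pos N). rewrite Rabs_pos_eq by lra. lra.
  - replace (Finite 0) with (Rbar_mult (2 * PI) 0) by (simpl; f_equal; ring).
    apply is_lim_seq_scal_l, inv_succ_lim.
Qed.

Lemma besselJ_0_inv_succ : is_lim_seq (fun N => besselJ_nat 0 (2 * inv_succ N)) 1.
Proof.
  apply is_lim_seq_ext with (fun N => phi 0 (inv_succ N ^ 2)).
  { intros N. rewrite besselJ_phi. replace (2 * inv_succ N / 2) with (inv_succ N) by field. simpl. ring. }
  replace 1 with (phi 0 0) by (rewrite phi_0; simpl; field).
  apply continuous_inv_succ_sqr, phi_continuous.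
Qed.

Lemma besselJ_1_inv_succ : is_lim_seq (fun N => besselJ_nat 1 (2 * inv_succ N)) 0.
Proof.
  apply is_lim_seq_ext with (fun N => inv_succ N * phi 1 (inv_succ N ^ 2)).
  { intros N. rewrite besselJ_phi. replace (2 * inv_succ N / 2) with (inv_succ N) by field. simpl. ring. }
  replace (Finite 0) with (Finite (0 * phi 1 0)) by (f_equal; ring).
  apply is_lim_seq_mult'; [apply inv_succ_lim | apply continuous_inv_succ_sqr, phi_continuous].
Qed.

Lemma besselJ_is_derive_01 (z : R) :
  0 < z ->
  is_derive (besselJ_nat 0) z (- besselJ_nat 1 z) /\
  is_derive (besselJ_nat 1) z (besselJ_nat 0 z - besselJ_nat 1 z / z).
Proof.
  intros Hz. split.
  - apply is_derive_eq with (1 := besselJ_is_derive_up 0 z Hz). simpl. field. lra.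
  - apply is_derive_eq with (1 := besselJ_is_derive_down 0 z Hz). simpl. field. lra.
Qed.

Lemma besselY_is_derive_01 (z : R) :
  0 < z ->
  is_derive (besselY_nat 0) z (- besselY_nat 1 z) /\
  is_derive (besselY_nat 1) z (besselY_nat 0 z - besselY_nat 1 z / z).
Proof.
  intros Hz. split.
  - apply is_derive_eq with (1 := besselY_is_derive_up 0 z Hz). simpl. field. lra.
  - apply is_derive_eq with (1 := besselY_is_derive_down 0 z Hz). simpl. field. lra.
Qed.

Lemma is_derive_lin (f g : R -> R) (a b z f' g' : R) :
  is_derive f z f' -> is_derive g z g' ->
  is_derive (fun z => a * f z + b * g z) z (a * f' + b * g').
Proof.
  intros Hf Hg. apply (is_derive_plus (fun z => a * f z) (fun z => b * g z));
    apply is_derive_scal; assumption.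
Qed.

Lemma schlaefli_J_01 (z : R) :
  0 < z ->
  PI * besselJ_nat 0 z = schlaefli_cos 0 0 z /\ PI * besselJ_nat 1 z = schlaefli_cos 1 0 z.
Proof.
  intros Hz.
  destruct (bessel_system_unique
    (fun z => PI * besselJ_nat 0 z + (-1) * schlaefli_cos 0 0 z)
    (fun z => PI * besselJ_nat 1 z + (-1) * schlaefli_cos 1 0 z)) with (z := z) as [E0 E1];
    [| | | | exact Hz | split; lra].
  - intros w Hw. destruct (besselJ_is_derive_01 w Hw) as [H _].
    apply is_derive_eq with (1 := is_derive_lin _ _ PI (-1) _ _ _ H (schlaefli_cos_0_is_derive 0 w Hw)).
    ring.
  - intros w Hw. destruct (besselJ_is_derive_01 w Hw) as [_ H].
    apply is_derive_eq with (1 := is_derive_lin _ _ PI (-1) _ _ _ H (schlaefli_cos_1_is_derive 0 w Hw)).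
    rewrite sin_0. field. lra.
  - replace (Finite 0) with (Finite (PI * 1 + -1 * schlaefli_cos 0 0 0))
      by (rewrite schlaefli_cos_0_0, cos_0; f_equal; ring).
    apply is_lim_seq_plus'.
    + apply (is_lim_seq_scal_l _ PI 1), besselJ_0_inv_succ.
    + apply (is_lim_seq_scal_l _ (-1) (schlaefli_cos 0 0 0)), schlaefli_cos_inv_succ.
  - replace (Finite 0) with (Finite (PI * 0 + -1 * schlaefli_cos 1 0 0))
      by (rewrite schlaefli_cos_1_0, sin_0; f_equal; ring).
    apply is_lim_seq_plus'.
    + apply (is_lim_seq_scal_l _ PI 0), besselJ_1_inv_succ.
    + apply (is_lim_seq_scal_l _ (-1) (schlaefli_cos 1 0 0)), schlaefli_cos_inv_succ.
Qed.

(** Here and for order 1, the function is - pi Y as given by Schlaefli's formula. *)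
Definition schlaefli_Y0 (z : R) : R := schlaefli_cos 0 (- (PI / 2)) z + 2 * schlaefli_tail 0 z.
Definition schlaefli_Y1 (z : R) : R :=
  schlaefli_cos 1 (- (PI / 2)) z + (schlaefli_tail 1 z - schlaefli_tail (-1) z).

Lemma sin_m_PI2 : sin (- (PI / 2)) = -1.
Proof. rewrite sin_neg, sin_PI2. reflexivity. Qed.

Lemma schlaefli_Y0_is_derive (z : R) : 0 < z -> is_derive schlaefli_Y0 z (- schlaefli_Y1 z).
Proof.
  intros Hz. unfold schlaefli_Y0, schlaefli_Y1.
  pose proof (is_derive_lin _ _ 1 2 _ _ _ (schlaefli_cos_0_is_derive (- (PI / 2)) z Hz)
    (schlaefli_tail_is_derive 0 z Hz)) as H.
  eapply is_derive_ext; [|apply is_derive_eq with (1 := H)].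
  - intros t. cbv beta. as_Req. ring.
  - rewrite Rplus_0_l. replace (0 - 1) with (-1) by ring. field.
Qed.

Lemma schlaefli_Y1_is_derive (z : R) :
  0 < z -> is_derive schlaefli_Y1 z (schlaefli_Y0 z - schlaefli_Y1 z / z).
Proof.
  intros Hz. unfold schlaefli_Y0, schlaefli_Y1.
  pose proof (is_derive_lin _ _ 1 (-1) _ _ _ (schlaefli_tail_is_derive 1 z Hz)
    (schlaefli_tail_is_derive (-1) z Hz)) as H0.
  pose proof (is_derive_lin _ _ 1 1 _ _ _ (schlaefli_cos_1_is_derive (- (PI / 2)) z Hz) H0) as H.
  eapply is_derive_ext; [|apply is_derive_eq with (1 := H)].
  - intros t. cbv beta. as_Req. ring.
  - pose proof (schlaefli_tail_rec 1 z Hz) as R1.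
    pose proof (schlaefli_tail_rec (-1) z Hz) as R2.
    rewrite sin_m_PI2.
    replace (1 - 1) with 0 in * by ring. replace (-1 + 1) with 0 in * by ring.
    replace (schlaefli_tail (1 + 1) z) with (2 / z * (1 * schlaefli_tail 1 z + 1) - schlaefli_tail 0 z) by lra.
    replace (schlaefli_tail (-1 - 1) z) with (2 / z * (-1 * schlaefli_tail (-1) z + 1) - schlaefli_tail 0 z) by lra.
    field. lra.
Qed.

Lemma schlaefli_Y_01 (z : R) :
  0 < z ->
  PI * besselY_nat 0 z = - schlaefli_Y0 z /\ PI * besselY_nat 1 z = - schlaefli_Y1 z.
Proof.
  intros Hz. pose proof PI_RGT_0.
  destruct (bessel_system_unique
    (fun z => PI * besselY_nat 0 z + 1 * schlaefli_Y0 z)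
    (fun z => PI * besselY_nat 1 z + 1 * schlaefli_Y1 z)) with (z := z) as [E0 E1];
    [| | | | exact Hz | split; lra].
  - intros w Hw. destruct (besselY_is_derive_01 w Hw) as [H1 _].
    apply is_derive_eq with (1 := is_derive_lin _ _ PI 1 _ _ _ H1 (schlaefli_Y0_is_derive w Hw)).
    ring.
  - intros w Hw. destruct (besselY_is_derive_01 w Hw) as [_ H1].
    apply is_derive_eq with (1 := is_derive_lin _ _ PI 1 _ _ _ H1 (schlaefli_Y1_is_derive w Hw)).
    field. lra.
  (* The logarithm of Y_0 is split as (phi_0 - 1) ln, which tends to 0, plus a pure ln that joins
     the half-line integral and leaves - gamma. Twice this cancels - psi_series_0(0) = 2 gamma. *)
  - apply is_lim_seq_ext with (fun N => 2 * ((phi 0 (inv_succ N ^ 2) - 1) * ln (inv_succ N))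
      + (-1 * psi_series 0 (inv_succ N ^ 2) + (2 * (schlaefli_tail 0 (2 * inv_succ N) + ln (inv_succ N))
      + schlaefli_cos 0 (- (PI / 2)) (2 * inv_succ N)))).
    { intros N. unfold schlaefli_Y0. rewrite besselY_psi, besselJ_phi.
      replace (2 * inv_succ N / 2) with (inv_succ N) by field.
      unfold finite_part. rewrite !pow_O. field. lra. }
    replace (Finite 0) with (Finite (2 * 0 + (-1 * psi_series 0 0 + (2 * (- euler_gamma)
      + schlaefli_cos 0 (- (PI / 2)) 0)))).
    2:{ rewrite schlaefli_cos_0_0, cos_neg, cos_PI2.
        rewrite psi_series_0_0. f_equal. ring. }
    apply is_lim_seq_plus'; [|apply is_lim_seq_plus'; [|apply is_lim_seq_plus']].
    + apply (is_lim_seq_scal_l _ 2 0).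
      apply is_lim_seq_squeeze with (fun N => -1 * (inv_succ N * ln (inv_succ N))).
      * intros N. pose proof (inv_succ_pos N) as Hn. pose proof (inv_succ_le_1 N) as Hn1.
        rewrite Rminus_0_r, Rabs_mult.
        assert (Hl : ln (inv_succ N) <= 0) by (rewrite <- ln_1; apply ln_le; lra).
        rewrite (Rabs_left1 (ln _)) by exact Hl.
        assert (Hp : Rabs (phi 0 (inv_succ N ^ 2) - 1) <= inv_succ N ^ 2).
        { replace 1 with (phi 0 0) by (rewrite phi_0; simpl; field).
          destruct (MVT_gen (phi 0) 0 (inv_succ N ^ 2) (fun s => - phi 1 s)) as [c [Hc ->]].
          - intros. apply phi_is_derive.
          - intros. apply continuity_pt_filterlim, phi_continuous.
          - rewrite Rmin_left in Hc by (apply pow2_ge_0).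
            rewrite Rabs_mult, Rabs_Ropp, Rminus_0_r, (Rabs_pos_eq (_ ^ 2)) by apply pow2_ge_0.
            pose proof (phi_bound 1 c (proj1 Hc)) as Hb. simpl in Hb. rewrite Rinv_1 in Hb.
            pose proof (pow2_ge_0 (inv_succ N)). nra. }
        pose proof (Rabs_pos (phi 0 (inv_succ N ^ 2) - 1)).
        assert (inv_succ N ^ 2 <= inv_succ N) by nra. nra.
      * replace (Finite 0) with (Rbar_mult (-1) 0) by (simpl; f_equal; ring).
        apply is_lim_seq_scal_l, inv_succ_ln_lim.
    + apply (is_lim_seq_scal_l _ (-1) (psi_series 0 0)).
      apply continuous_inv_succ_sqr, psi_continuous.
    + apply (is_lim_seq_scal_l _ 2 (- euler_gamma)), schlaefli_tail_0_inv_succ.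
    + apply schlaefli_cos_inv_succ.
  (* The pole of Y_1 cancels against that of [schlaefli_tail 1], made explicit by the recurrence at
     a = 0; the remaining constants are 2 and - 2. *)
  - apply is_lim_seq_ext with (fun N => 2 * (phi 1 (inv_succ N ^ 2) * (inv_succ N * ln (inv_succ N)))
      + (-1 * (inv_succ N * psi_series 1 (inv_succ N ^ 2)) + (schlaefli_cos 1 (- (PI / 2)) (2 * inv_succ N)
        + -2 * schlaefli_tail (-1) (2 * inv_succ N)))).
    { intros N. pose proof (inv_succ_pos N) as Hn.
      pose proof (schlaefli_tail_rec 0 (2 * inv_succ N) ltac:(lra)) as Hr.
      replace (0 - 1) with (-1) in Hr by ring. rewrite Rplus_0_l, Rmult_0_l, Rplus_0_l in Hr.
      unfold schlaefli_Y1. rewrite besselY_psi, besselJ_phi.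
      replace (2 * inv_succ N / 2) with (inv_succ N) by field.
      replace (schlaefli_tail 1 (2 * inv_succ N)) with (2 / (2 * inv_succ N) * 1 - schlaefli_tail (-1) (2 * inv_succ N)) by lra.
      unfold finite_part. rewrite sum_O. simpl (fact _). simpl (INR 1). rewrite !pow_O, pow_1. field. lra. }
    replace (Finite 0) with (Finite (2 * (phi 1 0 * 0) + (-1 * (0 * psi_series 1 0)
      + (schlaefli_cos 1 (- (PI / 2)) 0 + -2 * 1)))).
    2:{ rewrite schlaefli_cos_1_0, sin_m_PI2. f_equal; ring. }
    apply is_lim_seq_plus'; [|apply is_lim_seq_plus'; [|apply is_lim_seq_plus']].
    + apply (is_lim_seq_scal_l _ 2 (phi 1 0 * 0)).
      apply is_lim_seq_mult'; [apply continuous_inv_succ_sqr, phi_continuous | apply inv_succ_ln_lim].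
    + apply (is_lim_seq_scal_l _ (-1) (0 * psi_series 1 0)).
      apply is_lim_seq_mult'; [apply inv_succ_lim | apply continuous_inv_succ_sqr, psi_continuous].
    + apply schlaefli_cos_inv_succ.
    + apply (is_lim_seq_scal_l _ (-2) 1), schlaefli_tail_m1_inv_succ.
Qed.

Lemma sin_INR_PI_plus (n : nat) (d : R) : sin (INR n * PI + d) = (-1) ^ n * sin d.
Proof.
  induction n as [|n IH]; [simpl; rewrite Rmult_0_l, Rplus_0_l; ring|].
  rewrite S_INR. replace ((INR n + 1) * PI + d) with ((INR n * PI + d) + PI) by ring.
  rewrite neg_sin, IH. simpl. ring.
Qed.

Lemma two_step_ind (P : nat -> Prop) :
  P 0%nat -> P 1%nat -> (forall n, P n -> P (S n) -> P (S (S n))) -> forall n, P n.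
Proof.
  intros H0 H1 HS n. enough (P n /\ P (S n)) by tauto.
  induction n as [|n [IH1 IH2]]; split; auto.
Qed.

Lemma schlaefli_J (n : nat) (z : R) :
  0 < z -> PI * besselJ_nat n z = schlaefli_cos (INR n) 0 z.
Proof.
  intros Hz. revert n. apply two_step_ind.
  - apply schlaefli_J_01, Hz.
  - apply schlaefli_J_01, Hz.
  - intros n H0 H1.
    pose proof (besselJ_rec n z Hz) as HJ.
    pose proof (schlaefli_cos_rec (INR (S n)) 0 z) as HC.
    rewrite sin_INR_PI_plus, sin_0, Rmult_0_r in HC.
    replace (INR (S n) - 1) with (INR n) in HC by (rewrite S_INR; ring).
    rewrite <- (S_INR (S n)) in HC.
    apply Rmult_eq_reg_l with z; [|lra].
    transitivity (z * (PI * (2 * INR (S n) / z * besselJ_nat (S n) z - besselJ_nat n z)));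
      [f_equal; f_equal; lra|].
    transitivity (2 * INR (S n) * (PI * besselJ_nat (S n) z) - z * (PI * besselJ_nat n z)); [field; lra|].
    rewrite H0, H1. lra.
Qed.

Definition schlaefli_improper (n : nat) (z : R) : R :=
  schlaefli_tail (INR n) z + (-1) ^ n * schlaefli_tail (- INR n) z.

Lemma schlaefli_improper_rec (n : nat) (z : R) :
  0 < z ->
  z * (schlaefli_improper n z + schlaefli_improper (S (S n)) z)
  = 2 * INR (S n) * schlaefli_improper (S n) z + 2 * (1 - (-1) ^ S n).
Proof.
  intros Hz.
  pose proof (schlaefli_tail_rec (INR (S n)) z Hz) as H1.
  pose proof (schlaefli_tail_rec (- INR (S n)) z Hz) as H2.
  replace (INR (S n) - 1) with (INR n) in H1 by (rewrite S_INR; ring).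
  replace (- INR (S n) + 1) with (- INR n) in H2 by (rewrite S_INR; ring).
  replace (INR (S n) + 1) with (INR (S (S n))) in H1 by (rewrite (S_INR (S n)); ring).
  replace (- INR (S n) - 1) with (- INR (S (S n))) in H2 by (rewrite (S_INR (S n)); ring).
  unfold schlaefli_improper. rewrite <- !(tech_pow_Rmult (-1)).
  transitivity (z * (schlaefli_tail (INR (S (S n))) z + schlaefli_tail (INR n) z)
    + (-1) ^ n * (z * (schlaefli_tail (- INR n) z + schlaefli_tail (- INR (S (S n))) z))); [ring|].
  rewrite H1, H2. field. lra.
Qed.

(** The finite and the half-line integral each satisfy an inhomogeneous recurrence; the
    inhomogeneities 2 (1 - (-1)^(n+1)) have opposite signs, so the sum obeys the recurrence of Y. *)
Lemma schlaefli_Y (n : nat) (z : R) :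
  0 < z ->
  PI * besselY_nat n z = - (schlaefli_cos (INR n) (- (PI / 2)) z + schlaefli_improper n z).
Proof.
  intros Hz. revert n. apply two_step_ind.
  - rewrite (proj1 (schlaefli_Y_01 z Hz)). unfold schlaefli_Y0, schlaefli_improper.
    simpl. rewrite Ropp_0. ring.
  - rewrite (proj2 (schlaefli_Y_01 z Hz)). unfold schlaefli_Y1, schlaefli_improper.
    simpl. replace (- (1)) with (-1) by ring. ring.
  - intros n H0 H1.
    pose proof (besselY_rec n z Hz) as HJ.
    pose proof (schlaefli_cos_rec (INR (S n)) (- (PI / 2)) z) as HC.
    pose proof (schlaefli_improper_rec n z Hz) as HT.
    rewrite sin_INR_PI_plus, sin_m_PI2 in HC.
    replace (INR (S n) - 1) with (INR n) in HC by (rewrite S_INR; ring).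
    rewrite <- (S_INR (S n)) in HC.
    apply Rmult_eq_reg_l with z; [|lra].
    transitivity (z * (PI * (2 * INR (S n) / z * besselY_nat (S n) z - besselY_nat n z)));
      [f_equal; f_equal; lra|].
    transitivity (2 * INR (S n) * (PI * besselY_nat (S n) z) - z * (PI * besselY_nat n z)); [field; lra|].
    rewrite H0, H1. lra.
Qed.

(** * Behaviour at infinity *)

Lemma RInt_antiderivative_on (f F : R -> R) (a b : R) :
  a <= b ->
  (forall t, a <= t <= b -> is_derive F t (f t)) ->
  (forall t, a <= t <= b -> continuous f t) ->
  is_RInt f a b (F b - F a).
Proof.
  intros Hab HF Hf.
  apply (is_RInt_derive (V := R_CompleteNormedModule) F f);
    intros t Ht; rewrite Rmin_left, Rmax_right in Ht by exact Hab; [apply HF | apply Hf]; exact Ht.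
Qed.

(* Integration by parts: [1 - sin t = cos t * h t] with [h t = cos t / (1 + sin t)] smooth on [0, PI]. *)
Lemma stationary_bound (z e : R) :
  0 < z ->
  Rabs (RInt (fun t => (1 - sin t) * cos (z * sin t + e)) 0 PI) <= (2 + PI) / z.
Proof.
  intros Hz. pose proof PI_RGT_0 as HPI.
  set (F := fun t => cos t / (1 + sin t) * sin (z * sin t + e) / z).
  set (g := fun t => - (1 / (1 + sin t)) * sin (z * sin t + e) / z).
  assert (Hs : forall t, 0 <= t <= PI -> 0 <= sin t) by (intros; apply sin_ge_0; lra).
  assert (Hg : forall t, 0 <= t <= PI -> continuous g t).
  { intros t Ht. apply (ex_derive_continuous g). unfold g. auto_derive.
    specialize (Hs t Ht). repeat split; lra. }
  set (f := fun t => (1 - sin t) * cos (z * sin t + e)).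
  assert (Hxf : ex_RInt f 0 PI).
  { apply ex_derive_ex_RInt. intros t. unfold f. auto_derive. exact I. }
  assert (Hxg : ex_RInt g 0 PI).
  { apply (ex_RInt_continuous g). intros t Ht.
    rewrite Rmin_left, Rmax_right in Ht by lra. apply Hg, Ht. }
  assert (H : is_RInt (fun t => 1 * f t + 1 * g t) 0 PI (F PI - F 0)).
  { apply RInt_antiderivative_on; [lra | |].
    - intros t Ht. specialize (Hs t Ht). unfold F, f, g.
      auto_derive; [lra|]. pose proof (sin2_cos2 t) as H2. unfold Rsqr in H2.
      apply Rmult_eq_reg_r with (z * (1 + sin t) ^ 2); [|apply Rmult_integral_contrapositive_currified; [lra | apply pow_nonzero; lra]].
      field_simplify; [|lra | lra].
      replace (cos t ^ 2) with (1 - sin t ^ 2) by (simpl; lra). ring.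
    - intros t Ht. apply (continuous_plus (fun t => 1 * f t) (fun t => 1 * g t)).
      + apply (continuous_scal_r 1 f). apply (ex_derive_continuous f). unfold f. auto_derive. exact I.
      + apply (continuous_scal_r 1 g). apply Hg, Ht. }
  apply (is_RInt_unique (V := R_CompleteNormedModule)) in H. rewrite RInt_lin in H by assumption.
  unfold F in H. rewrite sin_PI, sin_0, cos_PI, cos_0, Rmult_0_r, Rplus_0_l, Rplus_0_r in H.
  assert (Hbg : Rabs (RInt g 0 PI) <= (PI - 0) * / z).
  { apply RInt_abs_bound; [lra | exact Hxg |]. intros t Ht. specialize (Hs t Ht). unfold g.
    unfold Rdiv. rewrite !Rabs_mult, Rabs_Ropp, (Rabs_pos_eq (/ z)) by (left; apply Rinv_0_lt_compat, Hz).
    assert (Hsin : Rabs (sin (z * sin t + e)) <= 1) by (apply Rabs_le, SIN_bound).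
    rewrite Rabs_mult, Rabs_R1, Rmult_1_l, (Rabs_pos_eq (/ (1 + sin t))) by (left; apply Rinv_0_lt_compat; lra).
    assert (Hi : 0 < / (1 + sin t) <= 1).
    { split; [apply Rinv_0_lt_compat; lra|]. rewrite <- Rinv_1. apply Rinv_le_contravar; lra. }
    assert (0 < / z) by (apply Rinv_0_lt_compat, Hz).
    pose proof (Rabs_pos (sin (z * sin t + e))).
    assert (/ (1 + sin t) * Rabs (sin (z * sin t + e)) <= 1) by nra. nra. }
  replace (RInt f 0 PI) with (- (2 * sin e) * / z - RInt g 0 PI).
  2:{ transitivity ((1 * RInt f 0 PI + 1 * RInt g 0 PI) - RInt g 0 PI); [|as_Req; ring].
      rewrite H. as_Req. field. lra. }
  assert (Hse : Rabs (sin e) <= 1) by (apply Rabs_le, SIN_bound).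
  assert (0 < / z) by (apply Rinv_0_lt_compat, Hz).
  eapply Rle_trans; [apply Rabs_triang|]. rewrite Rabs_mult, !Rabs_Ropp, Rabs_mult.
  rewrite (Rabs_pos_eq 2), (Rabs_pos_eq (/ z)) by lra.
  unfold Rdiv. nra.
Qed.

(** The part of the difference containing cos t sin(e - z sin t) is an exact derivative with zero
    integral. What is left carries the factor 1 - sin t, which vanishes at the stationary point t =
    pi/2; this yields O(1/z) instead of O(1/sqrt z). *)
Lemma schlaefli_cos_diff (z e : R) :
  0 < z ->
  schlaefli_cos 0 e z - schlaefli_cos 1 (e - PI / 2) z
  = RInt (fun t => (1 - sin t) * cos (z * sin t + - e)) 0 PI.
Proof.
  intros Hz.
  set (f := fun t => (1 - sin t) * cos (z * sin t + - e)).
  set (g := fun t => cos t * sin (e - z * sin t)).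
  assert (Hg : RInt g 0 PI = 0).
  { rewrite (RInt_antiderivative g (fun t => cos (e - z * sin t) / z)).
    - rewrite sin_PI, sin_0. as_Req. ring.
    - intros t. unfold g. auto_derive; [exact I|]. change (e + - (z * sin t)) with (e - z * sin t).
      field. lra.
    - intros t. apply (ex_derive_continuous g). unfold g. auto_derive. exact I. }
  assert (Hxf : ex_RInt f 0 PI).
  { apply ex_derive_ex_RInt. intros t. unfold f. auto_derive. exact I. }
  assert (Hxg : ex_RInt g 0 PI).
  { apply ex_derive_ex_RInt. intros t. unfold g. auto_derive. exact I. }
  transitivity (RInt (fun t => 1 * cos (0 * t - z * sin t + e) + (-1) * cos (1 * t - z * sin t + (e - PI / 2))) 0 PI).
  { rewrite RInt_lin by apply schlaefli_cos_ex. unfold schlaefli_cos. as_Req. ring. }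
  transitivity (RInt (fun t => 1 * f t + (-1) * g t) 0 PI).
  - apply RInt_ext. intros t _. as_Req. unfold f, g.
    replace (1 * t - z * sin t + (e - PI / 2)) with (t + (e - z * sin t) - PI / 2) by ring.
    replace (0 * t - z * sin t + e) with (e - z * sin t) by ring.
    replace (z * sin t + - e) with (- (e - z * sin t)) by ring.
    rewrite cos_neg, (cos_minus (t + (e - z * sin t))), cos_PI2, sin_PI2, (sin_plus t). ring.
  - rewrite RInt_lin by assumption. rewrite Hg. as_Req. ring.
Qed.

Lemma schlaefli_tail_nonneg (a z : R) : 0 < z -> 0 <= schlaefli_tail a z.
Proof.
  intros Hz. apply Rle_trans with (improper (fun t => 0 * exp (- t / 2))); [rewrite improper_exp_half; lra|].
  apply improper_le; [apply dominated_exp_half | apply schlaefli_kernel_dominated, Hz |].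
  intros t _. rewrite Rmult_0_l. left. apply schlaefli_kernel_pos.
Qed.

(** This is 1 <= cosh t. As the right side equals 2/z by the recurrence, it makes all three
    half-line integrals O(1/z). *)
Lemma schlaefli_tail_0_le (z : R) :
  0 < z -> 2 * schlaefli_tail 0 z <= schlaefli_tail 1 z + schlaefli_tail (-1) z.
Proof.
  intros Hz.
  assert (Hk : forall a, dominated (schlaefli_kernel a z)) by (intros; apply schlaefli_kernel_dominated, Hz).
  unfold schlaefli_tail.
  assert (improper (schlaefli_kernel 0 z)
    <= improper (fun t => 1 / 2 * schlaefli_kernel 1 z t + 1 / 2 * schlaefli_kernel (-1) z t)).
  { apply improper_le; [apply Hk | apply dominated_lin; apply Hk |]. intros t _.
    destruct (schlaefli_kernel_shift 0 z t) as [E1 E2].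
    rewrite Rplus_0_l in E1. replace (0 - 1) with (-1) in E2 by ring. rewrite E1, E2.
    pose proof (schlaefli_kernel_pos 0 z t).
    assert (2 <= exp t + exp (- t)); [|nra].
    pose proof (exp_ge_1_plus t). pose proof (exp_ge_1_plus (- t)). lra. }
  rewrite improper_lin in H by apply Hk. lra.
Qed.

Lemma radiation_0 (z : R) :
  0 < z ->
  Rabs (besselJ_nat 1 z - besselY_nat 0 z) <= 4 / z /\
  Rabs (besselY_nat 1 z + besselJ_nat 0 z) <= 4 / z.
Proof.
  intros Hz.
  destruct (schlaefli_J_01 z Hz) as [HJ0 HJ1]. destruct (schlaefli_Y_01 z Hz) as [HY0 HY1].
  unfold schlaefli_Y0, schlaefli_Y1 in *.
  pose proof (schlaefli_tail_rec 0 z Hz) as Hr.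
  rewrite Rplus_0_l in Hr. replace (0 - 1) with (-1) in Hr by ring.
  assert (Hr' : schlaefli_tail 1 z + schlaefli_tail (-1) z = 2 / z) by lra.
  pose proof (schlaefli_tail_0_le z Hz) as H0.
  pose proof (schlaefli_tail_nonneg 0 z Hz). pose proof (schlaefli_tail_nonneg 1 z Hz).
  pose proof (schlaefli_tail_nonneg (-1) z Hz).
  pose proof (stationary_bound z (- 0) Hz) as S0.
  pose proof (stationary_bound z (- (PI / 2)) Hz) as S1.
  rewrite <- schlaefli_cos_diff in S0, S1 by exact Hz.
  rewrite Rminus_0_l in S0. rewrite Rminus_diag in S1.
  assert (E : schlaefli_cos 0 (- (PI / 2)) z = - schlaefli_cos 0 (PI / 2) z).
  { unfold schlaefli_cos.
    rewrite <- (RInt_opp (V := R_CompleteNormedModule)) by apply schlaefli_cos_ex.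
    apply RInt_ext. intros t _. change opp with Ropp. as_Req.
    rewrite !(cos_plus (0 * t - z * sin t)), cos_neg, sin_neg, cos_PI2, sin_PI2. ring. }
  rewrite E in *.
  pose proof PI2_3_2. assert (HPI : 3 <= PI) by lra.
  assert (Hb : (4 + PI) / z <= PI * (4 / z)).
  { unfold Rdiv. assert (0 < / z) by (apply Rinv_0_lt_compat, Hz). nra. }
  assert (Hs : (2 + PI) / z + 2 / z = (4 + PI) / z) by (field; lra).
  apply Rabs_le_between in S0. apply Rabs_le_between in S1.
  split; apply Rmult_le_reg_l with PI; try lra;
    rewrite <- (Rabs_pos_eq PI) at 1 by lra; rewrite <- Rabs_mult;
    apply Rle_trans with (2 := Hb); apply Rabs_le; lra.
Qed.

(** Expanding the squares leaves twice the Wronskian. Together with the radiation estimate this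
    bounds z |H_0|^2 without any asymptotic expansion. *)
Lemma bessel_modulus_01 (z : R) :
  0 < z ->
  z * (besselJ_nat 0 z ^ 2 + besselY_nat 0 z ^ 2 + besselJ_nat 1 z ^ 2 + besselY_nat 1 z ^ 2)
  = z * ((besselJ_nat 1 z - besselY_nat 0 z) ^ 2 + (besselY_nat 1 z + besselJ_nat 0 z) ^ 2) + 4 / PI.
Proof.
  intros Hz. pose proof (bessel_wronskian 0 z Hz) as H. pose proof PI_RGT_0.
  replace (4 / PI) with (2 * z * (2 / (PI * z))) by (field; lra).
  rewrite <- H. ring.
Qed.

Lemma radiation (n : nat) :
  exists C, 0 <= C /\ forall z, 1 <= z ->
    Rabs (besselJ_nat n z) <= C / sqrt z /\ Rabs (besselY_nat n z) <= C / sqrt z /\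
    Rabs (besselJ_nat (S n) z - besselY_nat n z) <= C / z /\
    Rabs (besselY_nat (S n) z + besselJ_nat n z) <= C / z.
Proof.
  induction n as [|n [C [HC IH]]].
  (* The modulus identity gives at most 2 + 16 + 16, rounded up to 64 = 8^2. *)
  - exists 8. split; [lra|]. intros z Hz.
    destruct (radiation_0 z ltac:(lra)) as [R1 R2].
    pose proof (bessel_modulus_01 z ltac:(lra)) as Hm.
    assert (Hiz : 0 < / z <= 1).
    { split; [apply Rinv_0_lt_compat; lra|]. rewrite <- Rinv_1. apply Rinv_le_contravar; lra. }
    assert (Hsq : 0 < sqrt z) by (apply sqrt_lt_R0; lra).
    assert (Hss : sqrt z * sqrt z = z) by (apply sqrt_sqrt; lra).
    assert (HPI : 4 / PI <= 2).
    { pose proof PI2_3_2. apply Rle_div_l; lra. }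
    assert (Hsqr : forall x, Rabs x <= 4 / z -> x ^ 2 <= 16 / z * / z).
    { intros x Hx. rewrite <- pow2_abs. pose proof (Rabs_pos x).
      apply Rle_trans with ((4 / z) ^ 2); [apply pow_incr; lra | right; field; lra]. }
    pose proof (Hsqr _ R1) as Q1. pose proof (Hsqr _ R2) as Q2.
    assert (Hb : z * (besselJ_nat 0 z ^ 2 + besselY_nat 0 z ^ 2) <= 64).
    { pose proof (pow2_ge_0 (besselJ_nat 1 z)). pose proof (pow2_ge_0 (besselY_nat 1 z)).
      assert (z * (16 / z * / z) <= 16).
      { replace (z * (16 / z * / z)) with (16 * / z) by (field; lra). lra. }
      nra. }
    assert (Hroot : forall x, z * x ^ 2 <= 64 -> Rabs x <= 8 / sqrt z).
    { intros x Hx. apply Rle_div_r; [exact Hsq|].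
      apply Rsqr_incr_0; [|apply Rmult_le_pos; [apply Rabs_pos | lra] | lra].
      unfold Rsqr. pose proof (pow2_abs x). nra. }
    pose proof (pow2_ge_0 (besselJ_nat 0 z)). pose proof (pow2_ge_0 (besselY_nat 0 z)).
    assert (4 / z <= 8 / z) by (unfold Rdiv; nra).
    repeat split; try lra; apply Hroot; nra.
  (* In the recurrence the term 2(n+1)/z times a function bounded by 2 C contributes (4n+4) C / z,
     and the previous radiation error another C / z. *)
  - exists ((4 * INR n + 5) * C). pose proof (pos_INR n) as Hn. split; [nra|]. intros z Hz.
    destruct (IH z Hz) as [B1 [B2 [B3 B4]]].
    assert (Hiz : 0 < / z) by (apply Rinv_0_lt_compat; lra).
    assert (Hsq : 0 < sqrt z) by (apply sqrt_lt_R0; lra).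
    assert (Hs1 : sqrt z <= z).
    { pose proof (sqrt_sqrt z ltac:(lra)). assert (1 <= sqrt z); [|nra].
      rewrite <- sqrt_1. apply sqrt_le_1_alt. exact Hz. }
    assert (His : / z <= / sqrt z) by (apply Rinv_le_contravar; lra).
    assert (His1 : / sqrt z <= 1).
    { rewrite <- Rinv_1. apply Rinv_le_contravar; [lra|]. rewrite <- sqrt_1.
      apply sqrt_le_1_alt. exact Hz. }
    assert (His0 : 0 < / sqrt z) by (apply Rinv_0_lt_compat, Hsq).
    unfold Rdiv in *.
    assert (HJ : Rabs (besselJ_nat (S n) z) <= 2 * C * / sqrt z).
    { replace (besselJ_nat (S n) z) with (besselY_nat n z + (besselJ_nat (S n) z - besselY_nat n z)) by ring.
      eapply Rle_trans; [apply Rabs_triang|]. nra. }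
    assert (HY : Rabs (besselY_nat (S n) z) <= 2 * C * / sqrt z).
    { replace (besselY_nat (S n) z) with (- besselJ_nat n z + (besselY_nat (S n) z + besselJ_nat n z)) by ring.
      eapply Rle_trans; [apply Rabs_triang|]. rewrite Rabs_Ropp. nra. }
    assert (Hrec : forall x, Rabs x <= 2 * C * / sqrt z ->
      Rabs (2 * INR (S n) / z * x) <= (2 * INR n + 2) * (2 * C) * / z).
    { intros x Hx. unfold Rdiv. rewrite !Rabs_mult, (Rabs_pos_eq 2), (Rabs_pos_eq (INR _)), (Rabs_pos_eq (/ z))
        by (try apply pos_INR; lra).
      rewrite S_INR. pose proof (Rabs_pos x).
      assert (Rabs x <= 2 * C) by nra.
      assert (0 <= 2 * (INR n + 1) * / z) by nra. nra. }
    pose proof (besselJ_rec n z ltac:(lra)) as RJ.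
    pose proof (besselY_rec n z ltac:(lra)) as RY.
    assert (Hc : 2 * C * / sqrt z <= (4 * INR n + 5) * C * / sqrt z).
    { apply Rmult_le_compat_r; [lra | nra]. }
    repeat split; [lra | lra | |].
    + replace (besselJ_nat (S (S n)) z - besselY_nat (S n) z) with
        (2 * INR (S n) / z * besselJ_nat (S n) z + - (besselY_nat (S n) z + besselJ_nat n z)) by lra.
      eapply Rle_trans; [apply Rabs_triang|]. rewrite Rabs_Ropp. specialize (Hrec _ HJ). nra.
    + replace (besselY_nat (S (S n)) z + besselJ_nat (S n) z) with
        (2 * INR (S n) / z * besselY_nat (S n) z + (besselJ_nat (S n) z - besselY_nat n z)) by lra.
      eapply Rle_trans; [apply Rabs_triang|]. specialize (Hrec _ HY). nra.
Qed.

(** * Monotonicity of the modulus *)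

(* [a] stands for [z |H|^2]; [v = a'] satisfies [v'' + 4 Q v = - 2 Q' a] with [Q = 1 - mu / z ^ 2].
   The derivative of [G = z^3 (v'^2 + 4 Q v^2) + 8 mu a v] is a sum of squares, and
   [G] cannot become positive: past that point it would grow like [z ^ 3]. *)
Section Appell.

Variables (a v u : R -> R) (mu K : R).
Hypothesis mu_pos : 0 < mu.
Hypothesis Da : forall z, 0 < z -> is_derive a z (v z).
Hypothesis Dv : forall z, 0 < z -> is_derive v z (u z).
Hypothesis Du : forall z, 0 < z ->
  is_derive u z (- 4 * (1 - mu / z ^ 2) * v z - 4 * mu / z ^ 3 * a z).
Hypothesis a_pos : forall z, 0 < z -> 0 < a z.
(** In the application a = |w|^2 with w = sqrt z H_n solving w'' + Q w = 0, and the expression is 2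
    |w'|^2. *)
Hypothesis convex : forall z, 0 < z -> 0 <= u z + 2 * (1 - mu / z ^ 2) * a z.
Hypothesis bounds : forall z, 1 <= z ->
  Rabs (a z) <= K /\ Rabs (v z) <= K / sqrt z /\ Rabs (u z) <= K / sqrt z.

Definition appell_energy (z : R) : R :=
  z ^ 3 * u z ^ 2 + 4 * (z ^ 3 - mu * z) * v z ^ 2 + 8 * mu * a z * v z.

Lemma appell_energy_is_derive (z : R) :
  0 < z ->
  is_derive appell_energy z (3 * z ^ 2 * u z ^ 2 + (12 * z ^ 2 + 4 * mu) * v z ^ 2).
Proof.
  intros Hz. unfold appell_energy.
  apply is_derive_eq with
    (3 * z ^ 2 * u z ^ 2
     + z ^ 3 * (2 * u z * (- 4 * (1 - mu / z ^ 2) * v z - 4 * mu / z ^ 3 * a z))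
     + 4 * (3 * z ^ 2 - mu) * v z ^ 2 + 4 * (z ^ 3 - mu * z) * (2 * v z * u z)
     + 8 * mu * (v z * v z + a z * u z)).
  - auto_derive.
    + repeat split; eexists; [apply Du | apply Dv | apply Da | apply Dv]; exact Hz.
    + change (Derive (fun x : R => a x)) with (Derive a).
      change (Derive (fun x : R => v x)) with (Derive v).
      change (Derive (fun x : R => u x)) with (Derive u).
      rewrite (is_derive_unique _ _ _ (Da z Hz)), (is_derive_unique _ _ _ (Dv z Hz)),
        (is_derive_unique _ _ _ (Du z Hz)).
      simpl. field. lra.
  - field. lra.
Qed.

Lemma appell_energy_nondecreasing (x y : R) :
  0 < x <= y -> appell_energy x <= appell_energy y.
Proof.
  intros H. apply (is_derive_nondecreasing appell_energy
    (fun z => 3 * z ^ 2 * u z ^ 2 + (12 * z ^ 2 + 4 * mu) * v z ^ 2)); [lra | |].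
  - intros z Hz. apply appell_energy_is_derive. lra.
  - intros z Hz. pose proof (pow2_ge_0 z). pose proof (pow2_ge_0 (u z)).
    pose proof (pow2_ge_0 (v z)).
    assert (0 <= z ^ 2 * u z ^ 2) by (apply Rmult_le_pos; assumption).
    assert (0 <= (12 * z ^ 2 + 4 * mu) * v z ^ 2) by (apply Rmult_le_pos; lra). lra.
Qed.

Lemma bounds_eventually (c eps : R) :
  0 <= c -> 0 < eps -> exists Z, 1 <= Z /\ forall z, Z <= z -> c / sqrt z <= eps.
Proof.
  intros Hc He. exists (1 + (c / eps) ^ 2). pose proof (pow2_ge_0 (c / eps)). split; [lra|].
  intros z Hz. assert (Hs : 0 < sqrt z) by (apply sqrt_lt_R0; lra).
  apply Rle_div_l; [exact Hs|].
  assert (c / eps <= sqrt z).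
  { rewrite <- (sqrt_pow2 (c / eps)) by (apply Rdiv_le_0_compat; lra).
    apply sqrt_le_1_alt. lra. }
  apply Rle_div_l in H0; lra.
Qed.

Lemma appell_energy_nonpos (z0 : R) : 0 < z0 -> appell_energy z0 <= 0.
Proof.
  intros Hz0. apply Rnot_lt_le. intros Hpos.
  (* Half of the energy is kept as a margin against 8 mu a v, the only term of indefinite sign far
     out; it tends to 0 by [bounds]. *)
  set (d := appell_energy z0 / 2). assert (Hd : 0 < d) by (unfold d; lra).
  assert (HK : 0 <= K).
  { destruct (bounds 1 (Rle_refl 1)) as [H _]. pose proof (Rabs_pos (a 1)). lra. }
  destruct (bounds_eventually (8 * mu * K * K) d) as [Z1 [HZ1 B1]]; [nra | exact Hd |].
  set (Z := Rmax z0 Z1).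
  assert (HZ : z0 <= Z /\ Z1 <= Z) by (split; [apply Rmax_l | apply Rmax_r]).
  assert (Hsmall : forall z, Z <= z -> Rabs (8 * mu * a z * v z) <= d).
  { intros z Hz. destruct (bounds z ltac:(lra)) as [Ba [Bv _]].
    rewrite !Rabs_mult, (Rabs_pos_eq 8), (Rabs_pos_eq mu) by lra.
    apply Rle_trans with (2 := B1 z ltac:(lra)).
    pose proof (Rabs_pos (a z)). pose proof (Rabs_pos (v z)).
    replace (8 * mu * K * K / sqrt z) with (8 * mu * (K * (K / sqrt z))) by (unfold Rdiv; ring).
    rewrite Rmult_assoc. apply Rmult_le_compat_l; [lra|]. apply Rmult_le_compat; lra. }
  assert (HGZ : 2 * d <= appell_energy Z).
  { unfold d. replace (2 * (appell_energy z0 / 2)) with (appell_energy z0) by field.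
    apply appell_energy_nondecreasing. lra. }
  (* The energy G satisfies G' - 3 (G - d)/z = 16 mu v^2 + 3 (d - 8 mu a v)/z >= 0, so this quotient
     is nondecreasing and stays above a positive value, while [bounds] forces it below (5 K^2 +
     d)/z. *)
  set (g := fun z => (appell_energy z - d) / z ^ 3).
  assert (Hg : forall z, Z <= z -> g Z <= g z).
  { intros z Hz.
    apply (is_derive_nondecreasing g (fun z =>
      ((3 * z ^ 2 * u z ^ 2 + (12 * z ^ 2 + 4 * mu) * v z ^ 2) - 3 * (appell_energy z - d) / z) / z ^ 3));
      [exact Hz | |].
    - intros x Hx. assert (Hx0 : 0 < x) by lra. unfold g. auto_derive.
      + repeat split; [eexists; apply appell_energy_is_derive; exact Hx0 |].
        apply Rgt_not_eq. repeat apply Rmult_lt_0_compat; lra.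
      + change (Derive (fun x : R => appell_energy x)) with (Derive appell_energy).
        rewrite (is_derive_unique _ _ _ (appell_energy_is_derive x Hx0)). field. lra.
    - intros x Hx. assert (Hx0 : 0 < x) by lra.
      apply Rdiv_le_0_compat; [|apply pow_lt, Hx0].
      specialize (Hsmall x ltac:(lra)). apply Rabs_le_between in Hsmall.
      unfold appell_energy.
      replace (_ - _) with (16 * mu * v x ^ 2 + 3 * (d - 8 * mu * a x * v x) / x) by (field; lra).
      assert (0 <= 3 * (d - 8 * mu * a x * v x) / x) by (apply Rdiv_le_0_compat; lra).
      pose proof (pow2_ge_0 (v x)). nra. }
  assert (HgZ : 0 < g Z).
  { unfold g. apply Rdiv_lt_0_compat; [lra | apply pow_lt; lra]. }
  destruct (bounds_eventually (5 * K ^ 2 + d) (g Z / 2)) as [Z2 [HZ2 B2]];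
    [pose proof (pow2_ge_0 K); lra | lra |].
  set (z := Rmax Z Z2).
  assert (Hz : Z <= z /\ Z2 <= z) by (split; [apply Rmax_l | apply Rmax_r]).
  assert (Hz1 : 1 <= z) by lra.
  specialize (Hg z (proj1 Hz)). specialize (B2 z (proj2 Hz)).
  destruct (bounds z Hz1) as [_ [Bv Bu]].
  specialize (Hsmall z (proj1 Hz)). apply Rabs_le_between in Hsmall.
  assert (Hs : 0 < sqrt z) by (apply sqrt_lt_R0; lra).
  assert (Hss : sqrt z * sqrt z = z) by (apply sqrt_sqrt; lra).
  assert (Hs1 : 1 <= sqrt z) by (rewrite <- sqrt_1; apply sqrt_le_1_alt; exact Hz1).
  assert (Hsq : forall x, Rabs x <= K / sqrt z -> x ^ 2 <= K ^ 2 / z).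
  { intros x Hx. rewrite <- pow2_abs.
    apply Rle_trans with ((K / sqrt z) ^ 2); [apply pow_incr; split; [apply Rabs_pos | exact Hx]|].
    right. rewrite <- Hss at 2. field. lra. }
  pose proof (Hsq _ Bv) as Qv. pose proof (Hsq _ Bu) as Qu.
  assert (Hgz : g z <= (5 * K ^ 2 + d) / z).
  { unfold g, appell_energy. apply Rle_div_l; [apply pow_lt; lra|].
    assert (Hz3 : 0 < z ^ 3) by (apply pow_lt; lra).
    assert (Hv : 4 * (z ^ 3 - mu * z) * v z ^ 2 <= 4 * z ^ 3 * (K ^ 2 / z)).
    { pose proof (pow2_ge_0 (v z)). assert (0 <= mu * z * v z ^ 2) by (apply Rmult_le_pos; nra).
      assert (z ^ 3 * v z ^ 2 <= z ^ 3 * (K ^ 2 / z)) by (apply Rmult_le_compat_l; lra). lra. }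
    assert (Hu : z ^ 3 * u z ^ 2 <= z ^ 3 * (K ^ 2 / z)) by (apply Rmult_le_compat_l; lra).
    assert (Hdz : 0 <= d / z * z ^ 3) by (apply Rmult_le_pos; [apply Rdiv_le_0_compat; lra | lra]).
    replace ((5 * K ^ 2 + d) / z * z ^ 3) with (5 * (z ^ 3 * (K ^ 2 / z)) + d / z * z ^ 3) by (field; lra).
    lra. }
  assert (Hfin : (5 * K ^ 2 + d) / z <= (5 * K ^ 2 + d) / sqrt z).
  { apply Rmult_le_compat_l; [pose proof (pow2_ge_0 K); lra|].
    apply Rinv_le_contravar; [exact Hs | nra]. }
  lra.
Qed.

(** Beyond the turning point z^2 = mu, a positive slope would make every term of the energy
    nonnegative and the last one positive. *)
Lemma appell_slope_nonpos_far (z : R) : 0 < z -> mu <= z ^ 2 -> v z <= 0.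
Proof.
  intros Hz Hm. pose proof (appell_energy_nonpos z Hz) as H. unfold appell_energy in H.
  apply Rnot_lt_le. intros Hv. specialize (a_pos z Hz).
  assert (0 <= z ^ 3 * u z ^ 2) by (apply Rmult_le_pos; [apply pow_le; lra | apply pow2_ge_0]).
  assert (0 <= 4 * (z ^ 3 - mu * z) * v z ^ 2).
  { apply Rmult_le_pos; [|apply pow2_ge_0].
    replace (4 * (z ^ 3 - mu * z)) with (4 * z * (z ^ 2 - mu)) by ring. apply Rmult_le_pos; lra. }
  assert (0 < 8 * mu * a z * v z) by (repeat apply Rmult_lt_0_compat; lra). lra.
Qed.

(** Before the turning point Q <= 0, so [convex] gives v' >= 0 and v is at most its value at sqrt
    mu. *)
Lemma appell_slope_nonpos (z : R) : 0 < z -> v z <= 0.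
Proof.
  intros Hz. destruct (Rle_dec mu (z ^ 2)) as [H|H]; [apply appell_slope_nonpos_far; assumption|].
  assert (Hs : 0 < sqrt mu) by (apply sqrt_lt_R0, mu_pos).
  assert (Hss : sqrt mu ^ 2 = mu) by (apply pow2_sqrt; lra).
  assert (Hzs : z <= sqrt mu) by nra.
  apply Rle_trans with (v (sqrt mu)).
  - apply (is_derive_nondecreasing v u); [exact Hzs | |].
    + intros x Hx. apply Dv. lra.
    + intros x Hx. assert (Hx0 : 0 < x) by lra. specialize (convex x Hx0). specialize (a_pos x Hx0).
      assert (1 - mu / x ^ 2 <= 0).
      { assert (1 <= mu / x ^ 2); [|lra]. apply Rle_div_r; nra. }
      nra.
  - apply appell_slope_nonpos_far; lra.
Qed.

End Appell.

Definition modulus2 (n : nat) (z : R) : R := besselJ_nat n z ^ 2 + besselY_nat n z ^ 2.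

(** The real part of H_n times the conjugate of H_{n+1}; with the two squared moduli it forms a
    closed differential system. *)
Definition cross (n : nat) (z : R) : R :=
  besselJ_nat n z * besselJ_nat (S n) z + besselY_nat n z * besselY_nat (S n) z.

Lemma modulus2_pos (n : nat) (z : R) : 0 < z -> 0 < modulus2 n z.
Proof.
  intros Hz. unfold modulus2.
  pose proof (bessel_wronskian n z Hz) as H. pose proof PI_RGT_0.
  assert (0 < 2 / (PI * z)) by (apply Rdiv_lt_0_compat; [lra | apply Rmult_lt_0_compat; lra]).
  pose proof (pow2_ge_0 (besselJ_nat n z)). pose proof (pow2_ge_0 (besselY_nat n z)).
  apply Rnot_le_lt. intros H4.
  assert (besselJ_nat n z = 0) by nra. assert (besselY_nat n z = 0) by nra. nra.
Qed.

Lemma modulus2_is_derive (n : nat) (z : R) :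
  0 < z -> is_derive (modulus2 n) z (2 * INR n / z * modulus2 n z - 2 * cross n z).
Proof.
  intros Hz. unfold modulus2, cross. auto_derive.
  - repeat split; eexists; [apply besselJ_is_derive_up | apply besselY_is_derive_up]; exact Hz.
  - change (Derive (fun x : R => besselJ_nat n x)) with (Derive (besselJ_nat n)).
    change (Derive (fun x : R => besselY_nat n x)) with (Derive (besselY_nat n)).
    rewrite (is_derive_unique _ _ _ (besselJ_is_derive_up n z Hz)),
      (is_derive_unique _ _ _ (besselY_is_derive_up n z Hz)). field. lra.
Qed.

Lemma modulus2_S_is_derive (n : nat) (z : R) :
  0 < z ->
  is_derive (modulus2 (S n)) z (2 * cross n z - 2 * INR (S n) / z * modulus2 (S n) z).
Proof.
  intros Hz. unfold modulus2, cross. auto_derive.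
  - repeat split; eexists; [apply besselJ_is_derive_down | apply besselY_is_derive_down]; exact Hz.
  - change (Derive (fun x : R => besselJ_nat (S n) x)) with (Derive (besselJ_nat (S n))).
    change (Derive (fun x : R => besselY_nat (S n) x)) with (Derive (besselY_nat (S n))).
    rewrite (is_derive_unique _ _ _ (besselJ_is_derive_down n z Hz)),
      (is_derive_unique _ _ _ (besselY_is_derive_down n z Hz)). field. lra.
Qed.

Lemma cross_is_derive (n : nat) (z : R) :
  0 < z -> is_derive (cross n) z (modulus2 n z - modulus2 (S n) z - cross n z / z).
Proof.
  intros Hz. unfold modulus2, cross. auto_derive.
  - repeat split;
      match goal with
      | |- ex_derive (fun x => besselJ_nat ?k x) _ => eexists; exact (besselJ_is_derive_up k z Hz)
      | |- ex_derive (fun x => besselY_nat ?k x) _ => eexists; exact (besselY_is_derive_up k z Hz)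
      end.
  - change (Derive (fun x : R => besselJ_nat n x)) with (Derive (besselJ_nat n)).
    change (Derive (fun x : R => besselY_nat n x)) with (Derive (besselY_nat n)).
    change (Derive (fun x : R => besselJ_nat (S n) x)) with (Derive (besselJ_nat (S n))).
    change (Derive (fun x : R => besselY_nat (S n) x)) with (Derive (besselY_nat (S n))).
    rewrite (is_derive_unique _ _ _ (besselJ_is_derive_up n z Hz)),
      (is_derive_unique _ _ _ (besselY_is_derive_up n z Hz)),
      (is_derive_unique _ _ _ (besselJ_is_derive_down n z Hz)),
      (is_derive_unique _ _ _ (besselY_is_derive_down n z Hz)).
    rewrite S_INR. field. lra.
Qed.

(** Substituting H_{n+1} = - i H_n + O(1/z) makes the leading products cancel, both in [cross] and
    in the difference of moduli; only products with the error survive, at most six in number counted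
    with coefficients. *)
Lemma cross_asymptotics (n : nat) :
  exists C, 0 <= C /\ forall z, 1 <= z ->
    z * modulus2 n z <= C /\ Rabs (z * cross n z) <= C / sqrt z /\
    Rabs (z * (modulus2 n z - modulus2 (S n) z)) <= C / sqrt z.
Proof.
  destruct (radiation n) as [C [HC H]]. exists (6 * C ^ 2).
  assert (HC2 : 0 <= C ^ 2) by apply pow2_ge_0. split; [lra|]. intros z Hz.
  destruct (H z Hz) as [B1 [B2 [B3 B4]]]. unfold modulus2, cross.
  set (J := besselJ_nat n z) in *. set (Y := besselY_nat n z) in *.
  set (e1 := besselJ_nat (S n) z - Y) in *. set (e2 := besselY_nat (S n) z + J) in *.
  replace (besselJ_nat (S n) z) with (Y + e1) by (unfold e1; ring).
  replace (besselY_nat (S n) z) with (e2 - J) by (unfold e2; ring).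
  set (s := sqrt z).
  assert (Hss : s * s = z) by (apply sqrt_sqrt; lra).
  assert (Hs1 : 1 <= s) by (unfold s; rewrite <- sqrt_1; apply sqrt_le_1_alt; exact Hz).
  assert (Hp : forall x y a b, Rabs x <= a -> Rabs y <= b -> Rabs (x * y) <= a * b).
  { intros x y a b Ha Hb. rewrite Rabs_mult. apply Rmult_le_compat; auto using Rabs_pos. }
  assert (Hz0 : Rabs z <= z) by (rewrite Rabs_pos_eq; lra).
  assert (Hsq : forall x, Rabs x <= C / s -> z * x ^ 2 <= C ^ 2).
  { intros x Hx. rewrite <- pow2_abs.
    apply Rle_trans with (z * (C / s) ^ 2).
    - apply Rmult_le_compat_l; [lra|]. apply pow_incr. split; [apply Rabs_pos | exact Hx].
    - rewrite <- Hss. right. field. lra. }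
  assert (Hxe : forall x e, Rabs x <= C / s -> Rabs e <= C / z -> Rabs (z * (x * e)) <= C ^ 2 / s).
  { intros x e Hx He. eapply Rle_trans; [apply Hp; [exact Hz0 | apply Hp; eassumption]|].
    rewrite <- Hss. right. field. lra. }
  assert (Hee : forall e, Rabs e <= C / z -> Rabs (z * (e * e)) <= C ^ 2 / s).
  { intros e He. apply Hxe; [|exact He]. eapply Rle_trans; [exact He|].
    apply Rmult_le_compat_l; [exact HC|]. apply Rinv_le_contravar; nra. }
  fold s in B1, B2.
  pose proof (Hxe _ _ B1 B3) as X1. pose proof (Hxe _ _ B2 B4) as X2.
  pose proof (Hxe _ _ B2 B3) as X3. pose proof (Hxe _ _ B1 B4) as X4.
  pose proof (Hee _ B3) as X5. pose proof (Hee _ B4) as X6.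
  apply Rabs_le_between in X1, X2, X3, X4, X5, X6.
  replace (6 * C ^ 2 / s) with (6 * (C ^ 2 / s)) by (unfold Rdiv; ring).
  assert (0 <= C ^ 2 / s) by (apply Rdiv_le_0_compat; lra).
  repeat split.
  - pose proof (Hsq _ B1). pose proof (Hsq _ B2). lra.
  - apply Rabs_le. replace (z * (J * (Y + e1) + Y * (e2 - J))) with (z * (J * e1) + z * (Y * e2)) by ring. lra.
  - apply Rabs_le. replace (z * (J ^ 2 + Y ^ 2 - ((Y + e1) ^ 2 + (e2 - J) ^ 2))) with
      (- 2 * (z * (Y * e1)) + 2 * (z * (J * e2)) - z * (e1 * e1) - z * (e2 * e2)) by ring. lra.
Qed.

(* The derivative of [z * modulus2 n z] is nonpositive. *)
Lemma modulus2_cross (n : nat) (z : R) :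
  (1 <= n)%nat -> 0 < z -> (2 * INR n + 1) * modulus2 n z <= 2 * z * cross n z.
Proof.
  intros Hn Hz. assert (Hn1 : 1 <= INR n) by (apply (le_INR 1), Hn).
  destruct (cross_asymptotics n) as [C [HC HB]].
  set (k := 2 * INR n + 1).
  set (a := fun z => z * modulus2 n z).
  set (v := fun z => k * modulus2 n z - 2 * z * cross n z).
  set (u := fun z => k * (2 * INR n / z * modulus2 n z - 2 * cross n z)
     - 2 * z * (modulus2 n z - modulus2 (S n) z)).
  assert (H : v z <= 0); [|unfold v in H; lra].
  assert (Dm : forall z, 0 < z -> Derive (fun x => modulus2 n x) z = 2 * INR n / z * modulus2 n z - 2 * cross n z).
  { intros x Hx. apply is_derive_unique, modulus2_is_derive, Hx. }
  assert (DmS : forall z, 0 < z -> Derive (fun x => modulus2 (S n) x) z = 2 * cross n z - 2 * INR (S n) / z * modulus2 (S n) z).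
  { intros x Hx. apply is_derive_unique, modulus2_S_is_derive, Hx. }
  assert (Dc : forall z, 0 < z -> Derive (fun x => cross n x) z = modulus2 n z - modulus2 (S n) z - cross n z / z).
  { intros x Hx. apply is_derive_unique, cross_is_derive, Hx. }
  assert (Em : forall z, 0 < z -> ex_derive (fun x => modulus2 n x) z).
  { intros x Hx. eexists. apply modulus2_is_derive, Hx. }
  assert (EmS : forall z, 0 < z -> ex_derive (fun x => modulus2 (S n) x) z).
  { intros x Hx. eexists. apply modulus2_S_is_derive, Hx. }
  assert (Ec : forall z, 0 < z -> ex_derive (fun x => cross n x) z).
  { intros x Hx. eexists. apply cross_is_derive, Hx. }
  (* Here Q = 1 - (n^2 - 1/4)/z^2 is the potential of sqrt z H_n; its mu is positive because n >= 1.
     The last argument is a common bound, dictated by the three terms of [u]. *)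
  apply (appell_slope_nonpos a v u (INR n ^ 2 - 1 / 4) ((k * (2 * INR n + 2) + 2) * C));
    [nra | | | | | | | exact Hz].
  - intros x Hx. unfold a. auto_derive; [auto|]. rewrite Dm by exact Hx. unfold v, k. field. lra.
  - intros x Hx. unfold v. auto_derive; [auto|]. rewrite Dm, Dc by exact Hx. unfold u. field. lra.
  - intros x Hx. unfold u. auto_derive; [repeat split; auto; lra|].
    rewrite Dm, DmS, Dc by exact Hx. unfold v, a, k. rewrite S_INR. field. lra.
  - intros x Hx. unfold a. apply Rmult_lt_0_compat; [exact Hx | apply modulus2_pos, Hx].
  - intros x Hx. unfold u, a, modulus2, cross.
    match goal with |- 0 <= ?e => replace e with
      (2 * x * (((INR n + 1 / 2) / x * besselJ_nat n x - besselJ_nat (S n) x) ^ 2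
        + ((INR n + 1 / 2) / x * besselY_nat n x - besselY_nat (S n) x) ^ 2)) end.
    + apply Rmult_le_pos; [lra|]. apply Rplus_le_le_0_compat; apply pow2_ge_0.
    + unfold k. field. lra.
  - intros x Hx. destruct (HB x Hx) as [B1 [B2 B3]].
    assert (Hm : 0 < modulus2 n x) by (apply modulus2_pos; lra).
    set (s := sqrt x) in *.
    assert (Hss : s * s = x) by (apply sqrt_sqrt; lra).
    assert (Hs1 : 1 <= s) by (unfold s; rewrite <- sqrt_1; apply sqrt_le_1_alt; exact Hx).
    assert (Hk : 3 <= k) by (unfold k; lra).
    assert (Hms : modulus2 n x <= C / s).
    { apply Rle_div_r; [lra|]. apply Rle_trans with (2 := B1).
      rewrite Rmult_comm. apply Rmult_le_compat_r; nra. }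
    assert (HCs : 0 <= C / s) by (apply Rdiv_le_0_compat; lra).
    assert (Hdx : 0 <= / x <= 1).
    { split; [left; apply Rinv_0_lt_compat; lra|]. rewrite <- Rinv_1. apply Rinv_le_contravar; lra. }
    assert (Hc : Rabs (cross n x) <= C / s).
    { apply Rle_trans with (2 := B2). rewrite Rabs_mult, (Rabs_pos_eq x) by lra.
      pose proof (Rabs_pos (cross n x)). nra. }
    assert (Hmx : 0 <= modulus2 n x * / x <= C / s) by nra.
    apply Rabs_le_between in B2, B3, Hc.
    replace ((k * (2 * INR n + 2) + 2) * C / s) with ((k * (2 * INR n + 2) + 2) * (C / s)) by (unfold Rdiv; ring).
    assert (HkC : 0 <= k * (C / s)) by (apply Rmult_le_pos; lra).
    assert (HknC : 0 <= k * INR n * (C / s)) by (apply Rmult_le_pos; [nra | lra]).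
    repeat split.
    + unfold a. rewrite Rabs_pos_eq by nra.
      assert (1 <= k * (2 * INR n + 2) + 2) by nra. nra.
    + unfold v. assert (k * modulus2 n x <= k * (C / s)) by (apply Rmult_le_compat_l; lra).
      apply Rabs_le. split; nra.
    + unfold u.
      assert (0 <= k * INR n * (modulus2 n x * / x) <= k * INR n * (C / s)).
      { split; [apply Rmult_le_pos; nra | apply Rmult_le_compat_l; nra]. }
      assert (- (k * (C / s)) <= k * cross n x <= k * (C / s)) by (split; nra).
      replace (k * (2 * INR n / x * modulus2 n x - 2 * cross n x) - 2 * x * (modulus2 n x - modulus2 (S n) x))
        with (2 * (k * INR n * (modulus2 n x * / x)) - 2 * (k * cross n x)
           - 2 * (x * (modulus2 n x - modulus2 (S n) x))) by (unfold Rdiv; ring).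
      apply Rabs_le. split; lra.
Qed.

(** The recurrences express the difference of the two moduli through [cross (S n)] and
    [modulus2 (S n)]. Since [modulus2_cross] is used at order n + 1 >= 1, the step from order 0 is
    included. *)
Lemma modulus2_step (n : nat) (z : R) :
  0 < z -> modulus2 n z <= modulus2 (S (S n)) z.
Proof.
  intros Hz.
  pose proof (modulus2_cross (S n) z ltac:(lia) Hz) as H.
  pose proof (modulus2_pos (S n) z Hz) as Hm.
  pose proof (besselJ_rec n z Hz) as RJ. pose proof (besselY_rec n z Hz) as RY.
  assert (HS : 0 < INR (S n)) by (apply lt_0_INR; lia).
  assert (E : modulus2 (S (S n)) z - modulus2 n z =
    2 * INR (S n) / z * (2 * cross (S n) z - 2 * INR (S n) / z * modulus2 (S n) z)).
  { unfold modulus2, cross.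
    replace (besselJ_nat n z) with (2 * INR (S n) / z * besselJ_nat (S n) z - besselJ_nat (S (S n)) z) by lra.
    replace (besselY_nat n z) with (2 * INR (S n) / z * besselY_nat (S n) z - besselY_nat (S (S n)) z) by lra.
    ring. }
  assert (0 <= 2 * INR (S n) / z * (2 * cross (S n) z - 2 * INR (S n) / z * modulus2 (S n) z)); [|lra].
  apply Rmult_le_pos; [apply Rdiv_le_0_compat; lra|].
  apply Rmult_le_reg_l with z; [exact Hz|].
  replace (z * (2 * cross (S n) z - 2 * INR (S n) / z * modulus2 (S n) z)) with
    (2 * z * cross (S n) z - 2 * INR (S n) * modulus2 (S n) z) by (field; lra). lra.
Qed.

Lemma modulus2_monotone (n k : nat) (z : R) :
  0 < z -> modulus2 n z <= modulus2 (n + 2 * k) z.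
Proof.
  intros Hz. induction k as [|k IH]; [rewrite Nat.add_0_r; lra|].
  replace (n + 2 * S k)%nat with (S (S (n + 2 * k))) by lia.
  apply Rle_trans with (1 := IH). apply modulus2_step, Hz.
Qed.

(** The strict form of the same inequality, with J and Y on separate sides: at a zero of Y_{n+1} the
    right side vanishes, which is impossible where J is positive and decreasing in the order. *)
Lemma cross_increasing (n : nat) (z : R) :
  0 < z ->
  besselJ_nat (S n) z * (besselJ_nat n z - besselJ_nat (S (S n)) z)
  < besselY_nat (S n) z * (besselY_nat (S (S n)) z - besselY_nat n z).
Proof.
  intros Hz.
  pose proof (modulus2_cross (S n) z ltac:(lia) Hz) as H.
  pose proof (modulus2_pos (S n) z Hz) as Hm.
  pose proof (besselJ_rec n z Hz) as RJ. pose proof (besselY_rec n z Hz) as RY.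
  replace (besselJ_nat n z) with (2 * INR (S n) / z * besselJ_nat (S n) z - besselJ_nat (S (S n)) z) by lra.
  replace (besselY_nat n z) with (2 * INR (S n) / z * besselY_nat (S n) z - besselY_nat (S (S n)) z) by lra.
  assert (0 < 2 * cross (S n) z - 2 * INR (S n) / z * modulus2 (S n) z);
    [|unfold cross, modulus2 in *; lra].
  apply Rmult_lt_reg_l with z; [exact Hz|].
  replace (z * (2 * cross (S n) z - 2 * INR (S n) / z * modulus2 (S n) z)) with
    (2 * z * cross (S n) z - 2 * INR (S n) * modulus2 (S n) z) by (field; lra). lra.
Qed.

(** * Signs below the transition point *)

(** For such orders the first term of the series dominates: phi_k >= 1/k! - s/(k+1)! while (z/2)
    phi_{k+1} <= (z/2)/(k+1)!. *)
Lemma besselJ_decreasing_large (k : nat) (z : R) :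
  0 < z -> (z / 2) ^ 2 + z / 2 < INR (S k) ->
  0 < besselJ_nat k z /\ besselJ_nat (S k) z < besselJ_nat k z.
Proof.
  intros Hz Hk. set (h := z / 2) in *. set (s := h ^ 2) in *.
  assert (Hh : 0 < h) by (unfold h; lra).
  assert (Hs : 0 <= s) by apply pow2_ge_0.
  assert (Hlow : phi k 0 - s / INR (fact (S k)) <= phi k s).
  { pose proof (fact_ge_1 (S k)).
    assert (H0 : phi k 0 + 0 / INR (fact (S k)) <= phi k s + s / INR (fact (S k))); [|unfold Rdiv in *; lra].
    apply (is_derive_nondecreasing (fun x => phi k x + x / INR (fact (S k)))
      (fun x => - phi (S k) x + / INR (fact (S k)))); [exact Hs | |].
    - intros x _. apply (is_derive_plus (phi k) (fun x => x / INR (fact (S k)))).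
      + apply phi_is_derive.
      + generalize (INR (fact (S k))). intros c. auto_derive; [exact I | unfold Rdiv; ring].
    - intros x Hx. pose proof (phi_bound (S k) x (proj1 Hx)) as H1.
      apply Rabs_le_between in H1. lra. }
  rewrite phi_0 in Hlow.
  pose proof (phi_bound (S k) s Hs) as Hup. apply Rabs_le_between in Hup.
  rewrite !besselJ_phi. fold h. fold s. rewrite <- tech_pow_Rmult.
  assert (Hp : 0 < h ^ k) by (apply pow_lt, Hh).
  rewrite (fact_simpl k), mult_INR in *.
  pose proof (fact_ge_1 k) as Hf. set (F := INR (fact k)) in *. set (N := INR (S k)) in *.
  assert (HN : 0 < N) by lra.
  assert (E : / F - s / (N * F) - h * / (N * F) = (N - s - h) * / (N * F)) by (field; lra).
  assert (Hi : 0 < / (N * F)) by (apply Rinv_0_lt_compat; nra).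
  assert (0 < (N - s - h) * / (N * F)) by (apply Rmult_lt_0_compat; lra).
  assert (h * phi (S k) s <= h * / (N * F)) by (apply Rmult_le_compat_l; lra).
  assert (0 <= h * / (N * F)) by nra.
  assert (0 < phi k s - h * phi (S k) s) by lra.
  split; [apply Rmult_lt_0_compat; lra | nra].
Qed.

(** Descend from large orders: when k + 1 >= z, the recurrence gives J_k >= 2 J_{k+1} - J_{k+2} >
    J_{k+1}. *)
Lemma besselJ_decreasing (k : nat) (z : R) :
  0 < z -> z <= INR (S k) -> 0 < besselJ_nat (S k) z < besselJ_nat k z.
Proof.
  intros Hz.
  destruct (INR_unbounded ((z / 2) ^ 2 + z / 2)) as [K HK].
  assert (Hlarge : forall k, (K <= k)%nat -> 0 < besselJ_nat (S k) z < besselJ_nat k z).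
  { intros j Hj. apply le_INR in Hj.
    split; apply besselJ_decreasing_large; rewrite ?S_INR; lra. }
  assert (Hdesc : forall d k, (K <= d + k)%nat -> z <= INR (S k) ->
    0 < besselJ_nat (S k) z < besselJ_nat k z).
  { induction d as [|d IH]; intros j Hj Hzj; [apply Hlarge, Hj|].
    destruct (IH (S j)) as [H1 H2]; [lia | rewrite S_INR; lra|].
    pose proof (besselJ_rec j z Hz) as HR. split; [lra|].
    assert (1 <= INR (S j) / z) by (apply Rle_div_r; lra).
    replace (2 * INR (S j) / z) with (2 * (INR (S j) / z)) in HR by (unfold Rdiv; ring). nra. }
  apply (Hdesc K). lia.
Qed.

Lemma besselY_nonzero (n : nat) (z : R) :
  0 < z -> z <= INR (S n) -> besselY_nat (S n) z <> 0.
Proof.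
  intros Hz Hn E. pose proof (cross_increasing n z Hz) as H. rewrite E, Rmult_0_l in H.
  pose proof (besselJ_decreasing n z Hz Hn).
  pose proof (besselJ_decreasing (S n) z Hz ltac:(rewrite S_INR; lra)). nra.
Qed.

Lemma schlaefli_improper_eq (n : nat) (z : R) :
  0 < z ->
  schlaefli_improper n z =
  improper (fun t => 1 * schlaefli_kernel (INR n) z t + (-1) ^ n * schlaefli_kernel (- INR n) z t).
Proof.
  intros Hz. rewrite improper_lin by (apply schlaefli_kernel_dominated, Hz).
  unfold schlaefli_improper, schlaefli_tail. ring.
Qed.

(** The smallest case is order 1, where the sign (-1)^n is worst; the recurrence at a = 0 evaluates
    it as 2/z - 2 [schlaefli_tail (-1) z], and that tail is at most 1. *)
Lemma schlaefli_improper_ge (n : nat) (z : R) :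
  0 < z -> 2 / z - 2 <= schlaefli_improper (S n) z.
Proof.
  intros Hz.
  assert (Hk : forall a, dominated (schlaefli_kernel a z)) by (intros; apply schlaefli_kernel_dominated, Hz).
  pose proof (schlaefli_tail_rec 0 z Hz) as Hr.
  rewrite Rplus_0_l in Hr. replace (0 - 1) with (-1) in Hr by ring.
  assert (H1 : schlaefli_tail (-1) z <= 1).
  { rewrite <- improper_exp_neg. apply improper_le; [apply Hk | apply exp_neg_dominated |].
    intros t Ht. unfold schlaefli_kernel. apply exp_monotone.
    pose proof (sinh_nonneg t Ht). nra. }
  apply Rle_trans with (schlaefli_tail 1 z - schlaefli_tail (-1) z); [lra|].
  rewrite schlaefli_improper_eq by exact Hz.
  replace (schlaefli_tail 1 z - schlaefli_tail (-1) z) with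
    (improper (fun t => 1 * schlaefli_kernel 1 z t + (-1) * schlaefli_kernel (-1) z t)).
  2:{ rewrite improper_lin by apply Hk. unfold schlaefli_tail. ring. }
  apply improper_le; [apply dominated_lin; apply Hk | apply dominated_lin; apply Hk |].
  intros t Ht.
  assert (HN : 1 <= INR (S n)) by (apply (le_INR 1); lia).
  assert (HNt : t <= INR (S n) * t) by nra.
  assert (E1 : schlaefli_kernel 1 z t <= schlaefli_kernel (INR (S n)) z t).
  { apply exp_monotone. lra. }
  assert (E2 : schlaefli_kernel (- INR (S n)) z t <= schlaefli_kernel (-1) z t).
  { apply exp_monotone. lra. }
  pose proof (schlaefli_kernel_pos (- INR (S n)) z t).
  pose proof (pow_1_abs (S n)) as Hp. pose proof (Rle_abs (- (-1) ^ S n)) as Hp'.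
  rewrite Rabs_Ropp, Hp in Hp'. nra.
Qed.

(** For z <= 1/4 the half-line integral is at least 8 - 2 = 6 and outweighs the finite one, bounded
    by pi <= 4. *)
Lemma besselY_neg_small (n : nat) (z : R) :
  0 < z -> z <= 1 / 4 -> besselY_nat (S n) z < 0.
Proof.
  intros Hz Hz4. pose proof PI_RGT_0 as HPI. pose proof PI_4.
  pose proof (schlaefli_Y (S n) z Hz) as E.
  pose proof (schlaefli_improper_ge n z Hz) as HI.
  assert (H2 : 8 <= 2 / z) by (apply (Rle_div_r 8 2 z Hz); lra).
  assert (HC : Rabs (schlaefli_cos (INR (S n)) (- (PI / 2)) z) <= (PI - 0) * 1).
  { apply RInt_abs_bound; [lra | apply schlaefli_cos_ex |].
    intros t _. apply Rabs_le, COS_bound. }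
  apply Rabs_le_between in HC.
  apply Rmult_lt_reg_l with PI; [exact HPI|]. lra.
Qed.

(** Y_n starts negative near 0 and has no zero in (0, n], so it cannot change sign there. *)
Lemma besselY_neg (n : nat) (z : R) : 0 < z -> z <= INR n -> besselY_nat n z < 0.
Proof.
  destruct n as [|n]; [simpl; lra|]. intros Hz Hn.
  destruct (Rle_dec z (1 / 4)) as [H|H]; [apply besselY_neg_small; assumption|].
  apply Rnot_le_lt. intros Hpos.
  destruct (IVT_interv (besselY_nat (S n)) (1 / 4) z) as [c [Hc Ec]].
  - intros c Hc. apply continuity_pt_filterlim.
    apply (ex_derive_continuous (besselY_nat (S n))). eexists. apply besselY_is_derive_up. lra.
  - lra.
  - apply besselY_neg_small; lra.
  - pose proof (besselY_nonzero n z Hz Hn). lra.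
  - apply (besselY_nonzero n c); lra.
Qed.

(** * J is at most -Y below the transition point *)

Lemma nonneg_of_derivative (f df : R -> R) (b : R) :
  0 <= f 0 -> (forall t, is_derive f t (df t)) ->
  (forall t, 0 <= t <= b -> 0 <= df t) -> forall t, 0 <= t <= b -> 0 <= f t.
Proof.
  intros H0 Hd Hp t Ht. apply Rle_trans with (1 := H0).
  apply (is_derive_nondecreasing f df); [lra | intros; apply Hd | intros; apply Hp; lra].
Qed.

Ltac derivative_step f df :=
  apply (nonneg_of_derivative f df); [| intros; auto_derive; [exact I | simpl; field] |].

Lemma cos_ge (t : R) : 0 <= t -> 1 - t ^ 2 / 2 <= cos t.
Proof.
  intros Ht. pose proof (cos_2a_sin (t / 2)) as E. replace (2 * (t / 2)) with t in E by field.
  assert (Rabs (sin (t / 2)) <= Rabs (t / 2)).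
  { destruct (MVT_gen sin 0 (t / 2) cos) as [c [_ Ec]].
    - intros. apply is_derive_sin.
    - intros. apply continuity_sin.
    - rewrite sin_0, !Rminus_0_r in Ec. rewrite Ec, Rabs_mult.
      assert (Rabs (cos c) <= 1) by (apply Rabs_le, COS_bound). pose proof (Rabs_pos (t / 2)). nra. }
  assert (sin (t / 2) ^ 2 <= (t / 2) ^ 2).
  { rewrite <- (pow2_abs (sin _)), <- (pow2_abs (t / 2)). apply pow_incr.
    split; [apply Rabs_pos | exact H]. }
  nra.
Qed.

Lemma sin_ge_cubic (b t : R) : 0 <= t <= b -> t - t ^ 3 / 6 <= sin t.
Proof.
  intros Ht. enough (0 <= sin t - t + t ^ 3 / 6) by lra.
  revert t Ht. derivative_step (fun t => sin t - t + t ^ 3 / 6) (fun t => cos t - 1 + t ^ 2 / 2).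
  - rewrite sin_0. lra.
  - intros t Ht. pose proof (cos_ge t (proj1 Ht)). lra.
Qed.

Lemma cos_le_quartic (b t : R) : 0 <= t <= b -> cos t <= 1 - t ^ 2 / 2 + t ^ 4 / 24.
Proof.
  intros Ht. enough (0 <= 1 - t ^ 2 / 2 + t ^ 4 / 24 - cos t) by lra.
  revert t Ht.
  derivative_step (fun t => 1 - t ^ 2 / 2 + t ^ 4 / 24 - cos t) (fun t => sin t - t + t ^ 3 / 6).
  - rewrite cos_0. lra.
  - intros t Ht. pose proof (sin_ge_cubic b t Ht). lra.
Qed.

Lemma sin_le_quintic (b t : R) : 0 <= t <= b -> sin t <= t - t ^ 3 / 6 + t ^ 5 / 120.
Proof.
  intros Ht. enough (0 <= t - t ^ 3 / 6 + t ^ 5 / 120 - sin t) by lra.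
  revert t Ht.
  derivative_step (fun t => t - t ^ 3 / 6 + t ^ 5 / 120 - sin t)
    (fun t => 1 - t ^ 2 / 2 + t ^ 4 / 24 - cos t).
  - rewrite sin_0. lra.
  - intros t Ht. pose proof (cos_le_quartic b t Ht). lra.
Qed.

(** The Taylor coefficients of sinh t + sin t - 2 t vanish below degree 5, and the fifth derivative
    cosh t + cos t is at most (E + 1)/2 + 1; dividing by 5! gives (E + 3)/240. *)
Lemma sinh_plus_sin_le (b E t : R) :
  exp b <= E -> 0 <= t <= b -> sinh t + sin t - 2 * t <= (E + 3) / 240 * t ^ 5.
Proof.
  intros HE Ht. set (c := (E + 3) / 240).
  enough (0 <= c * t ^ 5 - (exp t - exp (- t)) / 2 - sin t + 2 * t) by (unfold sinh; lra).
  revert t Ht.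
  derivative_step (fun t => c * t ^ 5 - (exp t - exp (- t)) / 2 - sin t + 2 * t)
    (fun t => 5 * c * t ^ 4 - (exp t + exp (- t)) / 2 - cos t + 2).
  { rewrite Ropp_0, exp_0, sin_0. lra. }
  derivative_step (fun t => 5 * c * t ^ 4 - (exp t + exp (- t)) / 2 - cos t + 2)
    (fun t => 20 * c * t ^ 3 - (exp t - exp (- t)) / 2 + sin t).
  { rewrite Ropp_0, exp_0, cos_0. lra. }
  derivative_step (fun t => 20 * c * t ^ 3 - (exp t - exp (- t)) / 2 + sin t)
    (fun t => 60 * c * t ^ 2 - (exp t + exp (- t)) / 2 + cos t).
  { rewrite Ropp_0, exp_0, sin_0. lra. }
  derivative_step (fun t => 60 * c * t ^ 2 - (exp t + exp (- t)) / 2 + cos t)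
    (fun t => 120 * c * t - (exp t - exp (- t)) / 2 - sin t).
  { rewrite Ropp_0, exp_0, cos_0. lra. }
  derivative_step (fun t => 120 * c * t - (exp t - exp (- t)) / 2 - sin t)
    (fun t => 120 * c - (exp t + exp (- t)) / 2 - cos t).
  { rewrite Ropp_0, exp_0, sin_0. lra. }
  intros t Ht. unfold c.
  assert (exp t <= exp b) by (apply exp_monotone; lra).
  assert (exp (- t) <= 1) by (rewrite <- exp_0; apply exp_monotone; lra).
  pose proof (COS_bound t). lra.
Qed.

(** After multiplication by exp(y) the difference of the two sides has derivative 2 (exp(y) sin y -
    y), which is nonnegative by (1 + y)(y - y^3/6) >= y. *)
Lemma cos_minus_sin_le (y : R) : 0 <= y <= 1 -> cos y - sin y <= exp (- y) * (1 - y ^ 2).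
Proof.
  intros Hy.
  enough (0 <= 1 - y ^ 2 - exp y * (cos y - sin y)).
  { pose proof (exp_pos (- y)). assert (exp y * exp (- y) = 1) by (rewrite <- exp_plus, Rplus_opp_r; apply exp_0).
    assert (H2 : 0 <= exp (- y) * (1 - y ^ 2 - exp y * (cos y - sin y))) by (apply Rmult_le_pos; lra).
    replace (exp (- y) * (1 - y ^ 2 - exp y * (cos y - sin y))) with
      (exp (- y) * (1 - y ^ 2) - exp y * exp (- y) * (cos y - sin y)) in H2 by ring.
    rewrite H1 in H2. lra. }
  revert y Hy.
  derivative_step (fun y => 1 - y ^ 2 - exp y * (cos y - sin y))
    (fun y => 2 * (exp y * sin y - y)).
  - rewrite exp_0, cos_0, sin_0. lra.
  - intros y Hy. pose proof (sin_ge_cubic 1 y Hy). pose proof (exp_ge_1_plus y).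
    assert (0 <= y - y ^ 3 / 6) by nra.
    assert ((1 + y) * (y - y ^ 3 / 6) <= exp y * sin y) by (apply Rmult_le_compat; lra).
    assert (0 <= y ^ 2 - y ^ 3 / 6 - y ^ 4 / 6); [|nra].
    replace (y ^ 2 - y ^ 3 / 6 - y ^ 4 / 6) with (y ^ 2 * (1 - y / 6 - y ^ 2 / 6)) by field.
    apply Rmult_le_pos; [apply pow2_ge_0 | nra].
Qed.

(* After multiplication by [exp y], [y = n (t - sin t)], the left side is at most [1 - y ^ 2] and the
   right side is [exp (- d) (1 + exp (- 2 n t))] with [d] of order [n t ^ 5]: the loss [d] is
   compensated by [y ^ 2] if [n t] is large and by [exp (- 2 n t)] otherwise. *)
Lemma transition_pointwise (n t : R) :
  2 <= n -> 0 <= t -> n * (t - sin t) <= 1 ->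
  cos (n * (t - sin t)) - sin (n * (t - sin t))
  <= exp (- (n * sinh t)) * (exp (n * t) + exp (- (n * t))).
Proof.
  intros Hn Ht Hy. set (y := n * (t - sin t)) in *.
  pose proof (SIN_bound t) as Hsb.
  assert (Hts : 0 <= t - sin t).
  { destruct (MVT_gen sin 0 t cos) as [c [_ Ec]].
    - intros. apply is_derive_sin.
    - intros. apply continuity_sin.
    - rewrite sin_0, !Rminus_0_r in Ec. rewrite Ec. pose proof (COS_bound c). nra. }
  (* From 2 (t - 1) <= n (t - sin t) <= 1. *)
  assert (Ht15 : t <= 3 / 2) by (unfold y in Hy; nra).
  assert (Hy0 : 0 <= y) by (unfold y; nra).
  set (d := n * (sinh t + sin t - 2 * t)).
  assert (E : exp (- (n * sinh t)) * (exp (n * t) + exp (- (n * t)))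
     = exp (- y) * (exp (- d) * (1 + exp (- (2 * (n * t)))))).
  { rewrite Rmult_plus_distr_l, <- !exp_plus.
    rewrite (Rmult_plus_distr_l (exp (- d))), Rmult_1_r, <- exp_plus, Rmult_plus_distr_l, <- !exp_plus.
    f_equal; f_equal; unfold y, d; ring. }
  rewrite E. eapply Rle_trans; [apply cos_minus_sin_le; lra|].
  apply Rmult_le_compat_l; [left; apply exp_pos|].
  pose proof (exp_ge_1_plus (- d)) as Hd. pose proof (exp_pos (- d)) as Hd0.
  pose proof (exp_pos (- (2 * (n * t)))) as He0.
  pose proof (sin_le_quintic (3 / 2) t (conj Ht Ht15)) as Hs5.
  (* The constant 1/7 leaves 1/6 - 1/7 = 1/42 to cover t^2/120 up to t = 3/2. *)
  assert (Ht3 : t ^ 3 / 7 <= t - sin t).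
  { assert (0 <= t ^ 3 * (1 / 6 - 1 / 7 - t ^ 2 / 120)).
    { apply Rmult_le_pos; [apply pow_le, Ht | nra]. }
    lra. }
  assert (Hyl : n * (t ^ 3 / 7) <= y) by (unfold y; apply Rmult_le_compat_l; lra).
  assert (Hy2 : (n * (t ^ 3 / 7)) ^ 2 <= y ^ 2).
  { apply pow_incr. split; [|exact Hyl]. apply Rmult_le_pos; [lra|].
    apply Rdiv_le_0_compat; [apply pow_le, Ht | lra]. }
  assert (Ht5 : 0 <= t ^ 5) by (apply pow_le, Ht).
  (* The 49 is the square of 7: y^2 >= n^2 t^6 / 49 exceeds d as soon as k <= n t / 49. *)
  assert (Hcase : forall k, d <= n * (k * t ^ 5) -> k <= n * t / 49 -> 1 - y ^ 2 <= exp (- d) * (1 + exp (- (2 * (n * t))))).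
  { intros k Hk1 Hk2.
    assert (n * (k * t ^ 5) <= (n * (t ^ 3 / 7)) ^ 2).
    { replace ((n * (t ^ 3 / 7)) ^ 2) with (n * ((n * t / 49) * t ^ 5)) by field.
      apply Rmult_le_compat_l; [lra|]. apply Rmult_le_compat_r; lra. }
    nra. }
  destruct (Rle_dec 1 t) as [H1|H1].
  (* Here exp(3/2) <= 26/5, because e^3 <= 27 < (26/5)^2, and n t >= 2. *)
  - apply (Hcase ((26 / 5 + 3) / 240)); [|nra].
    unfold d. apply Rmult_le_compat_l; [lra|].
    apply (sinh_plus_sin_le (3 / 2)); [|lra].
    pose proof exp_le_3. pose proof (exp_pos 1). pose proof (exp_pos (3 / 2)).
    assert (exp (3 / 2) * exp (3 / 2) = exp 1 * exp 1 * exp 1) by (rewrite <- !exp_plus; f_equal; field).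
    assert (exp 1 * exp 1 <= 9) by nra. nra.
  - assert (Hd1 : d <= n * ((3 + 3) / 240 * t ^ 5)).
    { unfold d. apply Rmult_le_compat_l; [lra|].
      apply (sinh_plus_sin_le 1); [apply exp_le_3 | lra]. }
    destruct (Rle_dec (5 / 4) (n * t)) as [H2|H2].
    + apply (Hcase ((3 + 3) / 240)); [exact Hd1 | lra].
    + assert (Ht58 : t <= 5 / 8) by nra.
      assert (Ht4 : t ^ 4 <= 1 / 6).
      { replace (t ^ 4) with ((t ^ 2) ^ 2) by ring.
        assert (0 <= t ^ 2 <= 2 / 5) by nra. nra. }
      assert (Hd2 : d <= 1 / 100).
      { apply Rle_trans with (1 := Hd1).
        replace (n * ((3 + 3) / 240 * t ^ 5)) with ((n * t) * t ^ 4 / 40) by field.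
        assert (0 <= t ^ 4) by (apply pow_le, Ht). assert (0 <= n * t) by nra. nra. }
      assert (He1 : 1 / 27 <= exp (- (2 * (n * t)))).
      { apply Rle_trans with (exp (- (1 + 1 + 1))); [|apply exp_monotone; lra].
        rewrite exp_Ropp. replace (1 / 27) with (/ 27) by field.
        apply Rinv_le_contravar; [apply exp_pos|].
        rewrite !exp_plus.
        pose proof exp_le_3. pose proof (exp_pos 1). assert (exp 1 * exp 1 <= 9) by nra. nra. }
      pose proof (pow2_ge_0 y). nra.
Qed.

Lemma improper_ge_RInt (f : R -> R) (U : R) :
  dominated f -> 0 <= U -> (forall t, U <= t -> 0 <= f t) -> RInt f 0 U <= improper f.
Proof.
  intros Hf HU H.
  assert (Hx : forall a b, ex_RInt f a b) by (intros; apply dominated_ex_RInt, Hf).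
  destruct (INR_unbounded U) as [N HN].
  apply (is_lim_seq_le_loc (fun _ => RInt f 0 U) (fun n => RInt f 0 (INR n)) (RInt f 0 U) (improper f));
    [| apply is_lim_seq_const | apply improper_correct, Hf].
  exists N. intros n Hn. apply le_INR in Hn.
  rewrite <- (RInt_Chasles (V := R_CompleteNormedModule) f 0 U (INR n)) by apply Hx.
  change plus with Rplus.
  assert (0 <= RInt f U (INR n)); [|lra].
  apply RInt_ge_0; [lra | apply Hx |]. intros t Ht. apply H. lra.
Qed.

Lemma sin_plus_cos_le (x : R) : sin x + cos x <= sqrt 2.
Proof.
  apply Rle_trans with (Rabs (sin x + cos x)); [apply Rle_abs|].
  rewrite <- sqrt_Rsqr_abs. apply sqrt_le_1_alt.
  pose proof (sin2_cos2 x) as H. unfold Rsqr in *.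
  pose proof (pow2_ge_0 (sin x - cos x)). nra.
Qed.

(* Past the point where the phase [n t - z sin t] reaches [PI/4], compare with the derivative of
   [(sin + cos - sqrt 2) (phase) / phase'], which is negative there and vanishes at that point. *)
Lemma oscillating_tail (n : nat) (z t1 : R) :
  0 < z -> z <= INR n -> 0 < t1 < PI -> INR n * t1 - z * sin t1 = PI / 4 ->
  RInt (fun t => cos (INR n * t - z * sin t) - sin (INR n * t - z * sin t)) t1 PI <= 0.
Proof.
  intros Hz Hn Ht1 E1.
  set (ph := fun t => INR n * t - z * sin t) in *.
  set (K := fun t => (sin (ph t) + cos (ph t) - sqrt 2) / (INR n - z * cos t)).
  set (g := fun t => (cos (ph t) - sin (ph t))
      - (sin (ph t) + cos (ph t) - sqrt 2) * (z * sin t) / (INR n - z * cos t) ^ 2).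
  assert (Hd : forall t, t1 <= t <= PI -> 0 < INR n - z * cos t).
  { intros t Ht. assert (cos t < 1).
    { rewrite <- cos_0. apply cos_decreasing_1; lra. }
    nra. }
  assert (HK : is_RInt g t1 PI (K PI - K t1)).
  { apply RInt_antiderivative_on; [lra | |].
    - intros t Ht. specialize (Hd t Ht). unfold K, g, ph. auto_derive; [lra|].
      change (INR n * t + - (z * sin t)) with (INR n * t - z * sin t). field. lra.
    - intros t Ht. specialize (Hd t Ht). apply (ex_derive_continuous g). unfold g, ph.
      auto_derive. apply Rgt_not_eq.
      repeat apply Rmult_lt_0_compat; lra. }
  assert (Hf : ex_RInt (fun t => cos (ph t) - sin (ph t)) t1 PI).
  { apply ex_derive_ex_RInt. intros t. unfold ph. auto_derive. exact I. }
  apply Rle_trans with (K PI - K t1).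
  - rewrite <- (is_RInt_unique (V := R_CompleteNormedModule) _ _ _ _ HK).
    apply RInt_le; [lra | exact Hf | eexists; exact HK |].
    intros t Ht. unfold g. specialize (Hd t ltac:(lra)).
    assert (0 <= (sqrt 2 - (sin (ph t) + cos (ph t))) * (z * sin t) / (INR n - z * cos t) ^ 2).
    { apply Rdiv_le_0_compat; [|apply pow_lt, Hd].
      pose proof (sin_plus_cos_le (ph t)).
      apply Rmult_le_pos; [lra|]. apply Rmult_le_pos; [lra | apply sin_ge_0; lra]. }
    replace ((sqrt 2 - (sin (ph t) + cos (ph t))) * (z * sin t) / (INR n - z * cos t) ^ 2)
      with (- ((sin (ph t) + cos (ph t) - sqrt 2) * (z * sin t) / (INR n - z * cos t) ^ 2)) in H
      by (field; lra).
    fold (ph t). lra.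
  - assert (EK : K t1 = 0).
    { unfold K, ph. rewrite E1, sin_PI4, cos_PI4.
      replace (1 / sqrt 2 + 1 / sqrt 2 - sqrt 2) with 0; [unfold Rdiv; ring|].
      assert (0 < sqrt 2) by (apply sqrt_lt_R0; lra).
      apply Rmult_eq_reg_r with (sqrt 2); [|lra]. field_simplify; [|lra].
      rewrite pow2_sqrt; lra. }
    rewrite EK. unfold K, Rminus at 1. rewrite Ropp_0, Rplus_0_r.
    pose proof (sin_plus_cos_le (ph PI)). specialize (Hd PI ltac:(lra)).
    apply Rle_div_l; [exact Hd|]. lra.
Qed.

(** By Schlaefli, pi (J_n + Y_n) is the integral of cos - sin of the phase n t - z sin t, minus the
    half-line integral of T. Up to the point [t1] the integrands compare pointwise; beyond it the
    oscillating part has nonpositive integral. Even order is essential to the comparison: for odd n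
    the function T vanishes at t = 0, where the other integrand is 1. *)
Lemma bessel_sum_nonpos_even (k : nat) (z : R) :
  (1 <= k)%nat -> 0 < z -> z <= INR (2 * k) ->
  besselJ_nat (2 * k) z + besselY_nat (2 * k) z <= 0.
Proof.
  intros Hk Hz Hn. pose proof PI_RGT_0 as HPI.
  set (n := (2 * k)%nat) in *.
  assert (Hn2 : 2 <= INR n) by (apply (le_INR 2); lia).
  pose proof (schlaefli_J n z Hz) as EJ. pose proof (schlaefli_Y n z Hz) as EY.
  rewrite schlaefli_improper_eq in EY by exact Hz.
  set (T := fun t => 1 * schlaefli_kernel (INR n) z t + (-1) ^ n * schlaefli_kernel (- INR n) z t) in *.
  assert (HT : dominated T) by (apply dominated_lin; apply schlaefli_kernel_dominated, Hz).
  assert (Hsign : (-1) ^ n = 1) by (unfold n; rewrite pow_mult; replace ((-1) ^ 2) with 1 by ring; apply pow1).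
  assert (HTE : forall t, T t = exp (- (z * sinh t)) * (exp (INR n * t) + exp (- (INR n * t)))).
  { intros t. unfold T, schlaefli_kernel. rewrite Hsign, Rmult_plus_distr_l, <- !exp_plus, !Rmult_1_l.
    f_equal; f_equal; ring. }
  set (f := fun t => cos (INR n * t - z * sin t) - sin (INR n * t - z * sin t)).
  assert (Hxf : forall a b, ex_RInt f a b).
  { intros a b. apply ex_derive_ex_RInt. intros t. unfold f. auto_derive. exact I. }
  assert (Ef : schlaefli_cos (INR n) 0 z - schlaefli_cos (INR n) (- (PI / 2)) z = RInt f 0 PI).
  { transitivity (RInt (fun t => 1 * cos (INR n * t - z * sin t + 0)
       + (-1) * cos (INR n * t - z * sin t + - (PI / 2))) 0 PI).
    - rewrite RInt_lin by apply schlaefli_cos_ex. unfold schlaefli_cos. as_Req. ring.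
    - apply RInt_ext. intros t _. unfold f. as_Req.
      rewrite Rplus_0_r, (cos_plus _ (- (PI / 2))), cos_neg, sin_neg, cos_PI2, sin_PI2. ring. }
  (* The phase pi/4 is where cos - sin changes sign. *)
  destruct (IVT_interv (fun t => INR n * t - z * sin t - PI / 4) 0 PI) as [t1 [Ht1 E1]].
  { intros t _. apply continuity_pt_filterlim.
    apply (ex_derive_continuous (fun t => INR n * t - z * sin t - PI / 4)). auto_derive. exact I. }
  { exact HPI. }
  { rewrite sin_0. lra. }
  { rewrite sin_PI. nra. }
  assert (E1' : INR n * t1 - z * sin t1 = PI / 4) by lra.
  assert (Ht1' : 0 < t1 < PI).
  { split; apply Rnot_le_lt; intros Hc.
    - assert (t1 = 0) as -> by lra. rewrite sin_0 in E1'. lra.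
    - assert (t1 = PI) as -> by lra. rewrite sin_PI in E1'. nra. }
  assert (Hph : forall t, 0 <= t <= t1 -> INR n * t - z * sin t <= PI / 4).
  { intros t Ht. rewrite <- E1'.
    apply (is_derive_nondecreasing (fun t => INR n * t - z * sin t) (fun t => INR n - z * cos t)).
    - lra.
    - intros x _. auto_derive; [exact I | ring].
    - intros x _. pose proof (COS_bound x). nra. }
  assert (H1 : RInt f 0 t1 <= RInt T 0 t1).
  { apply RInt_le; [lra | apply Hxf | apply dominated_ex_RInt, HT |].
    intros t Ht. rewrite HTE. unfold f.
    specialize (Hph t ltac:(lra)).
    assert (Hs : 0 <= sin t) by (apply sin_ge_0; lra).
    pose proof PI_4 as HPI4.
    (* Replacing z by n lowers the phase, hence raises cos - sin on [0, pi/4], and lowers the factor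
       exp(- z sinh t); so z = n is the extreme case. *)
    set (y := INR n * t - z * sin t) in *. set (y0 := INR n * (t - sin t)).
    assert (Hyy : y0 <= y) by (unfold y0, y; nra).
    assert (Hts : sin t <= t) by (left; apply sin_lt_x; lra).
    assert (Hy0 : 0 <= y0) by (unfold y0; apply Rmult_le_pos; lra).
    apply Rle_trans with (cos y0 - sin y0).
    - assert (cos y <= cos y0) by (apply cos_decr_1; lra).
      assert (sin y0 <= sin y) by (apply sin_incr_1; lra). lra.
    - eapply Rle_trans; [apply transition_pointwise; unfold y0 in *; lra|].
      apply Rmult_le_compat_r; [pose proof (exp_pos (INR n * t)); pose proof (exp_pos (- (INR n * t))); lra|].
      apply exp_monotone. pose proof (sinh_nonneg t ltac:(lra)). nra. }
  assert (H2 : RInt T 0 t1 <= improper T).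
  { apply improper_ge_RInt; [exact HT | lra |]. intros t _. rewrite HTE.
    apply Rmult_le_pos; [left; apply exp_pos|].
    pose proof (exp_pos (INR n * t)); pose proof (exp_pos (- (INR n * t))); lra. }
  pose proof (oscillating_tail n z t1 Hz Hn Ht1' E1') as H3. fold f in H3.
  assert (Hch : RInt f 0 PI = RInt f 0 t1 + RInt f t1 PI).
  { symmetry. apply (RInt_Chasles (V := R_CompleteNormedModule)); apply Hxf. }
  apply Rmult_le_reg_l with PI; [exact HPI|]. lra.
Qed.

(* By the Wronskian, [J_n / (- Y_n)] decreases with [n]. *)
Lemma bessel_sum_nonpos_step (n : nat) (z : R) :
  0 < z -> z <= INR n ->
  besselJ_nat n z + besselY_nat n z <= 0 -> besselJ_nat (S n) z + besselY_nat (S n) z <= 0.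
Proof.
  intros Hz Hn H. assert (Hn' : z <= INR (S n)) by (rewrite S_INR; lra).
  pose proof (besselY_neg n z Hz Hn). pose proof (besselY_neg (S n) z Hz Hn').
  pose proof (besselJ_decreasing n z Hz Hn') as HJ.
  pose proof (bessel_wronskian n z Hz) as HW. pose proof PI_RGT_0.
  assert (0 < 2 / (PI * z)) by (apply Rdiv_lt_0_compat; [lra | apply Rmult_lt_0_compat; lra]).
  apply Rnot_lt_le. intros Hlt. nra.
Qed.

(** The induction must start at an even order at least z; when q is odd this is q + 1, which is why
    n = q is excluded. *)
Lemma bessel_sum_nonpos (q n : nat) (z : R) :
  (1 <= q)%nat -> 0 < z -> z <= INR q -> (q < n)%nat ->
  besselJ_nat n z + besselY_nat n z <= 0.
Proof.
  intros Hq Hz Hzq.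
  assert (Hbase : besselJ_nat (S q) z + besselY_nat (S q) z <= 0).
  { destruct (Nat.Even_or_Odd q) as [[k ->]|[k ->]].
    - apply bessel_sum_nonpos_step; [exact Hz | exact Hzq |].
      apply bessel_sum_nonpos_even; [lia | exact Hz | exact Hzq].
    - replace (S (2 * k + 1)) with (2 * (k + 1))%nat by lia.
      apply bessel_sum_nonpos_even; [lia | exact Hz |].
      apply Rle_trans with (1 := Hzq). apply le_INR. lia. }
  induction n as [|n IH]; intros Hn; [lia|].
  destruct (Nat.eq_dec n q) as [->|Hne]; [exact Hbase|].
  apply bessel_sum_nonpos_step; [exact Hz | | apply IH; lia].
  apply Rle_trans with (1 := Hzq). apply le_INR. lia.
Qed.

(** * The remainder of Graf's series *)

Lemma CSeries_bound (u : nat -> C) (b : nat -> R) (S0 : R) :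
  (forall k, Cmod (u k) <= b k) -> is_series b S0 ->
  @ex_series C_AbsRing C_NormedModule u /\ Cmod (CSeries u) <= S0.
Proof.
  intros H Hb.
  assert (He : @ex_series C_AbsRing C_NormedModule u).
  { apply (@ex_series_le C_AbsRing C_CompleteNormedModule u b H). exists S0. exact Hb. }
  split; [exact He|]. destruct He as [l Hl]. rewrite (CSeries_unique u l Hl).
  assert (Hn : is_lim_seq (fun n => Cmod (@sum_n C_AbelianMonoid u n)) (Cmod l)).
  { apply (filterlim_comp _ _ _ _ _ _ _ _ Hl).
    apply (@filterlim_norm C_AbsRing C_NormedModule l). }
  apply (is_lim_seq_le (fun n => Cmod (@sum_n C_AbelianMonoid u n)) (fun n => sum_n b n) (Cmod l) S0);
    [| exact Hn | exact Hb].
  intros n. induction n as [|n IH]; [rewrite !sum_O; apply H|].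
  rewrite !sum_Sn. eapply Rle_trans; [apply Cmod_triangle|].
  change (@plus R_AbelianMonoid) with Rplus. specialize (H (S n)). lra.
Qed.

Lemma besselY_of_nat (n : nat) (z : R) : besselY (Z.of_nat n) z = besselY_nat n z.
Proof.
  unfold besselY. rewrite Zabs2Nat.id.
  destruct (Z.ltb_spec (Z.of_nat n) 0); [lia | reflexivity].
Qed.

Lemma besselJ_abs (n : Z) (z : R) : Rabs (besselJ n z) = Rabs (besselJ_nat (Z.abs_nat n) z).
Proof.
  unfold besselJ. destruct (n <? 0)%Z; [|reflexivity].
  rewrite Rabs_mult, pow_1_abs. apply Rmult_1_l.
Qed.

Lemma besselY_abs (n : Z) (z : R) : Rabs (besselY n z) = Rabs (besselY_nat (Z.abs_nat n) z).
Proof.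
  unfold besselY. destruct (n <? 0)%Z; [|reflexivity].
  rewrite Rabs_mult, pow_1_abs. apply Rmult_1_l.
Qed.

Lemma Cmod_hankel1 (n : Z) (z : R) : Cmod (hankel1 n z) = sqrt (modulus2 (Z.abs_nat n) z).
Proof.
  unfold Cmod, hankel1, modulus2. simpl fst. simpl snd.
  rewrite <- (pow2_abs (besselJ n z)), <- (pow2_abs (besselY n z)), besselJ_abs, besselY_abs, !pow2_abs.
  reflexivity.
Qed.

Lemma Cmod_cis (t : R) : Cmod (cis t) = 1.
Proof.
  unfold Cmod, cis. simpl fst. simpl snd. rewrite <- sqrt_1. f_equal.
  pose proof (sin2_cos2 t) as H. unfold Rsqr in H. simpl. lra.
Qed.

Lemma Cmod_graf_term (upper : bool) (m : Z) (x y : R * R) (n : Z) :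
  Cmod (graf_term upper m x y n)
  = sqrt (modulus2 (Z.abs_nat (m + n)) (enorm x)) * Rabs (besselJ_nat (Z.abs_nat n) (enorm y)).
Proof.
  unfold graf_term. rewrite !Cmod_mult, !Cmod_cis, Cmod_hankel1, Cmod_R, besselJ_abs. ring.
Qed.

Lemma hankel_modulus_bound (q n j : nat) (z : R) :
  (1 <= q)%nat -> 0 < z -> z <= INR q -> (q < n)%nat -> (exists k, n = j + 2 * k)%nat ->
  sqrt (modulus2 j z) <= sqrt 2 * - besselY_nat n z.
Proof.
  intros Hq Hz Hzq Hn [k Hk].
  assert (Hzn : z <= INR n) by (apply Rle_trans with (1 := Hzq), le_INR; lia).
  pose proof (besselY_neg n z Hz Hzn) as HY.
  pose proof (bessel_sum_nonpos q n z Hq Hz Hzq Hn) as HS.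
  destruct n as [|n]; [lia|].
  pose proof (besselJ_decreasing n z Hz Hzn) as HJ.
  rewrite <- (sqrt_pow2 (- besselY_nat (S n) z)) by lra.
  rewrite <- sqrt_mult by (try apply pow2_ge_0; lra).
  apply sqrt_le_1_alt.
  apply Rle_trans with (modulus2 (S n) z).
  - rewrite Hk. apply modulus2_monotone, Hz.
  - unfold modulus2. nra.
Qed.

Lemma Cfun_S (n : nat) (z : R) :
  Cfun (S n) z = - besselY_nat (S n) z * (z / 2) ^ S n * (PI / INR (fact n)).
Proof. unfold Cfun. rewrite besselY_of_nat, Gamma_INR_S. reflexivity. Qed.

(** Dropping Y_n < 0 from the recurrence gives - Y_{n+2} <= (2(n+1)/z) (- Y_{n+1}), and the extra
    factor (z/2)/(n+1) in C_{n+2} cancels that coefficient. *)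
Lemma Cfun_decreasing (n : nat) (z : R) :
  0 < z -> z <= INR n -> Cfun (S (S n)) z <= Cfun (S n) z.
Proof.
  intros Hz Hn. rewrite !Cfun_S, (fact_simpl n), mult_INR, <- (tech_pow_Rmult (z / 2) (S n)).
  pose proof (besselY_neg n z Hz Hn) as HY. pose proof (besselY_rec n z Hz) as HR.
  pose proof PI_RGT_0 as HPI. pose proof (fact_ge_1 n) as Hf.
  assert (HN : 0 < INR (S n)) by (apply lt_0_INR; lia).
  assert (Hp : 0 < (z / 2) ^ S n) by (apply pow_lt; lra).
  replace (- besselY_nat (S n) z * (z / 2) ^ S n * (PI / INR (fact n))) with
    ((2 * INR (S n) / z * - besselY_nat (S n) z) * (z / 2 * (z / 2) ^ S n) * (PI / (INR (S n) * INR (fact n))))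
    by (field; repeat split; lra).
  assert (0 < PI / (INR (S n) * INR (fact n))).
  { apply Rdiv_lt_0_compat; [exact HPI | apply Rmult_lt_0_compat; lra]. }
  apply Rmult_le_compat_r; [lra|]. apply Rmult_le_compat_r; [nra | lra].
Qed.

Lemma Cfun_le (q k : nat) (z : R) :
  0 < z -> z <= INR q -> Cfun (S (q + k)) z <= Cfun (S q) z.
Proof.
  intros Hz Hq. induction k as [|k IH]; [rewrite Nat.add_0_r; lra|].
  rewrite Nat.add_succ_r. apply Rle_trans with (2 := IH), Cfun_decreasing; [exact Hz|].
  apply Rle_trans with (1 := Hq), le_INR. lia.
Qed.

(* AM-GM: [(k + m)! / (k + 1)!] is a product of [m - 1] factors symmetric about [k + 1 + m / 2]. *)
Lemma fact_ratio_le (m k : nat) :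
  INR (fact (k + m)) * (INR (S k) + INR m / 2) <= INR (fact (S k)) * (INR (S k) + INR m / 2) ^ m.
Proof.
  revert k. induction m as [| |m IH _] using two_step_ind; intros k.
  - rewrite Nat.add_0_r, fact_simpl, mult_INR. simpl (INR 0). simpl pow. lra.
  - rewrite Nat.add_1_r, pow_1. lra.
  - specialize (IH (S k)).
    replace (INR (S (S k)) + INR m / 2) with (INR (S k) + INR (S (S m)) / 2) in IH
      by (rewrite !S_INR; field).
    set (c := INR (S k) + INR (S (S m)) / 2) in *.
    replace (k + S (S m))%nat with (S (S k + m)) by lia.
    rewrite (fact_simpl (S k + m)), mult_INR.
    rewrite (fact_simpl (S k)), mult_INR in IH.
    pose proof (pos_INR m). pose proof (pos_INR k). pose proof (fact_ge_1 (S k)).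
    assert (Hc : 0 < c) by (unfold c; rewrite !S_INR; lra).
    assert (Hcm : 0 < c ^ m) by (apply pow_lt, Hc).
    assert (Hprod : INR (S (S k + m)) * INR (S (S k)) <= c * c).
    { unfold c. rewrite !S_INR, plus_INR, !S_INR. nra. }
    assert (0 <= INR (S (S k + m))) by apply pos_INR.
    rewrite <- !tech_pow_Rmult.
    apply Rle_trans with (INR (S (S k + m)) * (INR (S (S k)) * INR (fact (S k)) * c ^ m)).
    + rewrite Rmult_assoc. apply Rmult_le_compat_l; assumption.
    + replace (INR (S (S k + m)) * (INR (S (S k)) * INR (fact (S k)) * c ^ m)) with
        ((INR (S (S k + m)) * INR (S (S k))) * (INR (fact (S k)) * c ^ m)) by ring.
      replace (INR (fact (S k)) * (c * (c * c ^ m))) with ((c * c) * (INR (fact (S k)) * c ^ m)) by ring.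
      apply Rmult_le_compat_r; [nra | exact Hprod].
Qed.

(** Through 1 + t/a <= exp(t/a), polynomial growth in t becomes exponential, so that the tail stays
    geometric. *)
Lemma shifted_power_le (a t : R) (m : nat) :
  0 < a -> 0 <= t -> (a + t) ^ m / (a + t) <= a ^ m / a * exp (INR m * t / a).
Proof.
  intros Ha Ht.
  replace (INR m * t / a) with (INR m * (t / a)) by (unfold Rdiv; ring). rewrite <- exp_pow.
  assert (Hta : 0 <= t / a) by (apply Rdiv_le_0_compat; lra).
  apply Rle_trans with ((a + t) ^ m / a).
  - apply Rmult_le_compat_l; [apply pow_le; lra | apply Rinv_le_contravar; lra].
  - unfold Rdiv at 1 2. rewrite Rmult_assoc, (Rmult_comm (/ a)), <- Rmult_assoc.
    apply Rmult_le_compat_r; [left; apply Rinv_0_lt_compat, Ha|].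
    rewrite <- Rpow_mult_distr. apply pow_incr. split; [lra|].
    pose proof (exp_ge_1_plus (t / a)).
    apply Rle_trans with (a * (1 + t / a)); [right; field; lra | apply Rmult_le_compat_l; lra].
Qed.

(** The sum is D / (exp(l) - 1), and exp(l) - 1 >= l. *)
Lemma geometric_tail (D l : R) :
  0 <= D -> 0 < l ->
  exists s, is_series (fun k => D * exp (- l) ^ S k) s /\ s <= D / l.
Proof.
  intros HD Hl. set (q := exp (- l)).
  assert (Hq : 0 < q < 1).
  { split; [apply exp_pos|]. unfold q. rewrite <- exp_0. apply exp_increasing. lra. }
  exists (D * q * / (1 - q)). split.
  - apply is_series_ext with (fun k => scal (D * q) (q ^ k)).
    { intros k. change scal with Rmult. simpl. as_Req. ring. }
    apply (is_series_scal (V := R_NormedModule) (D * q)). apply is_series_geom.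
    rewrite Rabs_pos_eq; lra.
  - pose proof (exp_ge_1_plus l) as H.
    assert (Hqe : q * exp l = 1) by (unfold q; rewrite <- exp_plus, Rplus_opp_l; apply exp_0).
    assert (Hlq : l * q <= 1 - q) by nra.
    unfold Rdiv. rewrite Rmult_assoc. apply Rmult_le_compat_l; [exact HD|].
    apply Rmult_le_reg_r with ((1 - q) * l); [apply Rmult_lt_0_compat; lra|].
    field_simplify; lra.
Qed.

(** Both tails are treated at once, since only |n| = p + 1 + k enters. Rewriting - Y_{N+1} through
    C_{N+1} produces N!, which meets the factorial (p + k + 1)! from the bound on J. *)
Lemma graf_term_bound (upper : bool) (m p k : nat) (n : Z) (x y : R * R) :
  0 < enorm y < enorm x -> (1 <= p + m)%nat -> enorm x <= INR (p + m) ->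
  Z.abs_nat n = (p + 1 + k)%nat ->
  Cmod (graf_term upper (Z.of_nat m) x y n) <=
    sqrt 2 * Cfun (p + m + 1) (enorm x) / PI * (2 / enorm x) ^ m
    * ((enorm y / enorm x) ^ (p + S k)
       * ((INR p + INR m / 2 + INR (S k)) ^ m / (INR p + INR m / 2 + INR (S k)))).
Proof.
  intros Hxy Hpm Hx Hn. set (z := enorm x) in *. set (rho := enorm y) in *.
  assert (Hz : 0 < z) by lra. pose proof PI_RGT_0 as HPI.
  assert (Hs2 : 0 < sqrt 2) by (apply sqrt_lt_R0; lra).
  set (N := (p + k + m)%nat).
  rewrite Cmod_graf_term. fold z rho.
  assert (H1 : sqrt (modulus2 (Z.abs_nat (Z.of_nat m + n)) z) <= sqrt 2 * - besselY_nat (S N) z).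
  { apply (hankel_modulus_bound (p + m)); [exact Hpm | exact Hz | exact Hx | unfold N; lia |].
    (* The order |m + n| is N + 1 for positive n; otherwise it falls short of N + 1 by twice the
       smaller of m and |n|. *)
    destruct (Z.le_gt_cases 0 n).
    - exists 0%nat. unfold N. lia.
    - destruct (Nat.le_gt_cases m (p + 1 + k)).
      + exists m. unfold N. lia.
      + exists (p + 1 + k)%nat. unfold N. lia. }
  assert (HzN : z <= INR (S N)) by (apply Rle_trans with (1 := Hx), le_INR; unfold N; lia).
  pose proof (besselY_neg (S N) z Hz HzN) as HY.
  pose proof (besselJ_bound (Z.abs_nat n) rho ltac:(lra)) as H2. rewrite Hn in *.
  replace (p + 1 + k)%nat with (S (p + k)) in * by lia.
  assert (HC : Cfun (S N) z <= Cfun (p + m + 1) z).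
  { replace (p + m + 1)%nat with (S (p + m)) by lia.
    replace (S N) with (S (p + m + k)) by (unfold N; lia). apply Cfun_le; assumption. }
  assert (Hh : 0 < z / 2) by lra.
  assert (Hhp : 0 < (z / 2) ^ S N) by (apply pow_lt, Hh).
  pose proof (fact_ge_1 N) as Hf. pose proof (fact_ge_1 (S (p + k))) as Hf'.
  assert (EY : - besselY_nat (S N) z = Cfun (S N) z * INR (fact N) / (PI * (z / 2) ^ S N)).
  { rewrite Cfun_S. field. repeat split; lra. }
  rewrite EY in H1.
  set (c := INR p + INR m / 2 + INR (S k)).
  assert (Hc : c = INR (S (p + k)) + INR m / 2).
  { unfold c. rewrite !S_INR, plus_INR. ring. }
  assert (Hc0 : 0 < c) by (rewrite Hc, S_INR; pose proof (pos_INR (p + k)); pose proof (pos_INR m); lra).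
  pose proof (fact_ratio_le m (p + k)) as HF. rewrite <- Hc in HF. fold N in HF.
  assert (HF' : INR (fact N) / INR (fact (S (p + k))) <= c ^ m / c).
  { apply Rmult_le_reg_r with (INR (fact (S (p + k))) * c); [nra|].
    replace (INR (fact N) / INR (fact (S (p + k))) * (INR (fact (S (p + k))) * c)) with (INR (fact N) * c)
      by (field; lra).
    replace (c ^ m / c * (INR (fact (S (p + k))) * c)) with (INR (fact (S (p + k))) * c ^ m)
      by (field; lra). exact HF. }
  assert (HCN : 0 < Cfun (S N) z).
  { rewrite Cfun_S. apply Rmult_lt_0_compat; [nra | apply Rdiv_lt_0_compat; lra]. }
  eapply Rle_trans.
  { apply Rmult_le_compat; [apply sqrt_pos | apply Rabs_pos | exact H1 | exact H2]. }
  assert (Epow : (rho / 2) ^ S (p + k) / (z / 2) ^ S N = (2 / z) ^ m * (rho / z) ^ (p + S k)).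
  { replace (p + S k)%nat with (S (p + k)) by lia.
    replace (S N) with (S (p + k) + m)%nat by (unfold N; lia).
    rewrite pow_add. unfold Rdiv. rewrite !Rpow_mult_distr, !pow_inv.
    field. repeat split; apply pow_nonzero; lra. }
  replace (sqrt 2 * (Cfun (S N) z * INR (fact N) / (PI * (z / 2) ^ S N)) *
    ((rho / 2) ^ S (p + k) / INR (fact (S (p + k))))) with
    (sqrt 2 * Cfun (S N) z / PI * ((rho / 2) ^ S (p + k) / (z / 2) ^ S N)
      * (INR (fact N) / INR (fact (S (p + k))))) by (field; repeat split; lra).
  rewrite Epow.
  assert (Hg : 0 < (2 / z) ^ m * (rho / z) ^ (p + S k)).
  { apply Rmult_lt_0_compat; apply pow_lt; apply Rdiv_lt_0_compat; lra. }
  assert (HCC : 0 <= sqrt 2 * Cfun (S N) z / PI <= sqrt 2 * Cfun (p + m + 1) z / PI).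
  { split; [apply Rdiv_le_0_compat; [apply Rmult_le_pos; lra | lra]|].
    apply Rmult_le_compat_r; [left; apply Rinv_0_lt_compat, HPI | apply Rmult_le_compat_l; lra]. }
  assert (0 <= INR (fact N) / INR (fact (S (p + k)))) by (apply Rdiv_le_0_compat; lra).
  rewrite !(Rmult_assoc (sqrt 2 * _ / PI)).
  apply Rmult_le_compat; [lra | | lra |].
  - apply Rmult_le_pos; lra.
  - rewrite <- (Rmult_assoc ((2 / z) ^ m)). apply Rmult_le_compat_l; [lra | exact HF'].
Qed.

Theorem theorem2 :
  forall (upper : bool) (m p : nat) (x y : R * R),
    0 < enorm y < enorm x ->
    let r := enorm y / enorm x in
    INR (p + m) >= enorm x ->
    INR p + INR m / 2 > - (INR m / ln r) ->
    graf_remainder_converges upper (Z.of_nat m) p x y /\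
    Cmod (graf_remainder upper (Z.of_nat m) p x y) <=
      (4 * sqrt 2 * Cfun (p + m + 1) (enorm x) * INR (2 * p + m) ^ m * r ^ p)
      / (PI * enorm x ^ m * (- INR (2 * p + m) * ln r - 2 * INR m)).
Proof.
  intros upper m p x y Hxy r Hpm Hln.
  set (z := enorm x) in *. set (rho := enorm y) in *.
  assert (Hz : 0 < z) by lra. pose proof PI_RGT_0 as HPI.
  assert (Hr : 0 < r < 1).
  { unfold r. split; [apply Rdiv_lt_0_compat; lra | apply Rlt_div_l; lra]. }
  assert (HL : ln r < 0) by (rewrite <- ln_1; apply ln_increasing; lra).
  assert (Hzpm : z <= INR (p + m)) by lra.
  assert (Hpm1 : (1 <= p + m)%nat).
  { destruct (p + m)%nat; [simpl in Hzpm; lra | lia]. }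
  set (a := INR p + INR m / 2) in *.
  assert (Ha2 : INR (2 * p + m) = 2 * a).
  { unfold a. rewrite plus_INR, mult_INR. simpl (INR 2). field. }
  assert (Ha : 0 < a).
  { unfold a. rewrite plus_INR in Hzpm. pose proof (pos_INR p). lra. }
  assert (HaL : 0 < - (a * ln r) - INR m).
  { assert (H : - (INR m / ln r) * - ln r < a * - ln r) by (apply Rmult_lt_compat_r; lra).
    replace (- (INR m / ln r) * - ln r) with (INR m) in H by (field; lra). lra. }
  (* The rate of the geometric majorant: the decay of r^n reduced by the growth exp(m t / a) of the
     power. *)
  set (l := - ln r - INR m / a).
  assert (Hl : 0 < l).
  { unfold l. replace (- ln r - INR m / a) with ((- (a * ln r) - INR m) / a) by (field; lra).
    apply Rdiv_lt_0_compat; assumption. }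
  set (D := sqrt 2 * Cfun (p + m + 1) z / PI * (2 / z) ^ m * (r ^ p * (a ^ m / a))).
  assert (Hs2 : 0 < sqrt 2) by (apply sqrt_lt_R0; lra).
  assert (HC : 0 < Cfun (p + m + 1) z).
  { replace (p + m + 1)%nat with (S (p + m)) by lia. rewrite Cfun_S.
    assert (HzS : z <= INR (S (p + m))) by (rewrite S_INR; lra).
    pose proof (besselY_neg (S (p + m)) z Hz HzS). pose proof (fact_ge_1 (p + m)).
    assert (0 < (z / 2) ^ S (p + m)) by (apply pow_lt; lra).
    apply Rmult_lt_0_compat; [nra | apply Rdiv_lt_0_compat; lra]. }
  assert (HA : 0 < sqrt 2 * Cfun (p + m + 1) z / PI * (2 / z) ^ m).
  { apply Rmult_lt_0_compat; [apply Rdiv_lt_0_compat; [apply Rmult_lt_0_compat; lra | lra]|].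
    apply pow_lt, Rdiv_lt_0_compat; lra. }
  assert (HD : 0 <= D).
  { unfold D. apply Rmult_le_pos; [lra|]. apply Rmult_le_pos; [apply pow_le; lra|].
    apply Rdiv_le_0_compat; [apply pow_le; lra | exact Ha]. }
  assert (Hterm : forall k n, Z.abs_nat n = (p + 1 + k)%nat ->
    Cmod (graf_term upper (Z.of_nat m) x y n) <= D * exp (- l) ^ S k).
  { intros k n Hn.
    eapply Rle_trans; [apply (graf_term_bound upper m p k n x y Hxy Hpm1 Hzpm Hn)|].
    fold z rho r a. unfold D. rewrite (Rmult_assoc _ (r ^ p * _)).
    apply Rmult_le_compat_l; [lra|].
    rewrite pow_add, !Rmult_assoc. apply Rmult_le_compat_l; [apply pow_le; lra|].
    apply Rle_trans with (r ^ S k * (a ^ m / a * exp (INR m * INR (S k) / a))).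
    - apply Rmult_le_compat_l; [apply pow_le; lra|].
      apply shifted_power_le; [exact Ha | apply pos_INR].
    - right. rewrite exp_pow. rewrite <- (exp_ln r) at 1 by lra. rewrite exp_pow.
      transitivity (a ^ m / a * (exp (INR (S k) * ln r) * exp (INR m * INR (S k) / a))); [ring|].
      rewrite <- exp_plus. f_equal. f_equal. unfold l. field. lra. }
  destruct (geometric_tail D l HD Hl) as [s [Hs Hsle]].
  destruct (CSeries_bound (graf_tail_pos upper (Z.of_nat m) p x y)
    (fun k => D * exp (- l) ^ S k) s) with (2 := Hs) as [E1 B1].
  { intros k. apply Hterm. lia. }
  destruct (CSeries_bound (graf_tail_neg upper (Z.of_nat m) p x y)
    (fun k => D * exp (- l) ^ S k) s) with (2 := Hs) as [E2 B2].
  { intros k. apply Hterm. lia. }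
  split; [split; assumption|].
  unfold graf_remainder. eapply Rle_trans; [apply Cmod_triangle|].
  (* Equality from here on: (2/z)^m a^m = (2a)^m / z^m with 2a = 2p + m, and a l = (- 2a ln r -
     2m)/2. *)
  apply Rle_trans with (2 * (D / l)); [lra|]. right.
  rewrite Ha2. unfold D, l. unfold Rdiv. rewrite !Rpow_mult_distr, !pow_inv.
  assert (0 < z ^ m) by (apply pow_lt, Hz).
  field. repeat split; try lra.
Qed.
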